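(* Let $(I=I_\circ\sqcup I_\bullet,\tau)$ be a super Satake diagram of type A with admissible parameters, and let $i\in I_{\bar0}$, $j\in I$ with $i\sim j$ (i.e. $i\neq j$ and $a_{ij}\ne0$). Then the element $\mathrm{Rem}^{p_2}_{i,j}:=p_2(B_i,B_j)=[B_i,[B_i,B_j]_{q_i^{-1}}]_{q_i}$ of $\mathbf U^\imath$ is given by $$\mathrm{Rem}^{p_2}_{i,j}=\begin{cases}q_i\varsigma_iB_j,&\text{if } i=\tau i\in I_\circ,\ j\in I_\circ,\\[1mm] \varsigma_i\Bigl(\dfrac{q_i^2B_j\mathcal Z_i-\mathcal Z_iB_j}{q_i-q_i^{-1}}+\dfrac{q_i+q_i^{-1}}{q_j-q_j^{-1}}W_{i,j}K_j\Bigr),&\text{if } i=\tau i\in I_\circ,\ j\in I_\bullet,\\[2mm] -[2]_{q_i}\bigl(q_i\varsigma_j\mathcal Z_j+q_i^{-2}\varsigma_i\mathcal Z_i\bigr)B_i,&\text{if } i=\tau j\in I_\circ,\\[1mm] 0,&\text{otherwise.}\end{cases}$$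
   Context: **Root data.** The base field is $\mathbb C(q)$, $q$ an indeterminate. Let $V=V_{\bar0}\oplus V_{\bar1}$ be a complex superspace with $\dim V_{\bar0}=m$, $\dim V_{\bar1}=n$, with a homogeneous basis $v_1,\dots,v_{m+n}$ (any order of parities), $\mathfrak g=\mathfrak{gl}(V)$. Parities are denoted $|\cdot|\in\mathbb Z_2$. $P=\bigoplus_a\mathbb Z\epsilon_a$ has the form $(\epsilon_a,\epsilon_b)=(-1)^{|v_a|}\delta_{ab}$; $P^\vee=\bigoplus_a\mathbb Z\epsilon_a^\vee$, $\langle\epsilon_a^\vee,\epsilon_b\rangle=\delta_{ab}$; $|\epsilon_a|=|v_a|$. $I=\{1,\dots,m+n-1\}$, $\alpha_i=\epsilon_i-\epsilon_{i+1}$, $|i|=|\alpha_i|=|\epsilon_i|+|\epsilon_{i+1}|$, $h_i=\epsilon_i^\vee-(-1)^{|i|}\epsilon_{i+1}^\vee$, $a_{ij}=\langle h_i,\alpha_j\rangle$, $d_i=(-1)^{|\epsilon_i|}$, so $(\alpha_i,\alpha_j)=d_ia_{ij}$; $q_i=q^{d_i}$; $[2]_{q_i}=q_i+q_i^{-1}$. $X=\bigoplus\mathbb Z\alpha_i$, $Y=\bigoplus\mathbb Zh_i$, $X^+=\bigoplus\mathbb Z_{\ge0}\alpha_i$; $\mu>\gamma$ means $\mu-\gamma\in X^+$, $\mu\ne\gamma$. $I_{\bar0},I_{\bar1}$ are the sets of even, odd $i\in I$. For homogeneous $x,y$: $[x,y]_a=xy-(-1)^{|x||y|}a\,yx$,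 $[x,y]=[x,y]_1$. **Quantum enveloping superalgebra.** $\mathbf U$ is the unital associative $\mathbb C(q)$-superalgebra generated by $E_i,F_i$ ($i\in I$, of parity $|i|$) and even $K_h$ ($h\in P^\vee$) with relations: $K_0=1$, $K_hK_{h'}=K_{h+h'}$; $K_hE_i=q^{\langle h,\alpha_i\rangle}E_iK_h$, $K_hF_i=q^{-\langle h,\alpha_i\rangle}F_iK_h$; $[E_i,F_j]=\delta_{ij}\frac{K_i-K_i^{-1}}{q_i-q_i^{-1}}$ with $K_i:=K_{h_i}^{d_i}$; $[E_i,E_j]=0=[F_i,F_j]$ if $a_{ij}=0$; $[E_i,[E_i,E_j]_{q_i^{-1}}]_{q_i}=0=[F_i,[F_i,F_j]_{q_i^{-1}}]_{q_i}$ if $|a_{ij}|=1$, $|i|=\bar0$; and $[[[E_{j-1},E_j]_{q_j},E_{j+1}]_{q_{j+1}},E_j]=0=[[[F_{j-1},F_j]_{q_j},F_{j+1}]_{q_{j+1}},F_j]$ if $1<j<m+n-1$, $|j|=\bar1$. It is a Hopf superalgebra with coproduct $\Delta(E_i)=E_i\otimes1+K_i\otimes E_i$, $\Delta(F_i)=F_i\otimes K_i^{-1}+1\otimes F_i$, $\Delta(K_h)=K_h\otimes K_h$. $\mathbf U^+$ is the subalgebra generated by all $E_i$, and $\mathbf U^+_\gamma$ its component of weight $\gamma\in X^+$ (where $E_i$ has weight $\alpha_i$). For $i\in I_{\bar0}$, $T_i$ is the superalgebra automorphism of $\mathbf U$ with $T_i(E_i)=-F_iK_i$, $T_i(F_i)=-K_i^{-1}E_i$;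 $T_i(E_j)=E_j$, $T_i(F_j)=F_j$ if $|j-i|>1$; $T_i(E_j)=E_iE_j-q^{(\alpha_i,\alpha_j)}E_jE_i$, $T_i(F_j)=F_jF_i-q^{-(\alpha_i,\alpha_j)}F_iF_j$ if $|j-i|=1$; $T_i(K_h)=K_{s_i(h)}$, $s_i(h)=h-\langle h,\alpha_i\rangle h_i$. The $T_i$ satisfy the braid relations. **Super Satake diagrams of type A.** A pair $(I=I_\circ\sqcup I_\bullet,\tau)$ with $I_\bullet\subseteq I_{\bar0}$ (''black'' nodes; $I_\circ$ are ''white'') and $\tau$ a parity-preserving diagram symmetry ($\tau=\mathrm{id}$ or $\tau(i)=m+n-i$) such that, with $W_\bullet=\langle s_j: j\in I_\bullet\rangle$, $w_\bullet$ its longest element, $\rho_\bullet^\vee$ half the sum of positive coroots of the subsystem of $I_\bullet$: (1) $\tau^2=\mathrm{id}$; (2) $\tau(I_\bullet)=I_\bullet$ and $-w_\bullet(\alpha_i)=\alpha_{\tau i}$ for $i\in I_\bullet$; (3) if $j\in I_{\bar0}\cap I_\circ$ and $\tau j=j$ then $\langle\rho_\bullet^\vee,\alpha_j\rangle\in\mathbb Z$; (4) if $j\in I_{\bar1}\cap I_\circ$ and $\tau j=j$ then $\langle\rho_\bullet^\vee,\alpha_j\rangle\ne0$; and, when $\tau=\mathrm{id}$, every odd node is adjacent to exactly one black node. (Explicitly: for $\tau=\mathrm{id}$ black nodes are pairwise non-adjacent, each white even node has $0$ or $2$ black neighbours, each odd node exactly one; for $\tau\neq\mathrm{id}$, $I_\bullet$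 is empty or a $\tau$-stable central interval, and a white $\tau$-fixed node is even.) **$\imath$Quantum enveloping superalgebra.** $\tau$ acts on $Y$ by $\tau(h_i)=h_i$ if $\tau i=i$ and $\tau(h_i)=(-1)^{|i|}h_{\tau i}$ if $\tau i\ne i$. $Y^\imath=\{h\in Y\mid -w_\bullet\tau(h)=h\}$; $\mathbf U^{\imath0}$ is the subalgebra generated by $K_h$, $h\in Y^\imath$. $T_{w_\bullet}=T_{i_1}\cdots T_{i_k}$ for a reduced expression $w_\bullet=s_{i_1}\cdots s_{i_k}$. For parameters $\varsigma_i\in\mathbb C(q)^*$, $\kappa_i\in\mathbb C(q)$ ($i\in I_\circ$), $\mathbf U^\imath$ is the subalgebra of $\mathbf U$ generated by $\mathbf U^{\imath0}$, $E_i,F_i$ ($i\in I_\bullet$) and $B_i=F_i+\varsigma_iT_{w_\bullet}(E_{\tau i})K_i^{-1}+\kappa_iK_i^{-1}$ ($i\in I_\circ$). Set $B_i=F_i$ for $i\in I_\bullet$. Let $I_{\mathrm{ns}}=\{i\in I_\circ\mid\tau i=i,\ \langle h_j,\alpha_i\rangle=0\ \forall j\in I_\bullet\}$. Admissible parameters: (a) $\kappa_i=0$ unless $i\in I_{\mathrm{ns}}$ and $\langle h_k,\alpha_i\rangle\in2\mathbb Z$ for all $k\in I_{\mathrm{ns}}\setminus\{i\}$; (b) $\varsigma_i=\varsigma_{\tau i}$ if $(\alpha_i,\alpha_{\tau i})=0$ and $w_\bullet(\alpha_i)=\alpha_i$; (c) $\varsigma_i=\varsigma_{\tau i}$ if $|i|=\bar1$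 and $(\alpha_i,\alpha_{\tau i})\in2\mathbb Z\setminus\{0\}$. $\mathbf U_\bullet^+$ is the subalgebra generated by $E_i$, $i\in I_\bullet$. **The elements $\mathcal Z_i$ and $W_{i,j}$.** For $i\in I_\circ$, $\mathcal Z_i$ is the element uniquely determined by the summand of $\Delta(T_{w_\bullet}(E_{\tau i})K_i^{-1})$ whose second tensor factor is $E_{\tau i}K_i^{-1}$, i.e. by $$\Delta\bigl(T_{w_\bullet}(E_{\tau i})K_i^{-1}\bigr)\in T_{w_\bullet}(E_{\tau i})K_i^{-1}\otimes K_i^{-1}+\mathcal Z_i\otimes E_{\tau i}K_i^{-1}+\mathbf U\otimes\sum_{\gamma>\alpha_{\tau i}}\mathbf U^+_\gamma K_i^{-1}.$$ For $i=\tau i\in I_\circ$ and $j\in I_\bullet$, $W_{i,j}\in\mathbf U_\bullet^+$ is the element determined by the summand with second tensor factor $T_j(E_i)K_i^{-1}$, i.e. by $$\Delta\bigl(T_{w_\bullet}(E_i)K_i^{-1}\bigr)\in T_{w_\bullet}(E_i)K_i^{-1}\otimes K_i^{-1}+\mathcal Z_i\otimes E_iK_i^{-1}+W_{i,j}K_j\otimes T_j(E_i)K_i^{-1}+\mathbf U\otimes\sum_{\gamma>\alpha_i,\ \gamma\ne\alpha_i+\alpha_j}\mathbf U^+_\gamma K_i^{-1}.$$ The quantum Serre polynomial here is $p_2(x_i,x_j)=[x_i,[x_i,x_j]_{q_i^{-1}}]_{q_i}$, with $x_i$ of parity $|i|$. *)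

(* Defs.v *)
From HB Require Import structures.
From mathcomp Require Import all_boot all_order all_algebra.
From mathcomp Require Import boolp classical_sets fsbigop reals.
From mathcomp Require Import complex.

Set Implicit Arguments.
Unset Strict Implicit.
Unset Printing Implicit Defensive.

Import Order.TTheory GRing.Theory Num.Theory.

Local Open Scope ring_scope.
Local Open Scope quotient_scope.

Definition Cq (R : realType) : fieldType := {fraction {poly R[i]}}.
Definition qvar (R : realType) : Cq R := tofrac 'X.

(** N = dim V, and [par a] is the parity of the a-th basis vector (true = odd).
   Basis vectors and nodes are numbered from 0, so the nodes are 'I_N.-1. Both
   lattices P and P^vee are 'rV[int]_N, in the dual bases epsilon_a and
   epsilon_a^vee. *)

Section RootDatum.
Variables (N : nat) (par : 'I_N -> bool).
Local Notation I := 'I_N.-1.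
Implicit Types (i j : I) (h l : 'rV[int]_N).

Definition lo i : 'I_N := widen_ord (leq_pred N) i.
Definition hi i : 'I_N := Ordinal (etrans (esym (ltn_predRL i N)) (ltn_ord i)).

Definition eps (a : 'I_N) : 'rV[int]_N := delta_mx 0 a.
Definition alpha i : 'rV[int]_N := eps (lo i) - eps (hi i).
Definition npar i : bool := par (lo i) (+) par (hi i).
Definition hcoroot i : 'rV[int]_N :=
  eps (lo i) - ((-1) ^+ npar i : int) *: eps (hi i).

Definition cpair h l : int := \sum_a h 0 a * l 0 a.
Definition wform l1 l2 : int := \sum_a (-1) ^+ par a * l1 0 a * l2 0 a.
Definition cartan i j : int := cpair (hcoroot i) (alpha j).
Definition dsgn i : int := (-1) ^+ par (lo i).

(** [adj i j] is i ~ j. *)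
Definition adj i j : bool := (i != j) && (cartan i j != 0).

Definition in_Xplus l : Prop :=
  exists c : I -> nat, l = \sum_i alpha i *+ c i.
Definition root_gt (mu gamma : 'rV[int]_N) : Prop :=
  in_Xplus (mu - gamma) /\ mu <> gamma.

Definition srefl i l : 'rV[int]_N := l - cpair (hcoroot i) l *: alpha i.
Definition scorefl i h : 'rV[int]_N := h - cpair h (alpha i) *: hcoroot i.
Definition wact (w : seq I) l := foldr srefl l w.
Definition cowact (w : seq I) h := foldr scorefl h w.

(** Words in s_j (j in D) representing elements of W_D; lengths are the minimal
   numbers of letters, and elements are compared through their action on P. *)
Definition word_on (D : {set I}) (w : seq I) : bool := all [in D] w.
Definition reduced_on (D : {set I}) (w : seq I) : Prop :=
  word_on D w /\
  forall v, word_on D v -> wact v =1 wact w -> (size w <= size v)%N.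
Definition longest_on (D : {set I}) (w : seq I) : Prop :=
  reduced_on D w /\ forall v, reduced_on D v -> (size v <= size w)%N.

(** Positive coroots of the subsystem generated by D, and twice the half sum
   rho_D^vee of them. *)
Definition pos_coroots (D : {set I}) : set 'rV[int]_N :=
  [set h | (exists w j, [/\ word_on D w, j \in D & h = cowact w (hcoroot j)]) /\
           (exists c : I -> nat, h = \sum_(i in D) hcoroot i *+ c i)].
Definition rho2 (D : {set I}) : 'rV[int]_N := \sum_(h \in pos_coroots D) h.

(** Super Satake diagrams of type A. [black] is the set of black nodes and [w] a
   reduced word of the longest element of W_black. *)
Record super_satake (black : {set I}) (tau : I -> I) (w : seq I) : Prop :=
  SuperSatake {
    satake_black_even : forall i, i \in black -> ~~ npar i;
    satake_tau : tau =1 id \/ tau =1 @rev_ord N.-1;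
    satake_tau_par : forall i, npar (tau i) = npar i;
    satake_tauK : involutive tau;
    satake_tau_black : tau @: black = black;
    satake_w_black : forall i, i \in black -> - wact w (alpha i) = alpha (tau i);
    (* <rho_black^vee, alpha_j> is an integer *)
    satake_white_even : forall j, j \notin black -> ~~ npar j -> tau j = j ->
      (2 %| cpair (rho2 black) (alpha j))%Z;
    satake_white_odd : forall j, j \notin black -> npar j -> tau j = j ->
      cpair (rho2 black) (alpha j) != 0;
    satake_tau_id : tau =1 id -> forall j, npar j ->
      #|[set k in black | adj j k]| = 1%N
  }.

Definition in_ns (black : {set I}) (tau : I -> I) i : Prop :=
  [/\ i \notin black, tau i = i & forall j, j \in black -> cartan j i = 0].

(** [y_tau tau h h']: h lies in Y, and tau(h) = h'. *)
Definition y_tau (tau : I -> I) h (h' : 'rV[int]_N) : Prop :=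
  exists2 c : I -> int, h = \sum_i c i *: hcoroot i &
    h' = \sum_i c i *: (if tau i == i then hcoroot i
                        else ((-1) ^+ npar i : int) *: hcoroot (tau i)).

Definition in_Yi (tau : I -> I) (w : seq I) h : Prop :=
  exists2 h', y_tau tau h h' & - cowact w h' = h.

End RootDatum.

Record admissible (k : fieldType) N (par : 'I_N -> bool) (black : {set 'I_N.-1})
    (tau : 'I_N.-1 -> 'I_N.-1) (w : seq 'I_N.-1)
    (vsig kappa : 'I_N.-1 -> k) : Prop := Admissible {
  adm_vsig_neq0 : forall i, i \notin black -> vsig i != 0;
  adm_kappa : forall i, i \notin black ->
    ~ (in_ns par black tau i /\
       forall j, in_ns par black tau j -> j <> i -> (2 %| cartan par j i)%Z) ->
    kappa i = 0;
  adm_vsig_fix : forall i, i \notin black ->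
    wform par (alpha i) (alpha (tau i)) = 0 -> wact par w (alpha i) = alpha i ->
    vsig i = vsig (tau i);
  adm_vsig_odd : forall i, i \notin black -> npar par i ->
    (2 %| wform par (alpha i) (alpha (tau i)))%Z ->
    wform par (alpha i) (alpha (tau i)) != 0 ->
    vsig i = vsig (tau i)
}.

(** [sbr a b c x y] is [x, y]_c for x of parity a and y of parity b. *)
Definition sbr (k : fieldType) (A : algType k) (a b : bool) (c : k) (x y : A) : A :=
  x * y - ((-1) ^+ (a && b) * c) *: (y * x).

Inductive gen_subalg (k : fieldType) (A : algType k) (G : A -> Prop) : A -> Prop :=
| GenIn x of G x : gen_subalg G x
| Gen1 : gen_subalg G 1
| GenD x y of gen_subalg G x & gen_subalg G y : gen_subalg G (x + y)
| GenM x y of gen_subalg G x & gen_subalg G y : gen_subalg G (x * y)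
| GenZ c x of gen_subalg G x : gen_subalg G (c *: x).

(** Tensor product: finite formal sums of pairs modulo the relation of having
   the same image under every bilinear map. *)

Section Tensor.
Variables (k : fieldType) (V W : lmodType k).

Definition tsum (M : lmodType k) (f : V -> W -> M) (s : seq (V * W)) : M :=
  \sum_(x <- s) f x.1 x.2.

Definition tens_eqv (s t : seq (V * W)) : bool :=
  `[< forall (M : lmodType k) (f : {bilinear V -> W -> M}), tsum f s = tsum f t >].

Lemma tens_eqvP : equiv_class_of tens_eqv.
Proof.
split=> [s|s t|t s u].
- by apply/asboolP.
- by apply/asboolP/asboolP=> H M f; rewrite H.
- by move=> /asboolP H1 /asboolP H2; apply/asboolP=> M f; rewrite H1 H2.
Qed.

Canonical tens_equiv := EquivRelPack tens_eqvP.

Definition tensor := {eq_quot tens_equiv}.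
HB.instance Definition _ := Choice.on tensor.
HB.instance Definition _ := EqQuotient.on tensor.

Definition tclass (s : seq (V * W)) : tensor := \pi_tensor s.

Lemma tclassP s t : tclass s = tclass t <->
  forall (M : lmodType k) (f : {bilinear V -> W -> M}), tsum f s = tsum f t.
Proof.
split; first by move=> /eqmodP /asboolP.
by move=> H; apply/eqmodP/asboolP.
Qed.

Lemma tclassK t : tclass (repr t) = t. Proof. exact: reprK. Qed.

Lemma tsum_repr s (M : lmodType k) (f : {bilinear V -> W -> M}) :
  tsum f (repr (tclass s)) = tsum f s.
Proof. by have /tclassP := tclassK (tclass s); apply. Qed.

Definition tscale_seq (c : k) (s : seq (V * W)) := [seq (c *: x.1, x.2) | x <- s].

Definition tzero : tensor := tclass [::].
Definition tadd (t u : tensor) : tensor := tclass (repr t ++ repr u).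
Definition tscale (c : k) (t : tensor) : tensor := tclass (tscale_seq c (repr t)).
Definition topp (t : tensor) : tensor := tscale (-1) t.

Lemma tsum_cat (M : lmodType k) (f : V -> W -> M) s t :
  tsum f (s ++ t) = tsum f s + tsum f t.
Proof. exact: big_cat. Qed.

Lemma tsum_scale (M : lmodType k) (f : {bilinear V -> W -> M}) c s :
  tsum f (tscale_seq c s) = c *: tsum f s.
Proof.
rewrite /tsum big_map scaler_sumr; apply: eq_bigr => x _ /=.
by rewrite linearZl_LR.
Qed.

Fact taddA : associative tadd.
Proof.
move=> t u v; apply/tclassP => M f.
by rewrite !tsum_cat !tsum_repr !tsum_cat addrA.
Qed.

Fact taddC : commutative tadd.
Proof. by move=> t u; apply/tclassP => M f; rewrite !tsum_cat addrC. Qed.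

Fact tadd0 : left_id tzero tadd.
Proof.
move=> t; rewrite -[RHS]tclassK; apply/tclassP => M f.
by rewrite tsum_cat tsum_repr /tsum big_nil add0r.
Qed.

Fact taddN : left_inverse tzero topp tadd.
Proof.
move=> t; apply/tclassP => M f.
by rewrite tsum_cat tsum_repr tsum_scale scaleN1r addNr /tsum big_nil.
Qed.

HB.instance Definition _ := GRing.isZmodule.Build tensor taddA taddC tadd0 taddN.

Fact tscaleA a b t : tscale a (tscale b t) = tscale (a * b) t.
Proof.
by apply/tclassP => M f; rewrite !tsum_scale tsum_repr tsum_scale scalerA.
Qed.

Fact tscale1 : left_id 1 tscale.
Proof.
move=> t; rewrite -[RHS]tclassK; apply/tclassP => M f.
by rewrite tsum_scale scale1r.
Qed.

Fact tscaleDr : right_distributive tscale +%R.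
Proof.
move=> a t u; apply/tclassP => M f.
by rewrite tsum_cat !tsum_scale !tsum_repr tsum_cat !tsum_scale scalerDr.
Qed.

Fact tscaleDl t : {morph tscale^~ t : a b / a + b}.
Proof.
move=> a b; apply/tclassP => M f.
by rewrite tsum_cat !tsum_repr !tsum_scale scalerDl.
Qed.

HB.instance Definition _ :=
  GRing.Zmodule_isLmodule.Build k tensor tscaleA tscale1 tscaleDr tscaleDl.

Definition tens (x : V) (y : W) : tensor := tclass [:: (x, y)].

Definition tlift (M : lmodType k) (f : {bilinear V -> W -> M}) (t : tensor) : M :=
  tsum f (repr t).

Lemma tlift_tens (M : lmodType k) (f : {bilinear V -> W -> M}) x y :
  tlift f (tens x y) = f x y.
Proof. by rewrite /tlift tsum_repr /tsum big_seq1. Qed.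

Lemma tens_is_bilinear : bilinear_for *:%R *:%R tens.
Proof.
split=> [y a x x'|x a y y']; apply/tclassP => M f;
  rewrite tsum_cat !tsum_repr tsum_scale tsum_repr /tsum !big_seq1 /=.
- by rewrite linearPl.
- by rewrite linearPr.
Qed.

HB.instance Definition _ :=
  bilinear_isBilinear.Build k V W tensor *:%R *:%R tens tens_is_bilinear.

Lemma tensPl y a x x' : tens (a *: x + x') y = a *: tens x y + tens x' y.
Proof. exact: tens_is_bilinear.1. Qed.

Lemma tensPr x a y y' : tens x (a *: y + y') = a *: tens x y + tens x y'.
Proof. exact: tens_is_bilinear.2. Qed.

Lemma tclassE s : tclass s = \sum_(x <- s) tens x.1 x.2.
Proof.
elim: s => [|[x y] s IH]; first by rewrite big_nil.
rewrite big_cons -IH; apply/tclassP => M f.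
by rewrite tsum_cat !tsum_repr -tsum_cat.
Qed.

Lemma tlift_is_linear (M : lmodType k) (f : {bilinear V -> W -> M}) :
  linear (tlift f).
Proof.
move=> a t u; rewrite /tlift.
by rewrite tsum_repr tsum_cat tsum_repr tsum_scale.
Qed.

End Tensor.

(** Product of the tensor square of a superalgebra A with parity involution s
   (identity on the even part, -1 on the odd part, characteristic not 2):
   (a (x) b)(c (x) d) = (-1)^{|b||c|} ac (x) bd on homogeneous elements. *)
Section SuperTensor.
Variables (k : fieldType) (A : algType k) (s : {linear A -> A}).

Definition even_part (x : A) : A := 2^-1 *: (x + s x).
Definition odd_part (x : A) : A := 2^-1 *: (x - s x).

Definition smul_pure (a b c d : A) : tensor A A :=
  tens (a * c) (even_part b * d) + tens (a * s c) (odd_part b * d).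

Definition smul (t u : tensor A A) : tensor A A :=
  \sum_(x <- repr t) \sum_(y <- repr u) smul_pure x.1 x.2 y.1 y.2.

Lemma smul_pure_bilinear_r a b : bilinear_for *:%R *:%R (smul_pure a b).
Proof.
split=> [d z c c'|c z d d']; rewrite /smul_pure.
  rewrite !linearP !mulrDr -!scalerAr !tensPl addrACA.
  by congr (_ + _); rewrite -scalerDr.
rewrite !mulrDr -!scalerAr !tensPr addrACA.
by congr (_ + _); rewrite -scalerDr.
Qed.

HB.instance Definition _ a b := bilinear_isBilinear.Build k A A (tensor A A)
  *:%R *:%R (smul_pure a b) (smul_pure_bilinear_r a b).

Definition smul_l (u : tensor A A) (a b : A) : tensor A A :=
  \sum_(y <- repr u) smul_pure a b y.1 y.2.

Lemma even_partP z : {morph even_part : b b' / z *: b + b'}.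
Proof.
move=> b b'; rewrite /even_part linearP addrACA -(scalerDr z).
by rewrite (scalerDr 2^-1) scalerA mulrC -scalerA.
Qed.

Lemma odd_partP z : {morph odd_part : b b' / z *: b + b'}.
Proof.
move=> b b'; rewrite /odd_part linearP opprD addrACA -(scalerBr z).
by rewrite (scalerDr 2^-1) scalerA mulrC -scalerA.
Qed.

Lemma smul_l_bilinear u : bilinear_for *:%R *:%R (smul_l u).
Proof.
split=> [b z a a'|a z b b']; rewrite /smul_l [X in _ = X + _]scaler_sumr -big_split;
  apply: eq_bigr => -[c d] _; rewrite /smul_pure /=.
  rewrite !mulrDl -!scalerAl !tensPl addrACA.
  by congr (_ + _); rewrite -scalerDr.
rewrite even_partP odd_partP !mulrDl -!scalerAl !tensPr addrACA.
by congr (_ + _); rewrite -scalerDr.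
Qed.

HB.instance Definition _ u := bilinear_isBilinear.Build k A A (tensor A A)
  *:%R *:%R (smul_l u) (smul_l_bilinear u).

Lemma smul_tens a b c d : smul (tens a b) (tens c d) = smul_pure a b c d.
Proof.
rewrite -[LHS]/(tsum (smul_l (tens c d)) (repr (tens a b))) tsum_repr.
rewrite /tsum big_seq1 /= -[LHS]/(tsum (smul_pure a b) (repr (tens c d))).
by rewrite tsum_repr /tsum big_seq1.
Qed.

Lemma smul_koszul (pb pc : bool) a b c d : 2 != 0 :> k ->
  s b = (-1) ^+ pb *: b -> s c = (-1) ^+ pc *: c ->
  smul (tens a b) (tens c d) = (-1) ^+ (pb && pc) *: tens (a * c) (b * d).
Proof.
move=> n2 sb sc; rewrite smul_tens /smul_pure /even_part /odd_part sb sc.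
have half (x : A) : 2^-1 *: (x + x) = x.
  by rewrite -[x in x + x]scale1r -scalerDl scalerA mulVf ?scale1r.
case: pb {sb} => /=; rewrite ?expr1 ?expr0 ?scaleN1r ?scale1r ?opprK ?subrr ?scaler0.
  rewrite half mul0r linear0r add0r -scalerAr linearZl_LR.
  by case: pc {sc}.
by rewrite half mul0r linear0r addr0.
Qed.

End SuperTensor.

Section Relations.
Variables (k : fieldType) (q : k) (N : nat) (par : 'I_N -> bool).
Local Notation I := 'I_N.-1.
Local Notation npar := (npar par).
Local Notation hcoroot := (hcoroot par).
Local Notation cartan := (cartan par).
Local Notation dsgn := (dsgn par).

Definition qi (i : I) : k := q ^ dsgn i.

(** K_i = K_{h_i}^{d_i} is K at this vector. *)
Definition Kvec (i : I) : 'rV[int]_N := dsgn i *: hcoroot i.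

(** p_2(x, y) for x, y of parities |i|, |j|. *)
Definition p2 (A : algType k) (i j : I) (x y : A) : A :=
  sbr (npar i) (npar i (+) npar j) (qi i) x
    (sbr (npar i) (npar j) (qi i)^-1 x y).

Definition quartic (A : algType k) (a b c : I) (x y z : A) : A :=
  sbr (npar a (+) npar b (+) npar c) (npar b) 1
    (sbr (npar a (+) npar b) (npar c) (qi c)
       (sbr (npar a) (npar b) (qi b) x y) z) y.

Record Urel (A : algType k) (E F : I -> A) (K : 'rV[int]_N -> A) : Prop :=
  URel {
    UrelK0 : K 0 = 1;
    UrelKD : forall h h', K (h + h') = K h * K h';
    UrelKE : forall h i, K h * E i = q ^ cpair h (alpha i) *: (E i * K h);
    UrelKF : forall h i, K h * F i = q ^ (- cpair h (alpha i)) *: (F i * K h);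
    UrelEF : forall i j, sbr (npar i) (npar j) 1 (E i) (F j) =
      if i == j
      then (qi i - (qi i)^-1)^-1 *: (K (Kvec i) - K (- Kvec i)) else 0;
    UrelEE : forall i j, cartan i j = 0 -> sbr (npar i) (npar j) 1 (E i) (E j) = 0;
    UrelFF : forall i j, cartan i j = 0 -> sbr (npar i) (npar j) 1 (F i) (F j) = 0;
    UrelE2 : forall i j, `|cartan i j| = 1 -> ~~ npar i -> p2 i j (E i) (E j) = 0;
    UrelF2 : forall i j, `|cartan i j| = 1 -> ~~ npar i -> p2 i j (F i) (F j) = 0;
    UrelE4 : forall a b c : I, b = a.+1 :> nat -> c = b.+1 :> nat -> npar b ->
      quartic a b c (E a) (E b) (E c) = 0;
    UrelF4 : forall a b c : I, b = a.+1 :> nat -> c = b.+1 :> nat -> npar b ->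
      quartic a b c (F a) (F b) (F c) = 0
  }.

(** U is the algebra of expressions in the generators modulo the equalities that
   hold in every algebra satisfying the relations. *)
Inductive term :=
| TE of I
| TF of I
| TK of 'rV[int]_N
| TC of k
| TD of term & term
| TM of term & term.

HB.instance Definition _ := gen_eqMixin term.
HB.instance Definition _ := gen_choiceMixin term.

Fixpoint ev (A : algType k) (E F : I -> A) (K : 'rV[int]_N -> A) (t : term) : A :=
  match t with
  | TE i => E i
  | TF i => F i
  | TK h => K h
  | TC c => c%:A
  | TD t1 t2 => ev E F K t1 + ev E F K t2
  | TM t1 t2 => ev E F K t1 * ev E F K t2
  end.

Definition Ueqv (s t : term) : bool :=
  `[< forall (A : algType k) E F K, Urel E F K ->
        ev E F K s = ev E F K t :> A >].

Lemma UeqvP : equiv_class_of Ueqv.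
Proof.
split=> [s|s t|t s u].
- by apply/asboolP.
- by apply/asboolP/asboolP=> H A E F K r; rewrite (H _ _ _ _ r).
- move=> /asboolP H1 /asboolP H2; apply/asboolP=> A E F K r.
  by rewrite (H1 _ _ _ _ r) (H2 _ _ _ _ r).
Qed.

Canonical Uequiv := EquivRelPack UeqvP.

Definition U := {eq_quot Uequiv}.
HB.instance Definition _ := Choice.on U.
HB.instance Definition _ := EqQuotient.on U.

Definition Ucl (t : term) : U := \pi_U t.

Lemma UclP s t : Ucl s = Ucl t <->
  forall (A : algType k) E F K, Urel E F K -> ev E F K s = ev E F K t :> A.
Proof.
split; first by move=> /eqmodP /asboolP.
by move=> H; apply/eqmodP/asboolP.
Qed.

Lemma UclK x : Ucl (repr x) = x. Proof. exact: reprK. Qed.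

Lemma ev_repr (A : algType k) E F K (r : @Urel A E F K) t :
  ev E F K (repr (Ucl t)) = ev E F K t.
Proof. by have /UclP := UclK (Ucl t); apply. Qed.

Definition Uzero := Ucl (TC 0).
Definition Uone := Ucl (TC 1).
Definition Uadd (x y : U) := Ucl (TD (repr x) (repr y)).
Definition Umul (x y : U) := Ucl (TM (repr x) (repr y)).
Definition Uscale (c : k) (x : U) := Ucl (TM (TC c) (repr x)).
Definition Uopp (x : U) := Uscale (-1) x.

Local Ltac usolve :=
  rewrite -1?[RHS]UclK; apply/UclP => ? ? ? ?; let r := fresh "r" in move=> r;
  rewrite /=; do 3 rewrite ?(ev_repr r) /=;
  rewrite ?scale0r ?scale1r ?mul1r ?mulr1 ?add0r ?scaleN1r ?mulN1r ?addNr.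

Fact UaddA : associative Uadd. Proof. by move=> x y z; usolve; rewrite addrA. Qed.
Fact UaddC : commutative Uadd. Proof. by move=> x y; usolve; rewrite addrC. Qed.
Fact Uadd0 : left_id Uzero Uadd. Proof. by move=> x; usolve. Qed.
Fact UaddN : left_inverse Uzero Uopp Uadd. Proof. by move=> x; usolve. Qed.

HB.instance Definition _ := GRing.isZmodule.Build U UaddA UaddC Uadd0 UaddN.

Fact UmulA : associative Umul. Proof. by move=> x y z; usolve; rewrite mulrA. Qed.
Fact Umul1 : left_id Uone Umul. Proof. by move=> x; usolve. Qed.
Fact Umulr1 : right_id Uone Umul. Proof. by move=> x; usolve. Qed.
Fact UmulDl : left_distributive Umul +%R.
Proof. by move=> x y z; usolve; rewrite mulrDl. Qed.
Fact UmulDr : right_distributive Umul +%R.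
Proof. by move=> x y z; usolve; rewrite mulrDr. Qed.

(** The trivial representation separates 1 from 0. *)
Lemma Urel_triv : @Urel (k^o : algType k) (fun=> 0) (fun=> 0) (fun=> 1).
Proof.
by split=> *; rewrite /p2 /quartic /sbr
     ?(mulr1, mulr0, mul0r, scaler0, subr0, subrr, if_same).
Qed.

Fact Uone_neq0 : Uone != Uzero.
Proof.
apply/eqP => /UclP /(_ _ _ _ _ Urel_triv) /= /eqP.
by rewrite scale1r scale0r oner_eq0.
Qed.

HB.instance Definition _ := GRing.Zmodule_isNzRing.Build U
  UmulA Umul1 Umulr1 UmulDl UmulDr Uone_neq0.

Fact UscaleA a b x : Uscale a (Uscale b x) = Uscale (a * b) x.
Proof. by usolve; rewrite mulrA -scalerAl mul1r scalerA. Qed.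
Fact Uscale1 : left_id 1 Uscale. Proof. by move=> x; usolve. Qed.
Fact UscaleDr : right_distributive Uscale +%R.
Proof. by move=> a x y; usolve; rewrite mulrDr. Qed.
Fact UscaleDl x : {morph Uscale^~ x : a b / a + b}.
Proof. by move=> a b; usolve; rewrite scalerDl mulrDl. Qed.

HB.instance Definition _ :=
  GRing.Zmodule_isLmodule.Build k U UscaleA Uscale1 UscaleDr UscaleDl.

Fact UscaleAl (a : k) (x y : U) : a *: (x * y) = a *: x * y.
Proof. by usolve; rewrite mulrA. Qed.
HB.instance Definition _ := GRing.Lmodule_isLalgebra.Build k U UscaleAl.

Fact UscaleAr (a : k) (x y : U) : a *: (x * y) = x * (a *: y).
Proof. by usolve; rewrite !mulrA -scalerAl -scalerAr mul1r mulr1. Qed.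
HB.instance Definition _ := GRing.Lalgebra_isAlgebra.Build k U UscaleAr.

Definition UE (i : I) : U := Ucl (TE i).
Definition UF (i : I) : U := Ucl (TF i).
Definition UK (h : 'rV[int]_N) : U := Ucl (TK h).

Section Lift.
Variables (A : algType k) (E F : I -> A) (K : 'rV[int]_N -> A).
Hypothesis r : Urel E F K.

Definition Ulift (x : U) : A := ev E F K (repr x).

Lemma UliftE t : Ulift (Ucl t) = ev E F K t.
Proof. exact: ev_repr. Qed.

Lemma Ulift_linear : linear Ulift.
Proof.
move=> a x y; rewrite -[x]UclK -[y]UclK.
rewrite UliftE (UliftE (repr y)) [_ + _]/(Ucl _) UliftE /=.
by rewrite !(ev_repr r) /= !(ev_repr r) mulr_algl.
Qed.

Lemma Ulift_monoid : monoid_morphism Ulift.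
Proof.
split=> [|x y]; first by rewrite UliftE /= scale1r.
by rewrite -[x * y]/(Ucl _) UliftE.
Qed.

End Lift.

Lemma ev_U (t : term) : ev UE UF UK t = Ucl t.
Proof.
elim: t => //= [c|s -> t ->|s -> t ->].
- rewrite -[LHS]/(Ucl _); apply/UclP => A E F K r /=.
  by rewrite (ev_repr r) /= scale1r mulr1.
- by apply/UclP => A E F K r /=; rewrite !(ev_repr r).
- by apply/UclP => A E F K r /=; rewrite !(ev_repr r).
Qed.

Lemma Urel_U : Urel UE UF UK.
Proof.
have Ut s t : (forall (A : algType k) E F K, Urel E F K ->
    ev E F K s = ev E F K t :> A) -> ev UE UF UK s = ev UE UF UK t.
  by move=> H; rewrite !ev_U; apply/UclP.
pose tn t := TM (TC (-1)) t.
pose tsbr (a b : bool) (c : k) x y :=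
  TD (TM x y) (TM (TC (- ((-1) ^+ (a && b) * c))) (TM y x)).
have evs (A : algType k) E F K a b c x y :
    @ev A E F K (tsbr a b c x y) = sbr a b c (ev E F K x) (ev E F K y).
  by rewrite /tsbr /sbr /= mulr_algl scaleNr.
pose tp2 i j x y := tsbr (npar i) (npar i (+) npar j) (qi i) x
    (tsbr (npar i) (npar j) (qi i)^-1 x y).
have evp2 (A : algType k) E F K i j x y :
    @ev A E F K (tp2 i j x y) = p2 i j (ev E F K x) (ev E F K y).
  by rewrite /tp2 /p2 !evs.
pose tqu (a b c : I) x y z := tsbr (npar a (+) npar b (+) npar c) (npar b) 1
    (tsbr (npar a (+) npar b) (npar c) (qi c)
       (tsbr (npar a) (npar b) (qi b) x y) z) y.
have evqu (A : algType k) E F K a b c x y z :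
    @ev A E F K (tqu a b c x y z) =
      quartic a b c (ev E F K x) (ev E F K y) (ev E F K z).
  by rewrite /tqu /quartic !evs.
have t0 (t : term) : (forall (A : algType k) E F K, Urel E F K ->
    ev E F K t = 0 :> A) -> ev UE UF UK t = 0.
  move=> H; rewrite (Ut t (TC 0)) /= ?scale0r // => A E F K r.
  by rewrite (H _ _ _ _ r) scale0r.
split.
- have := Ut (TK 0) (TC 1); rewrite /= scale1r; apply=> A E F K r /=.
  by rewrite (UrelK0 r) scale1r.
- move=> h h'; apply: (Ut (TK (h + h')) (TM (TK h) (TK h'))) => A E F K r /=.
  exact: (UrelKD r).
- move=> h i.
  have := Ut (TM (TK h) (TE i)) (TM (TC (q ^ cpair h (alpha i))) (TM (TE i) (TK h))).
  rewrite /= mulr_algl; apply=> A E F K r /=.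
  by rewrite (UrelKE r) mulr_algl.
- move=> h i.
  have := Ut (TM (TK h) (TF i)) (TM (TC (q ^ (- cpair h (alpha i)))) (TM (TF i) (TK h))).
  rewrite /= mulr_algl; apply=> A E F K r /=.
  by rewrite (UrelKF r) mulr_algl.
- move=> i j; have [<-|ij] := eqVneq i j.
    rewrite -(evs _ UE UF UK _ _ _ (TE i) (TF i)).
    rewrite (Ut _ (TM (TC (qi i - (qi i)^-1)^-1) (TD (TK (Kvec i)) (tn (TK (- Kvec i)))))).
      by rewrite /= !mulr_algl scaleN1r.
    by move=> A E F K r; rewrite evs /= (UrelEF r) eqxx !mulr_algl scaleN1r.
  rewrite -(evs _ UE UF UK _ _ _ (TE i) (TF j)); apply: t0 => A E F K r.
  by rewrite evs /= (UrelEF r) (negPf ij).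
- move=> i j ij; rewrite -(evs _ UE UF UK _ _ _ (TE i) (TE j)).
  by apply: t0 => A E F K r; rewrite evs /= (UrelEE r).
- move=> i j ij; rewrite -(evs _ UE UF UK _ _ _ (TF i) (TF j)).
  by apply: t0 => A E F K r; rewrite evs /= (UrelFF r).
- move=> i j ij pi; rewrite -(evp2 _ UE UF UK _ _ (TE i) (TE j)).
  by apply: t0 => A E F K r; rewrite evp2 /= (UrelE2 r).
- move=> i j ij pi; rewrite -(evp2 _ UE UF UK _ _ (TF i) (TF j)).
  by apply: t0 => A E F K r; rewrite evp2 /= (UrelF2 r).
- move=> a b c ab bc pb; rewrite -(evqu _ UE UF UK _ _ _ (TE a) (TE b) (TE c)).
  by apply: t0 => A E F K r; rewrite evqu /= (UrelE4 r).
- move=> a b c ab bc pb; rewrite -(evqu _ UE UF UK _ _ _ (TF a) (TF b) (TF c)).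
  by apply: t0 => A E F K r; rewrite evqu /= (UrelF4 r).
Qed.

Lemma sbrZ (A : algType k) a b c (u v : k) (x y : A) :
  sbr a b c (u *: x) (v *: y) = (u * v) *: sbr a b c x y.
Proof.
rewrite /sbr -!scalerAl -!scalerAr !scalerA scalerBr scalerA.
by congr (_ - _ *: _); rewrite [RHS]mulrC [u * v]mulrC mulrA.
Qed.

Lemma Urel_sign (A : algType k) E F K : @Urel A E F K ->
  Urel (fun i => (-1) ^+ npar i *: E i) (fun i => (-1) ^+ npar i *: F i) K.
Proof.
move=> r; split.
- exact: (UrelK0 r).
- exact: (UrelKD r).
- by move=> h i; rewrite -scalerAr (UrelKE r) !scalerA -scalerAl scalerA mulrC.
- by move=> h i; rewrite -scalerAr (UrelKF r) !scalerA -scalerAl scalerA mulrC.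
- move=> i j; rewrite sbrZ (UrelEF r); case: eqP => [->|_]; last by rewrite scaler0.
  by rewrite -signr_addb addbb scale1r.
- by move=> i j ij; rewrite sbrZ (UrelEE r) ?scaler0.
- by move=> i j ij; rewrite sbrZ (UrelFF r) ?scaler0.
- by move=> i j ij pi; rewrite /p2 !sbrZ -/(p2 _ _ _ _) (UrelE2 r) ?scaler0.
- by move=> i j ij pi; rewrite /p2 !sbrZ -/(p2 _ _ _ _) (UrelF2 r) ?scaler0.
- move=> a b c ab bc pb.
  by rewrite /quartic !sbrZ -/(quartic _ _ _ _ _ _) (UrelE4 r) ?scaler0.
- move=> a b c ab bc pb.
  by rewrite /quartic !sbrZ -/(quartic _ _ _ _ _ _) (UrelF4 r) ?scaler0.
Qed.

(** The parity involution: 1 on the even part of U, -1 on the odd part. *)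
Definition parity : U -> U :=
  Ulift (fun i => (-1) ^+ npar i *: UE i) (fun i => (-1) ^+ npar i *: UF i) UK.

HB.instance Definition _ :=
  GRing.isLinear.Build k U U *:%R parity (Ulift_linear (Urel_sign Urel_U)).
HB.instance Definition _ :=
  GRing.isMonoidMorphism.Build U U parity (Ulift_monoid (Urel_sign Urel_U)).

End Relations.

Arguments UE {k q N par} i.
Arguments UF {k q N par} i.
Arguments UK {k q N par} h.
Arguments parity {k q N par} x.

Section QuantumSymmetricPair.
Variables (k : fieldType) (q : k) (N : nat) (par : 'I_N -> bool).
Local Notation I := 'I_N.-1.
Local Notation npar := (npar par).
Local Notation U := (U q par).
Local Notation U2 := (tensor U U).

Definition UKi (i : I) : U := UK (Kvec par i).
Definition UKi_inv (i : I) : U := UK (- Kvec par i).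

Record coproduct (Delta : {linear U -> U2}) : Prop := Coproduct {
  Delta1 : Delta 1 = tens 1 1;
  DeltaM : forall x y, Delta (x * y) = smul parity (Delta x) (Delta y);
  DeltaE : forall i, Delta (UE i) = tens (UE i) 1 + tens (UKi i) (UE i);
  DeltaF : forall i, Delta (UF i) = tens (UF i) (UKi_inv i) + tens 1 (UF i);
  DeltaK : forall h, Delta (UK h) = tens (UK h) (UK h)
}.

Definition next_to (i j : I) : bool := (j == i.+1 :> nat) || (i == j.+1 :> nat).

(** T i is specified for even i only. *)
Record braid_operators (T : I -> {lrmorphism U -> U}) : Prop := BraidOperators {
  T_bij : forall i, ~~ npar i -> bijective (T i);
  T_par : forall i, ~~ npar i -> {morph T i : x / parity x};
  T_Ei : forall i, ~~ npar i -> T i (UE i) = - (UF i * UKi i);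
  T_Fi : forall i, ~~ npar i -> T i (UF i) = - (UKi_inv i * UE i);
  T_Efar : forall i j, ~~ npar i -> j != i -> ~~ next_to i j ->
    T i (UE j) = UE j;
  T_Ffar : forall i j, ~~ npar i -> j != i -> ~~ next_to i j ->
    T i (UF j) = UF j;
  T_Enext : forall i j, ~~ npar i -> next_to i j ->
    T i (UE j) = UE i * UE j - q ^ wform par (alpha i) (alpha j) *: (UE j * UE i);
  T_Fnext : forall i j, ~~ npar i -> next_to i j ->
    T i (UF j) = UF j * UF i - q ^ (- wform par (alpha i) (alpha j)) *: (UF i * UF j);
  T_K : forall i h, ~~ npar i -> T i (UK h) = UK (scorefl par i h);
  T_braid : forall i j x, ~~ npar i -> ~~ npar j -> next_to i j ->
    T i (T j (T i x)) = T j (T i (T j x));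
  T_comm : forall i j x, ~~ npar i -> ~~ npar j -> j != i -> ~~ next_to i j ->
    T i (T j x) = T j (T i x)
}.

(** The component U^+_gamma: combinations of monomials in the E_i of weight gamma. *)
Definition Uplus_wt (gamma : 'rV[int]_N) (x : U) : Prop :=
  exists2 s : seq (k * seq I),
    (forall cv, cv \in s -> \sum_(i <- cv.2) alpha i = gamma) &
    x = \sum_(cv <- s) cv.1 *: \prod_(i <- cv.2) UE i.

(** t lies in U (x) sum_(gamma | Q gamma) U^+_gamma K_i^-1. *)
Definition in_tail (Q : 'rV[int]_N -> Prop) (i : I) (t : U2) : Prop :=
  exists2 s : seq (U * U),
    (forall xy, xy \in s -> exists gamma y,
       [/\ Q gamma, Uplus_wt gamma y & xy.2 = y * UKi_inv i]) &
    t = \sum_(xy <- s) tens xy.1 xy.2.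

Section Generators.
Variables (Delta : {linear U -> U2}) (T : I -> {lrmorphism U -> U}).
Variables (black : {set I}) (tau : I -> I) (w : seq I) (vsig kappa : I -> k).

Definition Tw (x : U) : U := foldr (fun i => T i) x w.

Definition TwEK (i : I) : U := Tw (UE (tau i)) * UKi_inv i.

Definition B (i : I) : U :=
  if i \in black then UF i
  else UF i + vsig i *: TwEK i + kappa i *: UKi_inv i.

Definition Ui0 (x : U) : Prop :=
  gen_subalg (fun y : U => exists2 h, in_Yi par tau w h & y = UK h) x.

Definition Ui (x : U) : Prop :=
  gen_subalg (fun y : U => Ui0 y \/
    exists i, if i \in black then y = UE i \/ y = UF i else y = B i) x.

Definition Ublack_plus (x : U) : Prop :=
  gen_subalg (fun y : U => exists2 i, i \in black & y = UE i) x.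

Definition is_Z (i : I) (z : U) : Prop :=
  in_tail (fun gamma => root_gt gamma (alpha (tau i))) i
    (Delta (TwEK i) - tens (TwEK i) (UKi_inv i)
       - tens z (UE (tau i) * UKi_inv i)).

(** For i = tau i. *)
Definition is_W (i j : I) (z W : U) : Prop :=
  Ublack_plus W /\
  in_tail (fun gamma => root_gt gamma (alpha i) /\ gamma <> alpha i + alpha j) i
    (Delta (TwEK i) - tens (TwEK i) (UKi_inv i) - tens z (UE i * UKi_inv i)
       - tens (W * UKi j) (T j (UE i) * UKi_inv i)).

End Generators.
End QuantumSymmetricPair.

Arguments UKi {k q N par} i.
Arguments UKi_inv {k q N par} i.

(* Main.v *)
Require Import Defs.
From HB Require Import structures.
From mathcomp Require Import all_boot all_order all_algebra.
From mathcomp Require Import perm fraction complex.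
From mathcomp Require Import boolp classical_sets fsbigop reals.
From mathcomp Require Import ring lra zify.

Set Implicit Arguments.
Unset Strict Implicit.
Unset Printing Implicit Defensive.

Import Order.TTheory GRing.Theory Num.Theory.

Local Open Scope ring_scope.

(** Write S(x, y) = x^2 y - (q_i + q_i^-1) x y x + y x^2 for the quantum Serre
    polynomial, to which p_2 reduces for even i, and
    X_i = T_w(E_tau(i)) K_i^-1 with w the longest element of W_black. Then
    B_i = F_i + vsig_i X_i + kappa_i K_i^-1 for white i, and F_i = - X_i for
    black i, because T_w exchanges positive and negative root vectors of the
    black subsystem ([Tw_reversed_E], [UF_black]).

    Two facts carry the proof. First, S(X_i, X_j) = 0 for all neighbours i, j
    ([serreX]): T_w is an algebra morphism, so up to factors from the torus
    this is the Serre relation of E_tau(i) and E_tau(j); the torus factors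
    contribute the same powers of q to the three terms since
    (alpha_i, w alpha_tau(j)) is symmetric in i and j ([wform_sym]). Secondly,
    F_f commutes with T_w(E_l) for white f != l that are not both odd
    ([Tw_commF]): T_w(E_l) lies in the subalgebra generated by E_l and the
    black E's. For black i and white j this already suffices, kappa_j being
    zero ([Rem_black]). For white i with tau(i) != j the terms of S(B_i, B_j)
    without X_i or with two of them vanish, and so do those with kappa_i; the
    terms linear in X_i are evaluated by moving elements that commute up to a
    power of q past each other.

    If tau(i) = i and j is white, i has no black neighbour, so
    X_i = E_i K_i^-1 and [E_i, F_i] produces q_i vsig_i B_j ([Rem_fixed]).
    If tau(i) = j, there are no black nodes, Z_i = K_j K_i^-1, and the identity
    is one between words in the generators ([Rem_swapped]). If tau(i) = i and
    j is black, then tau = id and i lies between exactly two black nodes j and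
    l; T_w(E_i) = T_l(T_j(E_i)), from which Z_i = (1 - q_i^-2)^2 E_j E_l and
    W_ij K_j = (1 - q_i^-2) E_l K_j, and again the identity is one between
    words ([Rem_fixed_black]). If tau(i) is neither i nor j, then F_i and X_i
    commute up to q_i^2 and the linear terms cancel ([Rem_moved_white],
    [Rem_moved_black]).

    The elements Z and W are given only through the coproduct. They are read
    off by contracting the second tensor factor against a matrix coefficient
    of the natural representation, which sees a single weight of U^+ and
    so kills the unspecified tail ([contr_tail], [Z_coef], [W_coef]). The word
    w is an arbitrary reduced one; [matsumoto] allows it to be replaced by
    whichever reduced word suits the computation. *)

(** * Identities in noncommutative algebras modulo pair rules *)

(** Syntax of expressions in finitely many atoms of a noncommutative algebra. An
    identity is decided by expanding both sides into words, rewriting pairs of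
    adjacent atoms by given relations such as K E = c E K, and comparing
    coefficients; the arithmetic of the coefficients is left to the user of
    the normal form. *)
Inductive ncexpr (k : Type) :=
| NCvar of nat
| NC0
| NC1
| NCadd of ncexpr k & ncexpr k
| NCopp of ncexpr k
| NCmul of ncexpr k & ncexpr k
| NCscale of k & ncexpr k.
Arguments NCvar {k}.
Arguments NC0 {k}.
Arguments NC1 {k}.

(** These functions are evaluated by cbv with an explicit list of constants, which
    must not reach the operations of the ground field; hence the local copies
    of equality and concatenation. *)
Fixpoint nat_eq (m n : nat) : bool :=
  match m, n with
  | 0, 0 => true
  | S m', S n' => nat_eq m' n'
  | _, _ => false
  end.

Fixpoint word_eq (u v : list nat) : bool :=
  match u, v with
  | [::], [::] => true
  | a :: u', b :: v' => if nat_eq a b then word_eq u' v' else false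
  | _, _ => false
  end.

Lemma nat_eqP m n : nat_eq m n -> m = n.
Proof. by elim: m n => [|m IH] [|n] //= /IH ->. Qed.

Lemma word_eqP u v : word_eq u v -> u = v.
Proof.
elim: u v => [|a u IH] [|b v] //=.
by case E: (nat_eq a b) => // /IH ->; rewrite (nat_eqP E).
Qed.

Section NcPoly.
Variables (k : fieldType) (A : algType k).
Implicit Types (e : list A) (p r : list (k * list nat)) (w : list nat).

Fixpoint nc_at e (n : nat) : A :=
  match e, n with
  | [::], _ => 0
  | x :: _, 0 => x
  | _ :: e', S n' => nc_at e' n'
  end.

Fixpoint nc_ev e (t : ncexpr k) : A :=
  match t with
  | NCvar n => nc_at e n
  | NC0 => 0
  | NC1 => 1
  | NCadd a b => nc_ev e a + nc_ev e b
  | NCopp a => - nc_ev e a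
  | NCmul a b => nc_ev e a * nc_ev e b
  | NCscale c a => c *: nc_ev e a
  end.

Fixpoint nc_mon e w : A :=
  match w with [::] => 1 | n :: w' => nc_at e n * nc_mon e w' end.

Fixpoint nc_poly e p : A :=
  match p with [::] => 0 | cw :: p' => cw.1 *: nc_mon e cw.2 + nc_poly e p' end.

Fixpoint nc_app (T : Type) (u v : list T) : list T :=
  match u with [::] => v | x :: u' => x :: nc_app u' v end.

Fixpoint nc_mulw (c : k) w p : list (k * list nat) :=
  match p with
  | [::] => [::]
  | (d, v) :: p' => (c * d, nc_app w v) :: nc_mulw c w p'
  end.

Fixpoint nc_mul p r : list (k * list nat) :=
  match p with
  | [::] => [::]
  | (c, w) :: p' => nc_app (nc_mulw c w r) (nc_mul p' r)
  end.

Fixpoint nc_norm (t : ncexpr k) : list (k * list nat) :=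
  match t with
  | NCvar n => [:: (1, [:: n])]
  | NC0 => [::]
  | NC1 => [:: (1, [::])]
  | NCadd a b => nc_app (nc_norm a) (nc_norm b)
  | NCopp a => nc_mulw (-1) [::] (nc_norm a)
  | NCmul a b => nc_mul (nc_norm a) (nc_norm b)
  | NCscale c a => nc_mulw c [::] (nc_norm a)
  end.

Fixpoint nc_rule (rs : list (nat * nat * ncexpr k)) (a b : nat) :=
  match rs with
  | [::] => None
  | (a', b', t) :: rs' =>
    if nat_eq a a' then (if nat_eq b b' then Some (nc_norm t) else nc_rule rs' a b)
    else nc_rule rs' a b
  end.

Fixpoint nc_step rs w : option (list (k * list nat)) :=
  match w with
  | [::] => None
  | a :: w' =>
    match w' with
    | [::] => None
    | b :: w'' =>
      match nc_rule rs a b with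
      | Some p => Some (nc_mul p [:: (1, w'')])
      | None =>
        match nc_step rs w' with
        | Some p => Some (nc_mulw 1 [:: a] p)
        | None => None
        end
      end
    end
  end.

(** The fuel bounds the length of a chain of rewriting steps, so no termination
    argument on the rules is needed; running out of it leaves a correct but
    unreduced polynomial. *)
Fixpoint nc_red rs (fuel : nat) p : list (k * list nat) :=
  match fuel with
  | 0 => p
  | S f =>
    (fix loop p := match p with
     | [::] => [::]
     | (c, w) :: p' =>
       match nc_step rs w with
       | None => (c, w) :: loop p'
       | Some r => nc_app (nc_red rs f (nc_mulw c [::] r)) (loop p')
       end
     end) p
  end.

Fixpoint nc_insert (c : k) w p : list (k * list nat) :=
  match p with
  | [::] => [:: (c, w)]
  | (d, v) :: p' => if word_eq w v then (c + d, v) :: p' else (d, v) :: nc_insert c w p'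
  end.

Fixpoint nc_collect p : list (k * list nat) :=
  match p with
  | [::] => [::]
  | (c, w) :: p' => nc_insert c w (nc_collect p')
  end.

Fixpoint nc_zero p : Prop :=
  match p with
  | [::] => True
  | (c, w) :: p' => c = 0 /\ nc_zero p'
  end.

Fixpoint nc_valid e (rs : list (nat * nat * ncexpr k)) : Prop :=
  match rs with
  | [::] => True
  | (a, b, t) :: rs' => nc_at e a * nc_at e b = nc_ev e t /\ nc_valid e rs'
  end.

Lemma nc_poly_app e p r : nc_poly e (nc_app p r) = nc_poly e p + nc_poly e r.
Proof. by elim: p => [|x p IH] /=; rewrite ?add0r // IH addrA. Qed.

Lemma nc_mon_app e u w : nc_mon e (nc_app u w) = nc_mon e u * nc_mon e w.
Proof. by elim: u => [|a u IH] /=; rewrite ?mul1r // IH mulrA. Qed.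

Lemma nc_poly_mulw e c w p : nc_poly e (nc_mulw c w p) = c *: (nc_mon e w * nc_poly e p).
Proof.
elim: p => [|[d v] p IH] /=; first by rewrite mulr0 scaler0.
by rewrite IH nc_mon_app mulrDr scalerDr -scalerAr scalerA.
Qed.

Lemma nc_poly_mul e p r : nc_poly e (nc_mul p r) = nc_poly e p * nc_poly e r.
Proof.
elim: p => [|[c w] p IH] /=; first by rewrite mul0r.
by rewrite nc_poly_app nc_poly_mulw IH mulrDl scalerAl.
Qed.

Lemma nc_normP e t : nc_poly e (nc_norm t) = nc_ev e t.
Proof.
elim: t => [n|||a IHa b IHb|a IHa|a IHa b IHb|c a IHa] /=.
- by rewrite mulr1 scale1r addr0.
- by [].
- by rewrite scale1r addr0.
- by rewrite nc_poly_app IHa IHb.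
- by rewrite nc_poly_mulw /= mul1r scaleN1r IHa.
- by rewrite nc_poly_mul IHa IHb.
- by rewrite nc_poly_mulw /= mul1r IHa.
Qed.

Lemma nc_ruleP e rs a b p : nc_valid e rs -> nc_rule rs a b = Some p ->
  nc_poly e p = nc_at e a * nc_at e b.
Proof.
elim: rs => [|[[a' b'] t] rs IH] //= [H /IH{}IH].
case Ea: (nat_eq a a') => //; case Eb: (nat_eq b b') => // -[<-].
by rewrite nc_normP -H (nat_eqP Ea) (nat_eqP Eb).
Qed.

Lemma nc_stepP e rs w p : nc_valid e rs -> nc_step rs w = Some p ->
  nc_poly e p = nc_mon e w.
Proof.
move=> V; elim: w p => [|a [|b w] IH] // p.
rewrite [nc_step _ _]/=; case E: (nc_rule rs a b) => [r|].
  move=> [<-]; rewrite nc_poly_mul (nc_ruleP V E) /=.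
  by rewrite scale1r addr0 mulrA.
change (match nc_step rs (b :: w) with Some p0 => Some (nc_mulw 1 [:: a] p0)
  | None => None end = Some p -> nc_poly e p = nc_mon e [:: a, b & w]).
case E': (nc_step rs (b :: w)) => [r|] // [<-].
by rewrite nc_poly_mulw (IH _ E') /= mulr1 scale1r.
Qed.

Lemma nc_redP e rs fuel p : nc_valid e rs -> nc_poly e (nc_red rs fuel p) = nc_poly e p.
Proof.
move=> V; elim: fuel p => [|f IHf] //; elim=> [|[c w] p IH] //=.
case E: (nc_step rs w) => [r|]; last by rewrite /= -IH.
by rewrite nc_poly_app IHf nc_poly_mulw (nc_stepP V E) mul1r -IH.
Qed.

Lemma nc_insertP e c w p : nc_poly e (nc_insert c w p) = c *: nc_mon e w + nc_poly e p.
Proof.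
elim: p => [|[d v] p IH] //=.
case E: (word_eq w v) => /=; last by rewrite IH addrCA.
by rewrite (word_eqP E) scalerDl addrA.
Qed.

Lemma nc_collectP e p : nc_poly e (nc_collect p) = nc_poly e p.
Proof. by elim: p => [|[c w] p IH] //=; rewrite nc_insertP IH. Qed.

Lemma nc_zeroP e p : nc_zero p -> nc_poly e p = 0.
Proof. by elim: p => [|[c w] p IH] //= [-> /IH ->]; rewrite scale0r addr0. Qed.

Lemma nc_decide e rs fuel s t : nc_valid e rs ->
  nc_zero (nc_collect (nc_red rs fuel (nc_norm (NCadd s (NCopp t))))) ->
  nc_ev e s = nc_ev e t.
Proof.
move=> V /(nc_zeroP e); rewrite nc_collectP nc_redP // nc_normP /= => H.
by apply/eqP; rewrite -subr_eq0 H.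
Qed.

End NcPoly.

Ltac nc_index x e :=
  lazymatch e with
  | x :: _ => constr:(O)
  | _ :: ?e' => let n := nc_index x e' in constr:(S n)
  end.

Ltac nc_reify k e t :=
  lazymatch t with
  | @GRing.add _ ?a ?b =>
    let a' := nc_reify k e a in let b' := nc_reify k e b in constr:(@NCadd k a' b')
  | @GRing.opp _ ?a => let a' := nc_reify k e a in constr:(@NCopp k a')
  | @GRing.mul _ ?a ?b =>
    let a' := nc_reify k e a in let b' := nc_reify k e b in constr:(@NCmul k a' b')
  | @GRing.scale _ _ ?c ?a => let a' := nc_reify k e a in constr:(@NCscale k c a')
  | @GRing.zero _ => constr:(@NC0 k)
  | @GRing.one _ => constr:(@NC1 k)
  | _ => let n := nc_index t e in constr:(@NCvar k n)
  end.

Ltac nc_rules k e H :=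
  lazymatch H with
  | tt => constr:(@nil (nat * nat * ncexpr k))
  | (?H1, ?H2) =>
    let r := nc_rules k e H1 in
    lazymatch type of H2 with
    | ?a * ?b = ?t =>
      let a' := nc_index a e in let b' := nc_index b e in
      let t' := nc_reify k e t in constr:((a', b', t') :: r)
    end
  end.

Ltac nc_validate := repeat (split; [assumption|]); exact I.

(** [nc_reduce k e H] reduces an equation over the atoms e to equations between
    coefficients in k. The relations in the tuple H (which starts with tt) are
    used from left to right; each has a product of two atoms on the left. *)
Tactic Notation "nc_reduce" constr(k) constr(e) constr(H) :=
  lazymatch goal with
  | |- ?s = ?t =>
    let s' := nc_reify k e s in
    let t' := nc_reify k e t in
    let r := nc_rules k e H in
    apply: (@nc_decide k _ e r 40 s' t');
    [ nc_validate
    | cbv [nc_zero nc_collect nc_red nc_norm nc_insert nc_step nc_rule nc_mul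
           nc_mulw nc_app word_eq nat_eq];
      repeat (split; [|]); try exact I ]
  end.

(** * The quantum Serre polynomial on sums *)

Section QSerre.
Variables (k : fieldType) (A : algType k) (q : k).
Hypothesis q0 : q != 0.
Implicit Types x y z : A.

Definition qserre x y : A := x * x * y - (q + q^-1) *: (x * y * x) + y * x * x.

Lemma sbr_qserre (b b' : bool) x y :
  sbr false b q x (sbr false b' q^-1 x y) = qserre x y.
Proof.
rewrite /sbr /qserre /= !expr0 !mul1r.
nc_reduce k [:: x; y] tt; field; rewrite ?q0 //.
Qed.

(** For a, b in the torus, S(x a, y b) is a multiple of S(x, y) a^2 b as soon as a
    moves past y with the same factor as b moves past x. *)
Lemma qserre_tori (s t : k) x a y b :
  a * x = t *: (x * a) -> a * y = s *: (y * a) -> b * x = s *: (x * b) ->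
  b * a = a * b ->
  qserre (x * a) (y * b) = (t * s ^+ 2) *: (qserre x y * (a * a * b)).
Proof.
move=> ax ay bx ba; rewrite /qserre.
nc_reduce k [:: x; y; a; b] (tt, ax, ay, bx, ba); field; rewrite ?q0 //.
Qed.

Lemma qserreNl x y : qserre (- x) y = qserre x y.
Proof. by rewrite /qserre; nc_reduce k [:: x; y] tt; field; rewrite ?q0 //. Qed.

Lemma qserreDr x y z : qserre x (y + z) = qserre x y + qserre x z.
Proof. rewrite /qserre. nc_reduce k [:: x; y; z] tt; field; rewrite ?q0 //. Qed.

Lemma qserreZr c x y : qserre x (c *: y) = c *: qserre x y.
Proof. rewrite /qserre. nc_reduce k [:: x; y] tt; field; rewrite ?q0 //. Qed.

(** S(x, .) is the composite of the commuting operators y |-> x y - q y x and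
    y |-> x y - q^-1 y x; here the second one vanishes. *)
Lemma qserre_qVcomm x y : x * y = q^-1 *: (y * x) -> qserre x y = 0.
Proof.
move=> xy; rewrite /qserre. nc_reduce k [:: x; y] (tt, xy); field; rewrite ?q0 //.
Qed.

Lemma qserreD_Fcomm v F X y :
  F * X = q ^- 2 *: (X * F) -> F * y = q *: (y * F) ->
  qserre (F + v *: X) y = v ^+ 2 *: qserre X y.
Proof.
move=> FX Fy; rewrite /qserre.
nc_reduce k [:: F; X; y] (tt, FX, Fy); field; rewrite ?q0 //.
Qed.

Lemma qserreD_Xcomm v F X y :
  X * F = q ^+ 2 *: (F * X) -> X * y = q^-1 *: (y * X) ->
  qserre (F + v *: X) y = qserre F y.
Proof.
move=> FX Fy; rewrite /qserre.
nc_reduce k [:: F; X; y] (tt, FX, Fy); field; rewrite ?q0 //.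
Qed.

(** When X does not commute with y up to a scalar, the part of S(F + v X, y) linear
    in v only involves the bracket D of X and y. *)
Lemma qserreD_bracket v F X y D : X * F = q ^+ 2 *: (F * X) ->
  q *: (X * y) - y * X = D -> D * F = q *: (F * D) ->
  qserre (F + v *: X) y = qserre F y + v ^+ 2 *: qserre X y.
Proof.
move=> FX <- DF.
suff ->: qserre (F + v *: X) y = qserre F y + v ^+ 2 *: qserre X y
    + (v * (1 + q ^- 2)) *: (q *: (F * (q *: (X * y) - y * X)) -
               (q *: (X * y) - y * X) * F).
  by rewrite DF subrr scaler0 addr0.
rewrite /qserre.
nc_reduce k [:: F; X; y] (tt, FX); field; rewrite ?q0 //.
Qed.

(** The part of S(x + v x', y) that is linear in v. *)
Definition qcross x x' y : A :=
  (x * x' + x' * x) * y - (q + q^-1) *: (x * y * x' + x' * y * x)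
  + y * (x * x' + x' * x).

Lemma qserre_polar v x x' y :
  qserre (x + v *: x') y = qserre x y + v ^+ 2 *: qserre x' y + v *: qcross x x' y.
Proof.
rewrite /qserre /qcross; nc_reduce k [:: x; x'; y] tt; field; rewrite ?q0 //.
Qed.

Hypothesis qV : q - q^-1 != 0.

Lemma sqr_sub1_neq0 : q ^+ 2 - 1 != 0.
Proof.
apply: contraNneq qV => H.
have -> : q - q^-1 = (q ^+ 2 - 1) / q by field.
by rewrite H mul0r.
Qed.

Ltac nc_done := field; rewrite ?q0 ?sqr_sub1_neq0 //.

Local Notation c := (q - q^-1)^-1.

(** The model is X = E K with K the inverse torus element, so that F X and X F
    differ by a combination of 1 and K^2; these are the only terms left, and
    passing K^2 through y leaves a multiple of y. *)
Lemma qserreD_tori_F v w F X K y :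
  F * y = q *: (y * F) -> K * y = q *: (y * K) ->
  F * X = q ^- 2 *: (X * F) - c *: (1 - K * K) ->
  K * F = q ^+ 2 *: (F * K) -> K * X = q ^- 2 *: (X * K) ->
  qserre (F + v *: X + w *: K) y = v ^+ 2 *: qserre X y + (q * v) *: y.
Proof.
move=> Fy Ky FX KF KX; rewrite /qserre.
nc_reduce k [:: F; X; K; y] (tt, Fy, Ky, FX, KF, KX); nc_done.
Qed.

(** The counterpart of the previous lemma in which y commutes with E instead of F. *)
Lemma qserreD_tori_X v w F X K y :
  X * y = q^-1 *: (y * X) -> K * y = q^-1 *: (y * K) ->
  X * F = q ^+ 2 *: (F * X) + (q ^+ 2 * c) *: (1 - K * K) ->
  K * F = q ^+ 2 *: (F * K) -> K * X = q ^- 2 *: (X * K) ->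
  qserre (F + v *: X + w *: K) y = qserre F y + (q * v) *: y.
Proof.
move=> Xy Ky XF KF KX; rewrite /qserre.
nc_reduce k [:: F; X; K; y] (tt, Xy, Ky, XF, KF, KX); nc_done.
Qed.

(** T_i undoes the bracketing of E_j with E_i, up to the order of the factors. With
    E_i sent to - F_i a, this comes down to the commutator of E_i and F_i. *)
Lemma rank2_E (Ei Ej Fi a a' : A) :
  a * Ei = q ^+ 2 *: (Ei * a) -> a * Ej = q^-1 *: (Ej * a) ->
  a' * a = 1 -> a' * Ej = q *: (Ej * a') -> a' * Ei = q ^- 2 *: (Ei * a') ->
  Ei * Fi = Fi * Ei + c *: (a - a') -> Ej * Fi = Fi * Ej ->
  (Ei * Ej - q^-1 *: (Ej * Ei)) * - (Fi * a)
    - q^-1 *: (- (Fi * a) * (Ei * Ej - q^-1 *: (Ej * Ei))) = Ej.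
Proof.
move=> h1 h2 h3 h4 h5 h6 h7.
nc_reduce k [:: Fi; Ei; Ej; a; a'] (tt, h1, h2, h3, h4, h5, h6, h7); nc_done.
Qed.

Lemma rank2_F (Ei Fi Fj a a' : A) :
  a * Fi = q ^- 2 *: (Fi * a) -> a * Fj = q *: (Fj * a) -> a' * a = 1 ->
  a' * Fi = q ^+ 2 *: (Fi * a') -> a' * Fj = q^-1 *: (Fj * a') -> a * a' = 1 ->
  Ei * Fi = Fi * Ei + c *: (a - a') -> Ei * Fj = Fj * Ei ->
  - (a' * Ei) * (Fj * Fi - q *: (Fi * Fj)) - q *: ((Fj * Fi - q *: (Fi * Fj)) * - (a' * Ei))
  = Fj.
Proof.
move=> h1 h2 h3 h4 h5 h6 h7 h8.
nc_reduce k [:: Fi; Fj; Ei; a; a'] (tt, h1, h2, h3, h4, h5, h6, h7, h8); nc_done.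
Qed.

(** The atoms a, a', b, b' stand for K_i, K_i^-1, K_j, K_j^-1, and
    B_i = F_i + vi E_j K_i^-1, B_j = F_j + vj E_i K_j^-1. Rewriting orders each
    word as F's, then E's, then torus elements. *)
Lemma qserre_swapped vi vj Fi Fj Ei Ej a a' b b' :
  a * Fi = q ^- 2 *: (Fi * a) -> a * Fj = q *: (Fj * a) ->
  a * Ei = q ^+ 2 *: (Ei * a) -> a * Ej = q^-1 *: (Ej * a) ->
  a' * Fi = q ^+ 2 *: (Fi * a') -> a' * Fj = q^-1 *: (Fj * a') ->
  a' * Ei = q ^- 2 *: (Ei * a') -> a' * Ej = q *: (Ej * a') ->
  b * Fi = q *: (Fi * b) -> b * Fj = q ^- 2 *: (Fj * b) ->
  b * Ei = q^-1 *: (Ei * b) -> b * Ej = q ^+ 2 *: (Ej * b) ->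
  b' * Fi = q^-1 *: (Fi * b') -> b' * Fj = q ^+ 2 *: (Fj * b') ->
  b' * Ei = q *: (Ei * b') -> b' * Ej = q ^- 2 *: (Ej * b') ->
  a * a' = 1 -> a' * a = 1 -> b * b' = 1 -> b' * b = 1 ->
  b * a = a * b -> b * a' = a' * b -> b' * a = a * b' -> b' * a' = a' * b' ->
  Ei * Fi = Fi * Ei + c *: (a - a') -> Ej * Fj = Fj * Ej + c *: (b - b') ->
  Ei * Fj = Fj * Ei -> Ej * Fi = Fi * Ej ->
  qserre (Fi + vi *: (Ej * a')) (Fj + vj *: (Ei * b')) =
    qserre Fi Fj + (vi ^+ 2 * vj) *: qserre (Ej * a') (Ei * b')
    + - (q + q^-1) *: ((q * vj *: (a * b') + q ^- 2 * vi *: (b * a'))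
                      * (Fi + vi *: (Ej * a'))).
Proof.
move=> h1 h2 h3 h4 h5 h6 h7 h8 h9 h10 h11 h12 h13 h14 h15 h16 h17 h18 h19 h20
  h21 h22 h23 h24 h25 h26 h27 h28; rewrite /qserre.
nc_reduce k [:: Fi; Fj; Ei; Ej; a; a'; b; b']
  (tt, h1, h2, h3, h4, h5, h6, h7, h8, h9, h10, h11, h12, h13, h14, h15, h16,
   h17, h18, h19, h20, h21, h22, h23, h24, h25, h26, h27, h28); nc_done.
Qed.

(** Here j and l are the neighbours of i, and T, Z, W are the explicit values of
    T_l(E_i), Z_i, W_ij. The bracket of Z with F_j converts the K_j^-1 that the
    computation produces into the K_j of the statement. *)
Lemma qcross_black_pair Fi Fj Ei Ej El a a' b b' :
  a * Fi = q ^- 2 *: (Fi * a) -> a * Fj = q *: (Fj * a) ->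
  a * Ei = q ^+ 2 *: (Ei * a) -> a * Ej = q^-1 *: (Ej * a) ->
  a * El = q^-1 *: (El * a) -> a' * El = q *: (El * a') ->
  a' * Fi = q ^+ 2 *: (Fi * a') -> a' * Fj = q^-1 *: (Fj * a') ->
  a' * Ei = q ^- 2 *: (Ei * a') -> a' * Ej = q *: (Ej * a') ->
  b * Fi = q *: (Fi * b) -> b * Fj = q ^- 2 *: (Fj * b) ->
  b * Ei = q^-1 *: (Ei * b) -> b * Ej = q ^+ 2 *: (Ej * b) ->
  b * El = El * b -> b' * El = El * b' ->
  b' * Fi = q^-1 *: (Fi * b') -> b' * Fj = q ^+ 2 *: (Fj * b') ->
  b' * Ei = q *: (Ei * b') -> b' * Ej = q ^- 2 *: (Ej * b') ->
  a * a' = 1 -> a' * a = 1 ->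
  b * a = a * b -> b * a' = a' * b -> b' * a = a * b' -> b' * a' = a' * b' ->
  Ei * Fi = Fi * Ei + c *: (a - a') -> Ej * Fj = Fj * Ej + c *: (b - b') ->
  Ei * Fj = Fj * Ei -> Ej * Fi = Fi * Ej -> El * Fi = Fi * El ->
  El * Fj = Fj * El -> El * Ej = Ej * El ->
  let T := El * Ei - q^-1 *: (Ei * El) in
  let Z := (1 - q ^- 2) ^+ 2 *: (Ej * El) in
  let W := (1 - q ^- 2) *: El in
  qcross Fi ((Ej * T - q^-1 *: (T * Ej)) * a') Fj =
    c *: (q ^+ 2 *: (Fj * Z) - Z * Fj) + ((q + q^-1) * c) *: (W * b).
Proof.
move=> h1 h2 h3 h4 h5 h6 h7 h8 h9 h10 h11 h12 h13 h14 h15 h16 h17 h18 h19 h20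
  h21 h22 h23 h24 h25 h26 h27 h28 h29 h30 h31 h32 h33 T Z W; rewrite /qcross /W /Z /T {T Z W}.
nc_reduce k [:: Fi; Fj; Ei; Ej; El; a; a'; b; b']
  (tt, h1, h2, h3, h4, h5, h6, h7, h8, h9, h10, h11, h12, h13, h14, h15, h16,
   h17, h18, h19, h20, h21, h22, h23, h24, h25, h26, h27, h28, h29, h30, h31,
   h32, h33); nc_done.
Qed.

End QSerre.

(** * Pairings, reflections and reduced words *)

Section RootDatumLemmas.
Variables (N : nat) (par : 'I_N -> bool).
Local Notation I := 'I_N.-1.
Local Notation npar := (npar par).
Implicit Types (i j l : I) (a b : 'I_N).

Lemma alphaE i a : alpha i 0 a = ((val a == i)%:R - (val a == i.+1)%:R : int).
Proof. by rewrite !mxE !eqxx /= -!val_eqE. Qed.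

Lemma lo_neq_hi i : (lo i == hi i) = false.
Proof. by rewrite -val_eqE /=; lia. Qed.

Lemma epsE a b : eps a 0 b = (b == a)%:R.
Proof. by rewrite mxE eqxx. Qed.

Lemma cpair_epsl a (l : 'rV[int]_N) : cpair (eps a) l = l 0 a.
Proof.
rewrite /cpair (bigD1 a) //= epsE eqxx mul1r big1 ?addr0 // => b ba.
by rewrite epsE (negPf ba) mul0r.
Qed.

Lemma cpairC (h l : 'rV[int]_N) : cpair h l = cpair l h.
Proof. by apply: eq_bigr => a _; rewrite mulrC. Qed.

Lemma cpairDr (h l l' : 'rV[int]_N) : cpair h (l + l') = cpair h l + cpair h l'.
Proof. by rewrite -big_split; apply: eq_bigr => a _; rewrite mxE mulrDr. Qed.

Lemma cpairZr c (h l : 'rV[int]_N) : cpair h (c *: l) = c * cpair h l.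
Proof. by rewrite mulr_sumr; apply: eq_bigr => a _; rewrite mxE mulrCA. Qed.

Lemma cpairNr (h l : 'rV[int]_N) : cpair h (- l) = - cpair h l.
Proof. by rewrite -scaleN1r cpairZr mulN1r. Qed.

Lemma cpairBr (h l l' : 'rV[int]_N) : cpair h (l - l') = cpair h l - cpair h l'.
Proof. by rewrite cpairDr cpairNr. Qed.

Lemma cpairDl (h h' l : 'rV[int]_N) : cpair (h + h') l = cpair h l + cpair h' l.
Proof. by rewrite ![cpair _ l]cpairC cpairDr. Qed.

Lemma cpairNl (h l : 'rV[int]_N) : cpair (- h) l = - cpair h l.
Proof. by rewrite ![cpair _ l]cpairC cpairNr. Qed.

Lemma cpairZl c (h l : 'rV[int]_N) : cpair (c *: h) l = c * cpair h l.
Proof. by rewrite ![cpair _ l]cpairC cpairZr. Qed.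

Lemma cpair_hcoroot i (l : 'rV[int]_N) :
  cpair (hcoroot par i) l = l 0 (lo i) - (-1) ^+ npar i * l 0 (hi i).
Proof. by rewrite /hcoroot cpairDl cpairNl cpairZl !cpair_epsl. Qed.

Lemma cartanE i j : cartan par i j =
  ((i == j :> nat)%:R - (i == j.+1 :> nat)%:R)
   - (-1) ^+ npar i * ((i.+1 == j :> nat)%:R - (i.+1 == j.+1 :> nat)%:R).
Proof. by rewrite /cartan cpair_hcoroot !alphaE. Qed.

Lemma cartan_even i j : ~~ npar i -> cartan par i j =
  if i == j then 2 else if next_to i j then -1 else 0.
Proof.
move=> /negPf ei; rewrite cartanE ei expr0 mul1r eqSS /next_to -val_eqE /=.
by case: (ltngtP i j) => ij; repeat (case: eqP => ? //=); lia.
Qed.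

Lemma adjE i j : adj par i j = next_to i j.
Proof.
rewrite /adj cartanE eqSS /next_to -val_eqE /=.
by case: (ltngtP (i : nat) j) => ij /=; case: (npar i); rewrite ?expr0 ?expr1;
  repeat (case: eqP => ? //=); lia.
Qed.

Lemma next_toC i j : next_to i j = next_to j i.
Proof. by rewrite /next_to orbC. Qed.

Lemma next_to_neq i j : next_to i j -> i != j.
Proof. by rewrite /next_to -val_eqE /=; lia. Qed.

Lemma wform_alphal i (l : 'rV[int]_N) : wform par (alpha i) l =
  (-1) ^+ par (lo i) * l 0 (lo i) - (-1) ^+ par (hi i) * l 0 (hi i).
Proof.
have E a : \sum_b (-1) ^+ par b * (eps a 0 b) * l 0 b = (-1) ^+ par a * l 0 a.
  rewrite (bigD1 a) //= epsE eqxx mulr1 big1 ?addr0 // => b ba.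
  by rewrite epsE (negPf ba) mulr0 mul0r.
rewrite -!E -sumrB; apply: eq_bigr => a _.
by rewrite [alpha i _ _]mxE [(- eps _) _ _]mxE mulrBr mulrBl.
Qed.

(** Conjugation by K_i is therefore governed by the bilinear form on P. *)
Lemma Kvec_pair i (l : 'rV[int]_N) : cpair (Kvec par i) l = wform par (alpha i) l.
Proof.
rewrite /Kvec cpairZl cpair_hcoroot wform_alphal /dsgn mulrBr mulrA -signr_addb.
by rewrite /Defs.npar addbA addbb.
Qed.

Lemma even_par i : ~~ npar i -> par (hi i) = par (lo i).
Proof. by rewrite /Defs.npar; case: (par (lo i)) (par (hi i)) => [] []. Qed.

Lemma Kvec_even i : ~~ npar i -> Kvec par i = dsgn par i *: alpha i.
Proof. by move=> /negPf ei; rewrite /Kvec /hcoroot ei expr0 scale1r. Qed.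

Lemma wformC (l l' : 'rV[int]_N) : wform par l l' = wform par l' l.
Proof. by apply: eq_bigr => a _; rewrite mulrAC. Qed.

Lemma wform_next i j : ~~ npar i -> next_to i j ->
  wform par (alpha i) (alpha j) = - dsgn par i.
Proof.
move=> ei ij; rewrite wform_alphal (even_par ei) -mulrBr /dsgn !alphaE eqSS.
rewrite [X in _ * X](_ : _ = -1) ?mulrN1 //=; move: ij; rewrite /next_to.
by repeat (case: eqP => ? //=); lia.
Qed.

Lemma wform_diag i : ~~ npar i -> wform par (alpha i) (alpha i) = dsgn par i * 2.
Proof.
move=> ei; rewrite wform_alphal (even_par ei) -mulrBr /dsgn !alphaE eqxx /=.
by repeat case: eqP; lia.
Qed.

Lemma wform_far i j : ~~ npar i -> i != j -> ~~ next_to i j ->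
  wform par (alpha i) (alpha j) = 0.
Proof.
move=> ei ij nij; rewrite wform_alphal (even_par ei) -mulrBr !alphaE /=.
rewrite [X in _ * X](_ : _ = 0) ?mulr0 //; move: ij nij.
by rewrite /next_to -val_eqE /=; repeat (case: eqP => //=); move=> *; lia.
Qed.

Lemma next_sides i j l : next_to i j -> next_to i l -> l != j ->
  (i = j.+1 :> nat /\ l = i.+1 :> nat) \/ (j = i.+1 :> nat /\ i = l.+1 :> nat).
Proof. by rewrite /next_to -val_eqE /=; lia. Qed.

Lemma next_unique i j l m : next_to i j -> next_to i l -> l != j ->
  next_to m i -> (m == j) || (m == l).
Proof. by rewrite /next_to -!val_eqE /=; lia. Qed.

Lemma next_far i j l : next_to i j -> next_to i l -> l != j -> ~~ next_to j l.
Proof. by rewrite /next_to -val_eqE /=; lia. Qed.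

Lemma far_endpoint i l a : i != l -> ~~ next_to i l -> a = lo i \/ a = hi i ->
  a != lo l /\ a != hi l.
Proof.
by rewrite /next_to => il nil; case=> ->; rewrite -!val_eqE /=; move: il nil;
  rewrite -val_eqE /=; lia.
Qed.

Lemma wformNr (l l' : 'rV[int]_N) : wform par l (- l') = - wform par l l'.
Proof. by rewrite /wform -sumrN; apply: eq_bigr => a _; rewrite mxE mulrN. Qed.

Lemma wformBr (l l' l'' : 'rV[int]_N) :
  wform par l (l' - l'') = wform par l l' - wform par l l''.
Proof. by rewrite /wform -sumrB; apply: eq_bigr => a _; rewrite !mxE mulrBr. Qed.

Lemma wform_eps a b :
  wform par (eps a) (eps b) = if a == b then (-1) ^+ par a else 0.
Proof.
rewrite /wform (bigD1 a) //= !epsE eqxx mulr1 big1 ?addr0 => [|c ca].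
  by case: eqP => _; rewrite ?mulr1 ?mulr0.
by rewrite !epsE (negPf ca) mulr0 mul0r.
Qed.

Lemma eps_inj : injective (@eps N).
Proof.
move=> a b /matrixP /(_ 0 a); rewrite !epsE eqxx.
by case: eqP.
Qed.

Lemma sub_eps_inj a b c d : c != d -> eps a - eps b = eps c - eps d ->
  a = c /\ b = d.
Proof.
move=> cd /matrixP E; have {}E x := E 0 x.
have := E c; have := E d; rewrite !mxE !eqxx /= (negPf cd) [d == c]eq_sym (negPf cd).
by case: (eqVneq c a) (eqVneq d b) => [->|_] [->|_] //; do 2 case: eqP => //.
Qed.

(** The Weyl group of a set of even nodes acts on P by permuting the eps_a. Working
    with this permutation of the indices turns w alpha_i < 0 into an inequality
    between two numbers. *)
Definition st i : {perm 'I_N} := tperm (lo i) (hi i).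
Definition pact (w : seq I) a : 'I_N := foldr (fun i b => st i b) a w.

Lemma st_val i a :
  nat_of_ord (st i a) =
    if a == i :> nat then i.+1 else if a == i.+1 :> nat then (i : nat) else (a : nat).
Proof.
rewrite /st permE /= -!val_eqE /=.
by case: ifP => // _; case: ifP.
Qed.

Lemma srefl_eps i a : ~~ npar i -> srefl par i (eps a) = eps (st i a).
Proof.
move=> ei; apply/matrixP => x b; rewrite {x}(ord1 x).
rewrite [LHS]mxE [X in _ + X]mxE [X in _ - X]mxE alphaE cpair_hcoroot (negPf ei).
rewrite expr0 mul1r !epsE -!val_eqE /= st_val.
by case: (nat_of_ord a =P i) => ?; [|case: (nat_of_ord a =P i.+1) => ?];
  repeat (case: eqP => ? //=); lia.
Qed.

Lemma pact_cat u v a : pact (u ++ v) a = pact u (pact v a).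
Proof. by rewrite /pact foldr_cat. Qed.

Lemma pact_rcons u i a : pact (rcons u i) a = pact u (st i a).
Proof. by rewrite -cats1 pact_cat. Qed.

Lemma pact_inj w : injective (pact w).
Proof. by elim: w => //= i w IH a b /perm_inj /IH. Qed.

Lemma pact_lo_hi w i : (pact w (hi i) < pact w (lo i))%N = false ->
  (pact w (lo i) < pact w (hi i))%N.
Proof.
rewrite ltnNge => /negbFE; rewrite leq_eqVlt => /orP[/eqP|//].
by move=> /val_inj/pact_inj/(congr1 val) /=; lia.
Qed.

Lemma sreflD i : {morph srefl par i : l l' / l + l'}.
Proof. by move=> l l'; rewrite /srefl cpairDr scalerDl opprD addrACA. Qed.
Lemma sreflZ i c : {morph srefl par i : l / c *: l}.
Proof. by move=> l; rewrite /srefl cpairZr [RHS]scalerBr scalerA. Qed.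

Lemma wactD w : {morph wact par w : l l' / l + l'}.
Proof. by move=> l l'; elim: w => //= i w ->; rewrite sreflD. Qed.
Lemma wactZ w c : {morph wact par w : l / c *: l}.
Proof. by move=> l; elim: w => //= i w ->; rewrite sreflZ. Qed.
Lemma wactN w : {morph wact par w : l / - l}.
Proof. by move=> l; rewrite -!scaleN1r wactZ. Qed.
Lemma wact0 w : wact par w 0 = 0.
Proof. by rewrite -[X in wact _ _ X](scale0r 0) wactZ scale0r. Qed.

Lemma rowE_eps (l : 'rV[int]_N) : l = \sum_a l 0 a *: eps a.
Proof.
apply/matrixP => x b; rewrite {x}(ord1 x) summxE (bigD1 b) //= mxE epsE eqxx mulr1.
by rewrite big1 ?addr0 // => a ab; rewrite mxE epsE eq_sym (negPf ab) mulr0.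
Qed.

Lemma wact_sum w (l : 'rV[int]_N) : wact par w l = \sum_a l 0 a *: wact par w (eps a).
Proof.
rewrite [in LHS](rowE_eps l) (big_morph _ (wactD w) (wact0 w)).
by apply: eq_bigr => a _; rewrite wactZ.
Qed.

Section EvenWords.
Variable D : {set I}.
Hypothesis evD : forall i, i \in D -> ~~ npar i.

Lemma wact_eps w a : word_on D w -> wact par w (eps a) = eps (pact w a).
Proof.
elim: w => //= i w IH /andP[iD wD]; rewrite (IH wD) srefl_eps //; exact: evD.
Qed.

Lemma wact_alpha w i : word_on D w ->
  wact par w (alpha i) = eps (pact w (lo i)) - eps (pact w (hi i)).
Proof. by move=> wD; rewrite /alpha wactD wactN !wact_eps. Qed.

Lemma pact_par w a : word_on D w -> par (pact w a) = par a.
Proof.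
elim: w => //= i w IH /andP[iD wD]; rewrite -(IH wD) /st permE /=.
by case: eqP => [->|_]; [|case: eqP => [->|//]]; rewrite (even_par (evD iD)).
Qed.

Lemma eq_wact_pact u v : word_on D u -> word_on D v ->
  (wact par u =1 wact par v) <-> (pact u =1 pact v).
Proof.
move=> uD vD; split=> E x; first by apply: eps_inj; rewrite -!wact_eps.
by rewrite !wact_sum; apply: eq_bigr => a _; rewrite !wact_eps // E.
Qed.

Definition red w := word_on D w /\
  forall v, word_on D v -> pact v =1 pact w -> (size w <= size v)%N.

Lemma redE w : reduced_on par D w <-> red w.
Proof.
by split=> -[wD H]; split=> // v vD E; apply: H => //;
  move: E; rewrite (eq_wact_pact vD wD).
Qed.

(** A right descent: w sends alpha_i to a negative root. *)
Definition rdesc w i := (pact w (hi i) < pact w (lo i))%N.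

(** The strong exchange property: if w reverses a pair a < b, some letter of w is
    the one at which the images of a and b pass each other, and deleting it
    multiplies w by the transposition of a and b. *)
Lemma exchange_pair w (a b : 'I_N) : word_on D w -> (a < b)%N ->
  (pact w b < pact w a)%N ->
  exists v, [/\ word_on D v, size w = (size v).+1 &
    forall c, pact w c = pact v (tperm a b c)].
Proof.
elim/last_ind: w a b => [|u i IH] a b; first by move=> _ /= *; lia.
rewrite /word_on all_rcons => /andP[iD uD] ab; rewrite !pact_rcons => H.
case: (ltnP (st i a) (st i b)) => sab.
  have [v [vD sv Ev]] := IH _ _ uD sab H.
  exists (rcons v i); rewrite /word_on all_rcons iD !size_rcons sv; split=> // c.
  by rewrite !pact_rcons Ev -(inj_tperm _ _ _ (@perm_inj _ (st i))).
exists u; rewrite size_rcons; split=> // c; rewrite pact_rcons.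
suff [-> ->] : a = lo i /\ b = hi i by [].
move: sab; rewrite !st_val => sab.
by split; apply: val_inj => /=; move: sab; repeat (case: eqP => ? //=); lia.
Qed.

Lemma exchange w i : word_on D w -> rdesc w i ->
  exists v, [/\ word_on D v, size w = (size v).+1 & pact w =1 pact (rcons v i)].
Proof.
have lt_i : (lo i < hi i)%N by [].
move=> wD /(exchange_pair wD lt_i) [v [vD sv Ev]].
by exists v; split=> // c; rewrite pact_rcons Ev.
Qed.

Lemma word_rcons v i : word_on D (rcons v i) = (i \in D) && word_on D v.
Proof. exact: all_rcons. Qed.

Lemma red_rcons v i : red (rcons v i) -> red v.
Proof.
move=> [/[!word_rcons] /andP[iD vD] H]; split=> // u uD E.
have := H (rcons u i); rewrite word_rcons iD uD !size_rcons ltnS; apply=> // c.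
by rewrite !pact_rcons E.
Qed.

Lemma red_eq u v : red u -> word_on D v -> pact v =1 pact u -> size v = size u ->
  red v.
Proof.
move=> [uD H] vD E sv; split=> // x xD Ex; rewrite sv; apply: H => // c.
by rewrite Ex E.
Qed.

Lemma red_size u v : red u -> red v -> pact u =1 pact v -> size u = size v.
Proof.
move=> [uD Hu] [vD Hv] E; apply/eqP; rewrite eqn_leq Hu ?Hv // => c; by rewrite E.
Qed.

Lemma st_lo i : st i (lo i) = hi i. Proof. exact: tpermL. Qed.
Lemma st_hi i : st i (hi i) = lo i. Proof. exact: tpermR. Qed.
Lemma st_st i a : st i (st i a) = a. Proof. exact: tpermK. Qed.

Lemma red_rdesc v i : red (rcons v i) ->
  rdesc (rcons v i) i /\ (pact v (lo i) < pact v (hi i))%N.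
Proof.
move=> rv; rewrite /rdesc !pact_rcons st_lo st_hi.
suff H : (pact v (lo i) < pact v (hi i))%N by [].
apply: pact_lo_hi; apply/negP => H.
have [vD _] := red_rcons rv.
have [x [xD sx Ex]] := exchange vD H.
have /(_ x xD) : _ := rv.2; rewrite size_rcons sx => L.
suff: ((size x).+1 < size x)%N by lia.
by apply: L => c; rewrite pact_rcons Ex pact_rcons st_st.
Qed.

Lemma st_far i j a : j != i -> ~~ next_to i j -> a = lo j \/ a = hi j -> st i a = a.
Proof.
rewrite /next_to -val_eqE /= => ij nij E; apply: val_inj; rewrite /= st_val.
by move: ij nij; case: E => -> /=; repeat (case: eqP => ? //=); lia.
Qed.

Lemma st_comm i j a : j != i -> ~~ next_to i j -> st i (st j a) = st j (st i a).
Proof.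
rewrite /next_to -val_eqE /= => ij nij; apply: val_inj; rewrite /= !st_val.
by move: ij nij; repeat (case: eqP => //=); move=> *; lia.
Qed.

Lemma st_braid i j a : next_to i j -> st i (st j (st i a)) = st j (st i (st j a)).
Proof.
rewrite /next_to => ij; apply: val_inj; rewrite /= !st_val.
by move: ij; repeat (case: eqP => //=); move=> *; lia.
Qed.

Lemma st_next_lo i j : next_to i j -> st i (st j (lo i)) = lo j.
Proof.
rewrite /next_to => ij; apply: val_inj; rewrite /= !st_val /=.
by move: ij; repeat (case: eqP => //=); move=> *; lia.
Qed.

Lemma st_next_hi i j : next_to i j -> st i (st j (hi i)) = hi j.
Proof.
rewrite /next_to => ij; apply: val_inj; rewrite /= !st_val /=.
by move: ij; repeat (case: eqP => //=); move=> *; lia.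
Qed.

Lemma next_cases i j : next_to i j ->
  [/\ hi i = lo j, st i (hi j) = hi j & st i (lo j) = lo i] \/
  [/\ hi j = lo i, st i (hi j) = hi i & st i (lo j) = lo j].
Proof.
rewrite /next_to => /orP[] /eqP ij; [left|right]; split; apply: val_inj;
  rewrite /= ?st_val /=; by repeat (case: eqP => //=); move=> *; lia.
Qed.

End EvenWords.
End RootDatumLemmas.

(** * Braid operators along reduced words *)

Section UBasics.
Variables (k : fieldType) (q : k) (N : nat) (par : 'I_N -> bool).
Hypothesis q0 : q != 0.
Hypothesis q1 : q - q^-1 != 0.
Local Notation I := 'I_N.-1.
Local Notation U := (U q par).
Local Notation npar := (npar par).
Implicit Types (i j l : I) (x y : U).

Lemma UK0 : UK 0 = 1 :> U. Proof. exact: UrelK0 (Urel_U q par). Qed.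
Lemma UKD h h' : UK (h + h') = UK h * UK h' :> U.
Proof. exact: UrelKD (Urel_U q par) h h'. Qed.
Lemma UKV h : UK (- h) * UK h = 1 :> U. Proof. by rewrite -UKD addNr UK0. Qed.
Lemma UVK h : UK h * UK (- h) = 1 :> U. Proof. by rewrite -UKD subrr UK0. Qed.
Lemma UKC h h' : UK h * UK h' = UK h' * UK h :> U.
Proof. by rewrite -!UKD addrC. Qed.

Lemma UKiV i : UKi_inv i * UKi i = 1 :> U. Proof. exact: UKV. Qed.
Lemma UKVi i : UKi i * UKi_inv i = 1 :> U. Proof. exact: UVK. Qed.

(** Weight spaces, as eigenspaces of conjugation by the torus. *)
Definition has_wt (g : 'rV[int]_N) x :=
  forall h, UK h * x = q ^ cpair h g *: (x * UK h).

Lemma wtE i : has_wt (alpha i) (UE i).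
Proof. by move=> h; exact: UrelKE (Urel_U q par) h i. Qed.

Lemma wtF i : has_wt (- alpha i) (UF i).
Proof. by move=> h; rewrite cpairNr; exact: UrelKF (Urel_U q par) h i. Qed.

Lemma wt_Ki i g x : has_wt g x -> UKi i * x = q ^ wform par (alpha i) g *: (x * UKi i).
Proof. by move=> W; rewrite /UKi W Kvec_pair. Qed.

Lemma wt_KiV i g x : has_wt g x ->
  UKi_inv i * x = q ^ (- wform par (alpha i) g) *: (x * UKi_inv i).
Proof. by move=> W; rewrite /UKi_inv W cpairNl Kvec_pair. Qed.

Lemma wt_KiV' i g x : has_wt g x ->
  x * UKi_inv i = q ^ wform par (alpha i) g *: (UKi_inv i * x).
Proof.
move=> /wt_KiV ->; rewrite scalerA -expfzDr // subrr expr0z scale1r //.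
Qed.

Lemma UEF_ne i j : i != j -> ~~ (npar i && npar j) ->
  UE i * UF j = UF j * UE i :> U.
Proof.
move=> ij /negPf p; have := UrelEF (Urel_U q par) i j.
by rewrite /sbr p (negPf ij) expr0 mul1r scale1r => /eqP; rewrite subr_eq0 => /eqP.
Qed.

Local Notation q_ i := (qi q par i).

Lemma qi_neq0 i : q_ i != 0.
Proof. exact: expfz_neq0. Qed.

Lemma qiE i : q_ i = q \/ q_ i = q^-1.
Proof. by rewrite /qi /dsgn; case: (par (lo i)); [right|left]. Qed.

Lemma qi_dif i : q_ i - (q_ i)^-1 != 0.
Proof.
by case: (qiE i) => ->; rewrite // invrK -oppr_eq0 opprB.
Qed.

Lemma UEF_eq i : ~~ npar i ->
  UE i * UF i = UF i * UE i + (q_ i - (q_ i)^-1)^-1 *: (UKi i - UKi_inv i) :> U.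
Proof.
move=> /negPf p; have := UrelEF (Urel_U q par) i i.
rewrite /sbr p eqxx expr0 mul1r scale1r => /eqP; rewrite subr_eq addrC => /eqP.
by [].
Qed.

Lemma q_dsgn i : q ^ dsgn par i = q_ i. Proof. by []. Qed.
Lemma q_dsgnN i : q ^ (- dsgn par i) = (q_ i)^-1.
Proof. by rewrite -invr_expz. Qed.
Lemma q_dsgn2 i : q ^ (dsgn par i * 2) = q_ i ^+ 2.
Proof. by rewrite -exprz_exp. Qed.
Lemma q_dsgn2N i : q ^ (- (dsgn par i * 2)) = q_ i ^- 2.
Proof. by rewrite -invr_expz q_dsgn2. Qed.

Lemma cartan_next i j : ~~ npar i -> next_to i j -> cartan par i j = -1.
Proof.
move=> ei ij; rewrite cartan_even // ij.
by have := next_to_neq ij; rewrite -val_eqE => /negPf ->.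
Qed.

Lemma p2E i j x y : ~~ npar i -> p2 q par i j x y = qserre (q_ i) x y.
Proof.
move=> /negPf ei; rewrite /p2 ei; exact: sbr_qserre (qi_neq0 i) _ _ _ _.
Qed.

Lemma serreF i j : ~~ npar i -> next_to i j -> qserre (q_ i) (UF i : U) (UF j) = 0.
Proof.
move=> ei ij; rewrite -(p2E j) //; apply: (UrelF2 (Urel_U q par)) => //.
by rewrite cartan_next // normrN1.
Qed.

Lemma serreE i j : ~~ npar i -> next_to i j -> qserre (q_ i) (UE i : U) (UE j) = 0.
Proof.
move=> ei ij; rewrite -(p2E j) //; apply: (UrelE2 (Urel_U q par)) => //.
by rewrite cartan_next // normrN1.
Qed.

Variable T : I -> {lrmorphism U -> U}.
Hypothesis braid_T : braid_operators T.

Local Notation Tw := (Tw T).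

Lemma Tw_cat u v x : Tw (u ++ v) x = Tw u (Tw v x).
Proof. by rewrite /Tw foldr_cat. Qed.
Lemma Tw_rcons u i x : Tw (rcons u i) x = Tw u (T i x).
Proof. by rewrite -cats1 Tw_cat. Qed.
Lemma TwD w : {morph Tw w : x y / x + y}.
Proof. by move=> x y; elim: w => //= i w ->; rewrite rmorphD. Qed.
Lemma TwM w : {morph Tw w : x y / x * y}.
Proof. by move=> x y; elim: w => //= i w ->; rewrite rmorphM. Qed.
Lemma TwZ w c : {morph Tw w : x / c *: x}.
Proof. by move=> x; elim: w => //= i w ->; rewrite linearZ. Qed.
Lemma TwN w : {morph Tw w : x / - x}.
Proof. by move=> x; rewrite -!scaleN1r TwZ. Qed.
Lemma TwB w : {morph Tw w : x y / x - y}.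
Proof. by move=> x y; rewrite TwD TwN. Qed.
Lemma Tw0 w : Tw w 0 = 0.
Proof. by rewrite -[X in Tw _ X](scale0r 0) TwZ scale0r. Qed.
Lemma Tw_qserre w c x y : Tw w (qserre c x y) = qserre c (Tw w x) (Tw w y).
Proof. by rewrite /qserre TwD TwB TwZ !TwM. Qed.

Lemma T_next i j : ~~ npar i -> next_to i j ->
  T i (UE j) = UE i * UE j - (q_ i)^-1 *: (UE j * UE i).
Proof. by move=> ei ij; rewrite (T_Enext braid_T) // wform_next // q_dsgnN. Qed.

Lemma T_nextF i j : ~~ npar i -> next_to i j ->
  T i (UF j) = UF j * UF i - q_ i *: (UF i * UF j).
Proof. by move=> ei ij; rewrite (T_Fnext braid_T) // wform_next // opprK q_dsgn. Qed.

Section Rank2.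
Variables (i j : I).
Hypotheses (ei : ~~ npar i) (ij : next_to i j).
Lemma KiEi : UKi i * UE i = q_ i ^+ 2 *: (UE i * UKi i) :> U.
Proof. by rewrite (wt_Ki i (wtE i)) wform_diag // q_dsgn2. Qed.
Lemma KiEj : UKi i * UE j = (q_ i)^-1 *: (UE j * UKi i) :> U.
Proof. by rewrite (wt_Ki i (wtE j)) wform_next // q_dsgnN. Qed.
Lemma KiFi : UKi i * UF i = q_ i ^- 2 *: (UF i * UKi i) :> U.
Proof. by rewrite (wt_Ki i (wtF i)) wformNr wform_diag // q_dsgn2N. Qed.
Lemma KiFj : UKi i * UF j = q_ i *: (UF j * UKi i) :> U.
Proof. by rewrite (wt_Ki i (wtF j)) wformNr wform_next // opprK. Qed.
Lemma KiVEi : UKi_inv i * UE i = q_ i ^- 2 *: (UE i * UKi_inv i) :> U.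
Proof. by rewrite (wt_KiV i (wtE i)) wform_diag // q_dsgn2N. Qed.
Lemma KiVEj : UKi_inv i * UE j = q_ i *: (UE j * UKi_inv i) :> U.
Proof. by rewrite (wt_KiV i (wtE j)) wform_next // opprK. Qed.
Lemma KiVFi : UKi_inv i * UF i = q_ i ^+ 2 *: (UF i * UKi_inv i) :> U.
Proof. by rewrite (wt_KiV i (wtF i)) wformNr wform_diag // opprK q_dsgn2. Qed.
Lemma KiVFj : UKi_inv i * UF j = (q_ i)^-1 *: (UF j * UKi_inv i) :> U.
Proof. by rewrite (wt_KiV i (wtF j)) wformNr wform_next // opprK q_dsgnN. Qed.

(** The inverse of T_i applied to E_j, in the form used below. *)
Lemma T_rank2_bracket : T i (UE j * UE i - (q_ i)^-1 *: (UE i * UE j)) = UE j.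
Proof.
rewrite linearB linearZ /= !rmorphM /= (T_Ei braid_T) // T_next //=.
have EjFi : UE j * UF i = UF i * UE j :> U.
  by apply: UEF_ne; rewrite ?(negPf ei) ?andbF // eq_sym next_to_neq.
exact (rank2_E (qi_neq0 i) (qi_dif i) KiEi KiEj (UKiV i) KiVEj KiVEi (UEF_eq ei) EjFi).
Qed.

Lemma T_rank2_bracketF : T i (UF i * UF j - q_ i *: (UF j * UF i)) = UF j.
Proof.
rewrite linearB linearZ /= !rmorphM /= (T_Fi braid_T) // T_nextF //=.
have EiFj : UE i * UF j = UF j * UE i :> U.
  by apply: UEF_ne; rewrite ?(negPf ei) // next_to_neq.
exact (rank2_F (qi_neq0 i) (qi_dif i) KiFi KiFj (UKiV i) KiVFi KiVFj (UKVi i)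
  (UEF_eq ei) EiFj).
Qed.
End Rank2.

Lemma qi_next i j : ~~ npar i -> ~~ npar j -> next_to i j -> q_ i = q_ j.
Proof.
move=> ei ej ij; rewrite /qi /dsgn; suff -> : par (lo i) = par (lo j) by [].
by case: (next_cases ij) => -[E _ _]; [rewrite -E (even_par ei)|rewrite -E (even_par ej)].
Qed.

Lemma T_rank2E i j : ~~ npar i -> ~~ npar j -> next_to i j ->
  T i (T j (UE i)) = UE j.
Proof.
move=> ei ej ij; rewrite T_next -1?next_toC // -(qi_next ei ej ij).
exact: T_rank2_bracket.
Qed.

Lemma T_rank2F i j : ~~ npar i -> ~~ npar j -> next_to i j ->
  T i (T j (UF i)) = UF j.
Proof.
move=> ei ej ij; rewrite T_nextF -1?next_toC // -(qi_next ei ej ij).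
exact: T_rank2_bracketF.
Qed.

Section Words.
Variable D : {set I}.
Hypothesis evD : forall i, i \in D -> ~~ npar i.
Local Notation red := (red D).
Local Notation word_on := (@word_on N D).

(** If w alpha_i and w alpha_j are negative, so is w (alpha_i + alpha_j). *)
Lemma rdesc_next u i j : next_to i j -> rdesc u i -> rdesc u j ->
  (pact u (st i (hi j)) < pact u (st i (lo j)))%N.
Proof.
rewrite /rdesc => ij; case: (next_cases ij) => -[E -> ->] ui uj.
  by apply: ltn_trans ui; rewrite E.
by apply: leq_trans ui _; rewrite ltnW // -E.
Qed.

(** Matsumoto's theorem for the action on U, by induction on the length. Let the
    two words end in s and t. The element then has both s and t as right
    descents, and the exchange property gives it a third reduced word, which
    ends in the longest word of the subgroup generated by s and t. That word can be
    made to end in s or in t by one braid or commutation relation, which the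
    T_i satisfy, and the induction hypothesis applies to the initial segments. *)
Lemma matsumoto u v x : red u -> red v -> pact u =1 pact v -> Tw u x = Tw v x.
Proof.
move: {2}(size u) (leqnn (size u)) => n; elim: n u v x => [|n IH] u v x.
  case: u => // _ ru rv E; have /esym/size0nil -> // := red_size ru rv E.
case/lastP: u => [|u s] su ru rv E.
  by have /esym/size0nil -> // := red_size ru rv E.
have := red_size ru rv E; rewrite size_rcons.
case/lastP: v rv E => // v t rv E; rewrite size_rcons => -[suv].
have {}su : (size u <= n)%N by move: su; rewrite size_rcons.
have [uD vD] : word_on u /\ word_on v.
  by split; [have [] := red_rcons ru|have [] := red_rcons rv].
have [sD tD] : s \in D /\ t \in D.
  by split; [have := ru.1|have := rv.1]; rewrite word_rcons => /andP[].
have ru' := red_rcons ru; have rv' := red_rcons rv.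
have Eu c : pact u c = pact (rcons u s) (st s c) by rewrite pact_rcons st_st.
have Ev c : pact v c = pact (rcons u s) (st t c) by rewrite E pact_rcons st_st.
rewrite !Tw_rcons; have [st_eq|nst] := eqVneq s t.
  by rewrite st_eq; apply: IH => // c; rewrite Eu Ev st_eq.
have ds : rdesc (rcons u s) s by case: (red_rdesc ru).
have dt : rdesc (rcons u s) t by rewrite /rdesc !E; case: (red_rdesc rv).
have [nx|nx] := boolP (next_to s t); last first.
  have nts : t != s by rewrite eq_sym.
  have far a : a = lo t \/ a = hi t -> st s a = a by apply: st_far.
  have dut : rdesc u t by rewrite /rdesc !Eu !far; auto.
  have [y [yD sy Ey]] := exchange uD dut.
  have Eys : pact v =1 pact (rcons y s).
    by move=> c; rewrite Ev !pact_rcons (st_comm _ nts nx) Ey pact_rcons st_st.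
  have ryt : red (rcons y t).
    by apply: (red_eq ru') => [||]; rewrite ?word_rcons ?tD // size_rcons.
  have rys : red (rcons y s).
    by apply: (red_eq rv') => [|c|]; rewrite ?word_rcons ?sD ?Eys // size_rcons -suv.
  rewrite (IH _ _ _ su ru' ryt Ey) (IH v _ _ _ rv' rys Eys) -?suv //.
  by rewrite !Tw_rcons (T_comm braid_T x (evD sD) (evD tD) nts nx).
have dut : rdesc u t by rewrite /rdesc !Eu; exact: rdesc_next.
have [z [zD sz Ez]] := exchange uD dut.
(* The word ends in s, t, s up to an initial segment y. *)
have Ezc c : pact z c = pact (rcons u s) (st s (st t c)).
  by rewrite -Eu Ez pact_rcons st_st.
have dz : rdesc z s by rewrite /rdesc !Ezc st_next_lo ?st_next_hi.
have [y [yD sy Ey]] := exchange zD dz.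
have E1 : pact (rcons (rcons y s) t) =1 pact u.
  by move=> c; rewrite pact_rcons -Ey Ez pact_rcons.
have E2 : pact (rcons (rcons y t) s) =1 pact v.
  move=> c; rewrite !pact_rcons Ev -[RHS]/(pact _ (st t c)).
  have -> d : pact y d = pact (rcons u s) (st s (st t (st s d))).
    by rewrite -Ezc Ey pact_rcons st_st.
  by rewrite st_braid // !st_st.
have ryst : red (rcons (rcons y s) t).
  by apply: (red_eq ru') => //; rewrite ?word_rcons ?tD ?sD // !size_rcons -sy -sz.
have ryts : red (rcons (rcons y t) s).
  by apply: (red_eq rv') => //; rewrite ?word_rcons ?tD ?sD // !size_rcons -sy -sz suv.
rewrite (IH _ _ _ su ru' ryst) // (IH v _ _ _ rv' ryts) -?suv //.
by rewrite !Tw_rcons (T_braid braid_T) // evD.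
Qed.
(** The rank two step of the inductions below: if v s_j is reduced and l is a
    neighbour of j that v sends to a negative root, then v = u s_l. *)
Lemma red_adj v j l : red (rcons v j) -> next_to j l -> l \in D ->
  (pact v (hi l) < pact v (lo l))%N ->
  exists u, [/\ red u, (size u < size v)%N,
    forall x, Tw (rcons v j) x = Tw u (T l (T j x)),
    pact u (lo j) = pact (rcons v j) (lo l) &
    pact u (hi j) = pact (rcons v j) (hi l)].
Proof.
move=> rv jl lD d; have rv' := red_rcons rv.
have [u [uD su Eu]] := exchange rv'.1 d.
have rul : red (rcons u l).
  by apply: (red_eq rv') => //; rewrite ?word_rcons ?lD // size_rcons su.
have E c : pact u c = pact (rcons v j) (st j (st l c)).
  by rewrite pact_rcons st_st Eu pact_rcons st_st.
exists u; split.
- exact: red_rcons rul.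
- by rewrite su.
- by move=> x; rewrite Tw_rcons (matsumoto _ rv' rul Eu) Tw_rcons.
- by rewrite E st_next_lo.
- by rewrite E st_next_hi.
Qed.

(** The hypotheses say v alpha_i = alpha_l, so the last letter j of v is not i. If
    it is far from i, it does nothing; if it is adjacent, v must end in
    s_i s_j, and T_i T_j maps F_i to F_j. *)
Lemma Tw_simple_F v i l : red v -> i \in D ->
  pact v (lo i) = lo l -> pact v (hi i) = hi l -> Tw v (UF i) = UF l.
Proof.
move: {2}(size v) (leqnn (size v)) => n; elim: n v i => [|n IH] v i.
  by case: v => // _ _ _ /(congr1 val) /= /val_inj ->.
case/lastP: v => [|v j]; first by move=> _ _ _ /(congr1 val) /= /val_inj ->.
rewrite size_rcons ltnS => sv rv iD El Eh.
have := rv.1; rewrite word_rcons => /andP[jD vD].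
have [d _] := red_rdesc rv.
have [ij|ij] := eqVneq i j.
  by subst j; move: d; rewrite /rdesc El Eh /=; lia.
have [nx|nx] := boolP (next_to j i); last first.
  have far a : a = lo i \/ a = hi i -> st j a = a by apply: st_far.
  rewrite Tw_rcons (T_Ffar braid_T) ?evD //; apply: IH => //.
  - exact: red_rcons rv.
  - by rewrite -El pact_rcons far; auto.
  - by rewrite -Eh pact_rcons far; auto.
have d' : (pact v (hi i) < pact v (lo i))%N.
  have E c : pact v c = pact (rcons v j) (st j c) by rewrite pact_rcons st_st.
  rewrite !E; move: d; rewrite /rdesc.
  have neq a b : a != b -> pact (rcons v j) a != pact (rcons v j) b :> nat.
    by apply: contra => /eqP /val_inj /pact_inj ->.
  case: (next_cases nx) => -[E' -> ->].
    have /neq : lo j != hi i by move/(congr1 val): E'; rewrite -val_eqE /=; lia.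
    by rewrite E' El Eh /=; lia.
  have /neq : hi j != lo i by move/(congr1 val): E'; rewrite -val_eqE /=; lia.
  by rewrite -E' El Eh /=; lia.
have [u [ru su Eu ul uh]] := red_adj rv nx iD d'.
rewrite Eu T_rank2F ?evD 1?next_toC //; apply: IH => //.
- exact: leq_trans (ltnW su) sv.
- by rewrite ul.
- by rewrite uh.
Qed.

(** T_v(E_i) is a combination of products of E_i and the E's of D as soon as
    v alpha_i is positive, and F_f commutes with all of these. Peeling off the
    last letter j either brackets T_v'(E_j) with T_v'(E_i), both of the same
    kind, or is the rank two reduction of [red_adj]. *)
Lemma Tw_commF f v i : f \notin D -> f != i -> ~~ (npar f && npar i) ->
  red v -> (i \in D -> (pact v (lo i) < pact v (hi i))%N) ->
  UF f * Tw v (UE i) = Tw v (UE i) * UF f.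
Proof.
move=> fD; move: {2}(size v) (leqnn (size v)) => n; elim: n v i => [|n IH] v i.
  by case: v => // _ fi pfi _ _ /=; rewrite UEF_ne 1?eq_sym // andbC.
case/lastP: v => [|v j].
  by move=> _ fi pfi _ _ /=; rewrite UEF_ne 1?eq_sym // andbC.
rewrite size_rcons ltnS => sv fi pfi rv pos.
have := rv.1; rewrite word_rcons => /andP[jD vD].
have [d d'] := red_rdesc rv.
have rv' := red_rcons rv.
have fj : f != j by apply: contraNneq fD => ->.
have pfj : ~~ (npar f && npar j) by rewrite (negPf (evD jD)) andbF.
have [ij|ij] := eqVneq i j.
  by subst j; move: d (pos jD); rewrite /rdesc => /ltnW; rewrite leqNgt => /negP.
have [nx|nx] := boolP (next_to j i); last first.
  have far a : a = lo i \/ a = hi i -> st j a = a by apply: st_far.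
  rewrite Tw_rcons (T_Efar braid_T) ?evD //; apply: IH => // /pos.
  by rewrite !pact_rcons !far; auto.
have [iD|iD] := boolP ((i \in D) && (pact v (hi i) < pact v (lo i))%N).
  case/andP: iD => iD di.
  have [u [ru su Eu ul uh]] := red_adj rv nx iD di.
  rewrite Eu T_rank2E ?evD 1?next_toC //; apply: IH => //.
  - exact: leq_trans (ltnW su) sv.
  - by rewrite ul uh => _; exact: pos.
rewrite Tw_rcons T_next ?evD // TwB TwZ !TwM.
have Ci : UF f * Tw v (UE i) = Tw v (UE i) * UF f.
  by apply: IH => // iD'; apply: pact_lo_hi; move: iD; rewrite iD' /= => /negbTE.
have Cj : UF f * Tw v (UE j) = Tw v (UE j) * UF f by apply: IH.
rewrite mulrBr mulrBl -scalerAl -scalerAr !mulrA Ci Cj -!mulrA Ci Cj.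
by [].
Qed.
Lemma T_wt i g x : ~~ npar i -> has_wt g x -> has_wt (srefl par i g) (T i x).
Proof.
move=> ei W h; have E (l : 'rV[int]_N) : scorefl par i l = srefl par i l.
  by rewrite /scorefl /srefl cpairC /hcoroot (negPf ei) expr0 scale1r.
have inv : srefl par i (srefl par i h) = h.
  rewrite {2}/srefl sreflD -scaleN1r !sreflZ {2}/srefl -/(cartan par i i).
  rewrite cartan_even // eqxx /srefl; apply/matrixP => a b.
  by rewrite !mxE; ring.
rewrite -{1}inv -E -(T_K braid_T) // -rmorphM /= W linearZ /= rmorphM /=.
rewrite (T_K braid_T) // E inv; congr (q ^ _ *: _).
rewrite /srefl cpairDl cpairBr cpairNl cpairZl cpairZr /hcoroot (negPf ei).
by rewrite expr0 scale1r -/(alpha i) (cpairC h (alpha i)) mulrC.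
Qed.

Lemma Tw_wt v g x : word_on v -> has_wt g x -> has_wt (wact par v g) (Tw v x).
Proof.
by elim: v => //= i v IH /andP[iD vD] W; apply: T_wt; [exact: evD|exact: IH].
Qed.

Lemma Tw_K v h : word_on v -> Tw v (UK h) = UK (wact par v h).
Proof.
elim: v => //= i v IH /andP[iD vD]; rewrite IH // (T_K braid_T) ?evD //.
by rewrite /scorefl /srefl cpairC /hcoroot (negPf (evD iD)) expr0 scale1r.
Qed.

(** If v alpha_i = - alpha_l then v = u s_i with u alpha_i = alpha_l, so that
    T_v(E_i) = T_u(- F_i K_i). *)
Lemma Tw_reversed_E v i l : red v -> i \in D -> l \in D ->
  pact v (lo i) = hi l -> pact v (hi i) = lo l -> Tw v (UE i) = - (UF l * UKi l).
Proof.
move=> rv iD lD El Eh.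
have d : rdesc v i by rewrite /rdesc El Eh.
have [u [uD su Eu]] := exchange rv.1 d.
have ru : red (rcons u i).
  by apply: (red_eq rv) => //; rewrite ?word_rcons ?iD // size_rcons su.
have Euc c : pact u c = pact v (st i c) by rewrite Eu pact_rcons st_st.
rewrite (matsumoto _ rv ru Eu) Tw_rcons (T_Ei braid_T) ?evD // TwN TwM.
have ulo : pact u (lo i) = lo l by rewrite Euc st_lo.
have uhi : pact u (hi i) = hi l by rewrite Euc st_hi.
rewrite (Tw_simple_F (red_rcons ru) iD ulo uhi) /UKi Tw_K //.
rewrite !Kvec_even ?evD // wactZ (wact_alpha evD) // ulo uhi.
by have -> : dsgn par l = dsgn par i by rewrite /dsgn -ulo (pact_par evD).
Qed.

End Words.
End UBasics.

(** * Combinatorics of super Satake diagrams *)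

Section Diagram.
Variables (N : nat) (par : 'I_N -> bool).
Local Notation I := 'I_N.-1.
Local Notation npar := (npar par).
Implicit Types (i j l : I) (a b : 'I_N).

Lemma pact_fix (D : {set I}) v a : word_on D v ->
  (forall i, i \in D -> a != lo i /\ a != hi i) -> pact v a = a.
Proof.
move=> vD fa; elim: v vD => //= i v IH /andP[/fa[al ah] vD].
by rewrite IH // /st tpermD // eq_sym.
Qed.

(** A node outside D separates the points that W_D can exchange. *)
Lemma pact_barrier (D : {set I}) v m a : word_on D v -> m \notin D ->
  (pact v a <= m)%N = (a <= m)%N.
Proof.
move=> vD mD; elim: v vD => //= i v IH /andP[iD vD]; rewrite -IH //.
have im : i != m by apply: contraNneq mD => <-.
by move: im; rewrite -val_eqE /= st_val; repeat (case: eqP => //=); move=> *; lia.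
Qed.

Lemma next_rev i j : next_to i j -> next_to (rev_ord i) (rev_ord j).
Proof. by rewrite /next_to /=; have := ltn_ord i; have := ltn_ord j; lia. Qed.

Variables (black : {set I}) (tau : I -> I) (w : seq I).
Hypothesis satake : super_satake par black tau w.
Hypothesis w_black : word_on black w.

Let evB := satake_black_even satake.

Lemma tau_black i : (tau i \in black) = (i \in black).
Proof.
rewrite -[in LHS](satake_tau_black satake) mem_imset //.
exact: inv_inj (satake_tauK satake).
Qed.

Lemma pact_black i : i \in black ->
  pact w (lo i) = hi (tau i) /\ pact w (hi i) = lo (tau i).
Proof.
move=> iB; have := satake_w_black satake iB.
rewrite (wact_alpha evB _ w_black) opprB => /sub_eps_inj[].
  by rewrite -val_eqE /=; lia.
by move=> -> ->.
Qed.

Section Rev.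
Hypothesis tau_rev : tau =1 @rev_ord N.-1.

Lemma rev_lo i : rev_ord (lo i) = hi (rev_ord i).
Proof. by apply: val_inj => /=; have := ltn_ord i; lia. Qed.
Lemma rev_hi i : rev_ord (hi i) = lo (rev_ord i).
Proof. by apply: val_inj => /=; have := ltn_ord i; lia. Qed.

(** For tau the reflection of the diagram, w carries the endpoints of a black node
    to those of its mirror image, so no white node separates the two. *)
Lemma black_central i m : i \in black -> m \notin black ->
  (N.-1 - i <= m)%N = (i <= m)%N.
Proof.
move=> iB mB; have := pact_barrier (lo i) w_black mB.
have [-> _] := pact_black iB; rewrite tau_rev /= => <-.
by congr (_ <= _)%N; have := ltn_ord i; lia.
Qed.

(** The central node separates every node from its mirror image. *)
Lemma centre_black_empty (m : I) : (m.*2.+2 = N)%N -> m \notin black -> black = finset.set0.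
Proof.
move=> mN mB; apply/setP => i; rewrite inE; apply/negP => iB.
by have := black_central iB mB; lia.
Qed.

(** Reflecting the parities changes all of them or none, because tau preserves the
    parity of the nodes. A fixed point excludes the first case. Without a
    fixed point, the first case would make the central node odd, hence white;
    then there are no black nodes, against the condition on the pairing with
    rho. *)
Lemma par_rev a : par (rev_ord a) = par a.
Proof.
pose d b := par (rev_ord b) (+) par b.
have step i : d (lo i) = d (hi i).
  have := satake_tau_par satake i; rewrite tau_rev /Defs.npar /d rev_lo rev_hi.
  by do 4 case: (par _).
have dE n (ln : (n < N)%N) : forall b : 'I_N, (b <= n)%N -> d b = d (Ordinal ln).
  elim: n ln => [|n IH] ln b bn.
    by congr d; apply: val_inj => /=; move: bn; lia.
  have ln' : (n < N)%N by lia.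
  have nI : (n < N.-1)%N by lia.
  have := step (Ordinal nI); rewrite (_ : hi _ = Ordinal ln); last exact: val_inj.
  rewrite (_ : lo _ = Ordinal ln'); last exact: val_inj.
  move=> E; have [bn'|bn'] := leqP b n; first by rewrite IH.
  by congr d; apply: val_inj => /=; lia.
have dC b c : d b = d c.
  have E n (ln : (n < N)%N) (x : 'I_N) : n = x -> Ordinal ln = x by move=> nx; apply: val_inj.
  case: (leqP b c) => bc.
    by rewrite (dE _ (ltn_ord c) b bc) (E _ _ c).
  by rewrite (dE _ (ltn_ord b) c (ltnW bc)) (E _ _ b).
(* d is constant, so one zero suffices: the central point if N is odd, and
   otherwise an endpoint of the central node. *)
suff : exists b, d b = false.
  by move=> [b]; rewrite (dC b a) /d; case: (par _) (par _) => [] [].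
have aN := ltn_ord a.
have [oN|eN] := boolP (odd N).
  have lN : (N./2 < N)%N by lia.
  exists (Ordinal lN); rewrite /d (_ : rev_ord _ = Ordinal lN) ?addbb //.
  by apply: val_inj => /=; lia.
have lN : (N./2.-1 < N.-1)%N by lia.
pose m : I := Ordinal lN.
have mN : (m.*2.+2 = N)%N by rewrite /=; lia.
exists (lo m); rewrite /d.
have -> : rev_ord (lo m) = hi m by apply: val_inj => /=; lia.
apply/negbTE/negP => pm.
have om : npar m by rewrite /Defs.npar addbC.
have mB : m \notin black by apply: contraL om => /evB.
have tm : tau m = m by rewrite tau_rev; apply: val_inj => /=; lia.
have := satake_white_odd satake mB om tm.
rewrite (centre_black_empty mN mB) /rho2 (_ : pos_coroots _ _ = classical_sets.set0).
  by rewrite fsbig_set0 /cpair big1 // => x _; rewrite mxE mul0r.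
by apply/seteqP; split=> // h [] [v [j [_]]]; rewrite inE.
Qed.
End Rev.

Definition endpt a := [exists i in black, (a == lo i) || (a == hi i)].

Lemma pact_nendpt a : ~~ endpt a -> pact w a = a.
Proof.
move=> /existsPn na; apply: (pact_fix w_black) => i iB.
by have := na i; rewrite iB /= negb_or => /andP[].
Qed.

(** Twisting the action of w by tau gives an involution of the points that
    preserves parity, and an involutive isometry is self-adjoint. *)
Lemma wform_sym i j : wform par (alpha i) (wact par w (alpha (tau j))) =
  wform par (alpha j) (wact par w (alpha (tau i))).
Proof.
suff [th [e [thK thp thE]]] : exists th : 'I_N -> 'I_N, exists e : int,
    [/\ involutive th, forall a, par (th a) = par a &
        forall l, wact par w (alpha (tau l)) = e *: (eps (th (lo l)) - eps (th (hi l)))].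
  have sy a b : wform par (eps a) (eps (th b)) = wform par (eps b) (eps (th a)).
    rewrite !wform_eps; case: (eqVneq a (th b)) => [->|ne].
      by rewrite thK eqxx thp.
    by case: (eqVneq b (th a)) => // bE; rewrite bE thK eqxx in ne.
  have wformZ c (l l' : 'rV[int]_N) : wform par l (c *: l') = c * wform par l l'.
    by rewrite /wform mulr_sumr; apply: eq_bigr => a _; rewrite mxE mulrCA.
  rewrite !thE !wformZ; congr (_ * _).
  have wformBl (l l' l'' : 'rV[int]_N) :
      wform par (l - l') l'' = wform par l l'' - wform par l' l''.
    by rewrite wformC wformBr !(wformC _ l'').
  rewrite /alpha !wformBr !wformBl !(sy (lo j)) !(sy (hi j)); ring.
have tauK := satake_tauK satake.
have endptP a : endpt a -> exists2 l, l \in black & a = lo l \/ a = hi l.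
  by case/existsP => l /andP[lB /orP[] /eqP ->]; exists l; auto.
case: (satake_tau satake) => [tid|trev].
  exists (pact w), 1; split=> [a|a|l].
  - case: (boolP (endpt a)) => [/endptP[l lB]|na]; last by rewrite !pact_nendpt.
    have [E1 E2] := pact_black lB; rewrite tid in E1 E2.
    by case=> ->; rewrite ?E1 ?E2 ?E1.
  - exact: pact_par evB _ _ w_black.
  - by rewrite tid scale1r (wact_alpha evB).
(* For the reflection, w agrees with it on the endpoints of black nodes and is
   trivial elsewhere, so the twisted action is the reflection outside them. *)
have rB l : (rev_ord l \in black) = (l \in black) by rewrite -trev tau_black.
have epr a : endpt (rev_ord a) = endpt a.
  have {}H b : endpt b -> endpt (rev_ord b).
    case/endptP => l lB bE; apply/existsP; exists (rev_ord l); rewrite rB lB /=.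
    by case: bE => ->; rewrite ?rev_lo ?rev_hi eqxx ?orbT.
  by apply/idP/idP => /H //; rewrite rev_ordK.
have pE a : pact w a = if endpt a then rev_ord a else a.
  case: ifPn => [/endptP[l lB]|/pact_nendpt //].
  have [E1 E2] := pact_black lB; rewrite trev in E1 E2.
  by case=> ->; rewrite ?E1 ?E2 ?rev_lo ?rev_hi.
exists (fun a => pact w (rev_ord a)), (-1); split=> [a|a|l].
- have thE b : pact w (rev_ord b) = if endpt b then b else rev_ord b.
    by rewrite pE epr rev_ordK.
  rewrite !thE; case: (boolP (endpt a)) => ea; first by rewrite ea.
  by rewrite epr (negPf ea) rev_ordK.
- by rewrite (pact_par evB _ w_black) par_rev.
- by rewrite trev (wact_alpha evB) // !rev_lo !rev_hi scaleN1r opprB.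
Qed.

Lemma tau_next i j : next_to i j -> next_to (tau i) (tau j).
Proof. by move=> ij; case: (satake_tau satake) => E; rewrite !E // next_rev. Qed.

Lemma tau_dsgn i : ~~ npar i -> dsgn par (tau i) = dsgn par i.
Proof.
move=> ei; case: (satake_tau satake) => E; rewrite E // /dsgn -rev_hi par_rev //.
by rewrite even_par.
Qed.

Lemma tau_fix_rev_empty i : tau =1 @rev_ord N.-1 -> tau i = i -> i \notin black ->
  black = finset.set0.
Proof.
move=> trev ti iB; apply: (centre_black_empty trev (m := i)) => //.
by move: ti; rewrite trev => /(congr1 val) /=; have := ltn_ord i; lia.
Qed.

Lemma tau_swap_empty i : next_to i (tau i) -> i \notin black -> black = finset.set0.
Proof.
move=> ij iB; case: (satake_tau satake) => E.
  by move: ij; rewrite E /next_to; lia.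
have tB : tau i \notin black by rewrite tau_black.
apply/setP => l; rewrite inE; apply/negP => lB.
have := black_central E lB iB; have := black_central E lB tB.
have : l != i by apply: contraNneq iB => <-.
have : l != tau i by apply: contraNneq tB => <-.
move: ij; rewrite E /next_to -!val_eqE /=.
by have := ltn_ord i; have := ltn_ord l; lia.
Qed.

Section Id.
Hypothesis tau_id : tau =1 id.

Lemma black_not_next i j : i \in black -> j \in black -> ~~ next_to i j.
Proof.
move=> iB jB; apply/negP => ij.
have [E1 E2] := pact_black iB; have [E3 E4] := pact_black jB.
rewrite tau_id in E1 E2; rewrite tau_id in E3 E4.
case: (next_cases ij) => -[E _ _].
  by move: E2; rewrite E E3 => /(congr1 val)/=; move/(congr1 val): E => /=; lia.
by move: E1; rewrite -E E4 => /(congr1 val)/=; move/(congr1 val): E => /=; lia.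
Qed.

Lemma black_cartan i j : i \in black -> j \in black ->
  cartan par i j = if i == j then 2 else 0.
Proof.
by move=> iB jB; rewrite cartan_even ?evB // (negPf (black_not_next iB jB)).
Qed.

Lemma cowact_black v j : word_on black v -> j \in black ->
  cowact par v (hcoroot par j) = hcoroot par j \/
  cowact par v (hcoroot par j) = - hcoroot par j.
Proof.
move=> vB jB; elim: v vB => [|i v IH] /=; first by left.
case/andP=> iB /IH; rewrite /scorefl.
have C := black_cartan jB iB; rewrite /cartan in C.
case=> ->; rewrite ?cpairNl C; case: eqP => [->|_]; rewrite ?oppr0 ?scale0r ?subr0;
  try (by auto); [right|left]; apply/matrixP => a b; rewrite !mxE; ring.
Qed.

(** For tau = id the black nodes are pairwise far apart, so the system they generate
    is a product of rank one systems. *)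
Lemma pos_coroots_black :
  pos_coroots par black = [set` [seq hcoroot par j | j <- enum black]]%classic.
Proof.
apply/seteqP; split=> h /=.
  case=> -[v [j [vB jB ->]]] [c E]; apply/mapP; exists j; rewrite ?mem_enum //.
  case: (cowact_black vB jB) => // E'; move: E; rewrite E'.
  move=> /(congr1 (fun x : 'rV[int]_N => cpair x (alpha j))).
  have -> : cpair (\sum_(i in black) hcoroot par i *+ c i) (alpha j) = 2 * (c j)%:R.
    have D0 : cpair 0 (alpha j) = 0 :> int.
      by rewrite -[X in cpair X](scale0r (alpha j)) cpairZl mul0r.
    rewrite (big_morph (fun x : 'rV[int]_N => cpair x (alpha j)) (fun x y => cpairDl x y _) D0).
    have Cn i : cpair (hcoroot par i *+ c i) (alpha j) = (c i)%:R * cartan par i j.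
      by rewrite -scaler_nat cpairZl.
    rewrite (bigD1 j) //= Cn black_cartan // eqxx big1 ?addr0 1?mulrC //.
    by move=> i /andP[iB ij]; rewrite Cn black_cartan // (negPf ij) mulr0.
  by rewrite cpairNl -/(cartan par j j) black_cartan // eqxx; lia.
case/mapP => j; rewrite mem_enum => jB ->; split; first by exists [::], j.
exists (fun i => (i == j) : nat); rewrite (bigD1 j) //= eqxx mulr1n big1 ?addr0 //.
by move=> i /andP[_ /negPf->].
Qed.

Lemma hcoroot_inj : {in black &, injective (@hcoroot N par)}.
Proof.
move=> i j iB jB E; have := black_cartan iB jB; rewrite /cartan E -/(cartan par j j).
by rewrite black_cartan // eqxx; case: eqP.
Qed.

Lemma rho2_pair j : j \notin black ->
  cpair (rho2 par black) (alpha j) = - (#|[set l in black | next_to j l]|%:R).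
Proof.
move=> jB; rewrite /rho2 pos_coroots_black -fsbig_seq; last first.
  rewrite map_inj_in_uniq ?enum_uniq // => x y; rewrite !mem_enum.
  exact: hcoroot_inj.
have D0 : cpair 0 (alpha j) = 0 :> int.
  by rewrite -[X in cpair X](scale0r (alpha j)) cpairZl mul0r.
rewrite (big_morph (fun x : 'rV[int]_N => cpair x (alpha j)) (fun x y => cpairDl x y _) D0).
rewrite big_map big_enum /=.
rewrite -sum1_card natr_sum -sumrN [RHS](eq_bigl (fun l => (l \in black) && next_to j l)).
  rewrite big_mkcondr; apply: eq_bigr => l lB.
  rewrite -/(cartan par l j) cartan_even ?evB // next_toC.
  by have /negPf -> : l != j by apply: contraNneq jB => <-.
by move=> l; rewrite inE.
Qed.

(** By the integrality condition the number of black neighbours is even, and a node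
    has at most two neighbours. *)
Lemma white_even_nbrs i j l : i \notin black -> ~~ npar i -> next_to i j ->
  j \in black -> next_to i l -> l \in black.
Proof.
move=> iB ei ij jB il; apply/negPn/negP => lB.
have := satake_white_even satake iB ei (tau_id i); rewrite rho2_pair //.
rewrite (_ : [set _ in _ | _] = [set j]%SET) ?cards1 //; apply/setP => m.
rewrite !inE; apply/andP/eqP => [[mB im]|->] //; apply/eqP.
have : m != l by apply: contraNneq lB => <-.
have : j != l by apply: contraNneq lB => <-.
by move: ij il im; rewrite /next_to -!val_eqE /=; lia.
Qed.

Lemma white_even_other i j : i \notin black -> ~~ npar i -> next_to i j ->
  j \in black -> exists l, [/\ l \in black, next_to i l & l != j].
Proof.
move=> iB ei ij jB; apply/not_existsP => H.
have := satake_white_even satake iB ei (tau_id i); rewrite rho2_pair //.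
rewrite (_ : [set _ in _ | _] = [set j]%SET) ?cards1 //; apply/setP => m.
rewrite !inE; apply/andP/eqP => [[mB im]|->] //; apply/eqP/negPn/negP => mj.
by apply: (H m).
Qed.

End Id.

Lemma white_fix_no_black i j l : i \notin black -> ~~ npar i -> tau i = i ->
  next_to i j -> j \notin black -> l \in black -> ~~ next_to i l.
Proof.
move=> iB ei ti ij jB lB; case: (satake_tau satake) => E.
  by apply: contra jB => il; apply: (white_even_nbrs E iB ei il lB ij).
by move: lB; rewrite (tau_fix_rev_empty E ti iB) inE.
Qed.

Lemma white_fix_black_id i j : i \notin black -> tau i = i -> j \in black -> tau =1 id.
Proof.
move=> iB ti jB; case: (satake_tau satake) => // E.
by move: jB; rewrite (tau_fix_rev_empty E ti iB) inE.
Qed.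

End Diagram.

(** * Matrix coefficients of the natural representation *)

Section NaturalRep.
Variables (k : fieldType) (q : k) (n : nat) (par : 'I_n.+1 -> bool).
Hypothesis q0 : q != 0.
Hypothesis q1 : q - q^-1 != 0.
Local Notation I := 'I_n.+1.-1.
Local Notation M := 'M[k]_n.+1.

Definition natural_E (i : I) : M := delta_mx (lo i) (hi i).
Definition natural_F (i : I) : M := delta_mx (hi i) (lo i).
Definition natural_K (h : 'rV[int]_n.+1) : M := diag_mx (\row_a q ^ h 0 a).

Lemma delta_sandwich (a b : 'I_n.+1) (x : M) :
  delta_mx a b * x * delta_mx a b = x b a *: delta_mx a b.
Proof.
apply/matrixP => c d; rewrite -!mulmxE mxE (bigD1 a) //= big1 => [|e ea].
  rewrite !mxE (bigD1 b) //= big1 => [|e eb].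
    rewrite !mxE !eqxx /= !addr0.
    by case: (c == a); case: (d == b); rewrite /= ?mul1r ?mulr1 ?mul0r ?mulr0.
  by rewrite mxE (negPf eb) andbF mul0r.
by rewrite [X in _ * X]mxE (negPf ea) mulr0.
Qed.

Lemma delta_mul (a b c d : 'I_n.+1) :
  delta_mx a b * delta_mx c d = if b == c then delta_mx a d else 0 :> M.
Proof.
rewrite -mulmxE; case: eqP => [->|/eqP bc]; first by rewrite mul_delta_mx.
by rewrite mul_delta_mx_0.
Qed.

(** Every word in the higher relations contains two copies of one matrix unit with
    a product in between that cannot lead back from its column to its row. *)
Lemma Urel_natural : Urel q par natural_E natural_F natural_K.
Proof.
have hl (i : 'I_n.+1.-1) : (hi i == lo i) = false.
  by rewrite -val_eqE /=; lia.
have lh (i : 'I_n.+1.-1) : (lo i == hi i) = false.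
  by rewrite -val_eqE /=; lia.
have lE (i j : 'I_n.+1.-1) : (lo i == lo j) = (i == j) by rewrite -!val_eqE.
have hE (i j : 'I_n.+1.-1) : (hi i == hi j) = (i == j) by rewrite -!val_eqE.
have nxE (i j : 'I_n.+1.-1) : next_to i j = (hi i == lo j) || (hi j == lo i).
  by rewrite /next_to -!val_eqE /=; lia.
have nn (i j : 'I_n.+1.-1) : hi i == lo j -> (hi j == lo i) = false.
  by rewrite -!val_eqE /=; lia.
have p20 (A : algType k) i j (x y : A) : x * x = 0 -> x * y * x = 0 ->
    p2 q par i j x y = 0.
  move=> xx xyx; have yxx : y * x * x = 0 by rewrite -mulrA xx mulr0.
  rewrite /p2 /sbr !mulrBr !mulrBl -!scalerAl -!scalerAr !mulrA xx xyx yxx.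
  by rewrite mul0r !scaler0 !subr0 !scaler0 subrr.
have qu0 (A : algType k) a b c (x y z : A) : y * y = 0 -> y * x * y = 0 ->
    y * z * y = 0 -> y * (x * z) * y = 0 -> y * (z * x) * y = 0 ->
    quartic q par a b c x y z = 0.
  move=> yy yxy yzy yxzy yzxy; rewrite /quartic /sbr.
  rewrite !(mulrBr, mulrBl) -!scalerAl -!scalerAr !(mulrBr, mulrBl).
  rewrite -?scalerAl -?scalerAr.
  have e1 : x * y * z * y = 0 by rewrite -!mulrA [y * _]mulrA yzy mulr0.
  have e2 : y * x * z * y = 0 by rewrite -(mulrA y) yxzy.
  have e3 : z * (x * y) * y = 0 by rewrite -!mulrA yy !mulr0.
  have e4 : z * (y * x) * y = 0 by rewrite -!mulrA [y * _]mulrA yxy mulr0.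
  have e5 : y * (x * y * z) = 0 by rewrite !mulrA yxy mul0r.
  have e6 : y * (y * x * z) = 0 by rewrite !mulrA yy !mul0r.
  have e7 : y * (z * (x * y)) = 0 by rewrite -yzxy !mulrA.
  have e8 : y * (z * (y * x)) = 0 by rewrite !mulrA yzy !mul0r.
  rewrite !(e1, e2, e3, e4, e5, e6, e7, e8).
  by rewrite !(scaler0, subr0, oppr0, addr0).
split.
- rewrite /natural_K; apply/matrixP => a b; rewrite !mxE expr0z.
  by case: (a == b).
- move=> h h'; rewrite /natural_K -mulmxE mulmx_diag; congr diag_mx.
  by apply/rowP => a; rewrite !mxE expfzDr.
- move=> h i; rewrite /natural_K /natural_E -!mulmxE mul_diag_mx mul_mx_diag.
  apply/matrixP => a b; rewrite !mxE.
  case: eqP => [->|_]; last by rewrite !mul0r !mulr0.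
  case: eqP => [->|_]; last by rewrite !mul0r !mulr0.
  rewrite !mulr1 mul1r -expfzDr //; congr (q ^ _).
  by rewrite cpairBr !(cpairC h) !cpair_epsl subrK.
- move=> h i; rewrite /natural_K /natural_F -!mulmxE mul_diag_mx mul_mx_diag.
  apply/matrixP => a b; rewrite !mxE.
  case: eqP => [->|_]; last by rewrite !mul0r !mulr0.
  case: eqP => [->|_]; last by rewrite !mul0r !mulr0.
  rewrite !mulr1 mul1r -expfzDr //; congr (q ^ _).
  by rewrite cpairBr !(cpairC h) !cpair_epsl opprB subrK.
- move=> i j; rewrite /sbr /natural_E /natural_F !delta_mul hE lE [j == i]eq_sym.
  case: eqP => [->|_]; last by rewrite scaler0 subr0.
  rewrite andbb mulr1; apply/matrixP => a b; rewrite !mxE.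
  have [<-|ab] := eqVneq a b; last first.
    have e c : (a == c) && (b == c) = false.
      by apply/andP => -[/eqP ac /eqP bc]; rewrite ac bc eqxx in ab.
    by rewrite !e !mulr0n subrr !mulr0 subrr.
  rewrite !andbb eqxx /= !mulr1n; have [->|al] := eqVneq a (lo j).
    rewrite lh !(mulr1n, mulr0n, mulr0, subr0, mulr1) -invr_expz mulVf //.
    exact: qi_dif.
  have [_|ah] := eqVneq a (hi j); last first.
    by rewrite !(mulr0n, mulr0, subrr, oppr0, expr0z).
  rewrite !(mulr0n, mulr1n, sub0r, mulr1); case: (boolP (Defs.npar par j)) => pj.
    rewrite !(expr1, opprK, mulr1) -invr_expz mulVf //.
    exact: qi_dif.
  rewrite !(expr0, mulrN1, opprK) -invr_expz.
  rewrite -[(q ^ _)^-1 - _]opprB mulrN mulVf //; exact: qi_dif.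
- move=> i j c0; have : ~~ adj par i j by rewrite /adj c0 eqxx andbF.
  rewrite adjE nxE negb_or => /andP[/negPf e1 /negPf e2].
  by rewrite /sbr /natural_E !delta_mul e1 e2 scaler0 subr0.
- move=> i j c0; have : ~~ adj par i j by rewrite /adj c0 eqxx andbF.
  rewrite adjE nxE negb_or => /andP[/negPf e1 /negPf e2].
  by rewrite /sbr /natural_F !delta_mul eq_sym e2 eq_sym e1 scaler0 subr0.
- move=> i j _ _; apply: p20; first by rewrite /natural_E delta_mul hl.
  rewrite /natural_E delta_sandwich mxE; case: (boolP (hi i == lo j)) => [e|_].
    by rewrite [lo i == _]eq_sym nn // scale0r.
  by rewrite scale0r.
- move=> i j _ _; apply: p20; first by rewrite /natural_F delta_mul lh.
  rewrite /natural_F delta_sandwich mxE; case: (boolP (hi i == lo j)) => [e|_].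
    by rewrite [lo i == _]eq_sym nn // scale0r.
  by rewrite andbF scale0r.
- move=> a b c ab bc _; have ne (x y : 'I_n.+1) : x != y :> nat -> (x == y) = false.
    by rewrite val_eqE => /negPf.
  have hv (i : 'I_n.+1.-1) : hi i = i.+1 :> nat by [].
  have lv (i : 'I_n.+1.-1) : lo i = i :> nat by [].
  have xz : natural_E a * natural_E c = 0.
    by rewrite /natural_E delta_mul ne // ?hv ?lv; lia.
  have zx : natural_E c * natural_E a = 0.
    by rewrite /natural_E delta_mul ne // ?hv ?lv; lia.
  apply: qu0; rewrite ?xz ?zx ?mulr0 ?mul0r // /natural_E.
  - by rewrite delta_mul ne // ?hv ?lv; lia.
  - by rewrite delta_sandwich mxE [X in X && _]ne ?scale0r // ?hv ?lv; lia.
  - by rewrite delta_sandwich mxE [X in _ && X]ne ?andbF ?scale0r // ?hv ?lv; lia.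
- move=> a b c ab bc _; have ne (x y : 'I_n.+1) : x != y :> nat -> (x == y) = false.
    by rewrite val_eqE => /negPf.
  have hv (i : 'I_n.+1.-1) : hi i = i.+1 :> nat by [].
  have lv (i : 'I_n.+1.-1) : lo i = i :> nat by [].
  have xz : natural_F a * natural_F c = 0.
    by rewrite /natural_F delta_mul ne // ?hv ?lv; lia.
  have zx : natural_F c * natural_F a = 0.
    by rewrite /natural_F delta_mul ne // ?hv ?lv; lia.
  apply: qu0; rewrite ?xz ?zx ?mulr0 ?mul0r // /natural_F.
  - by rewrite delta_mul ne // ?hv ?lv; lia.
  - by rewrite delta_sandwich mxE [X in _ && X]ne ?andbF ?scale0r // ?hv ?lv; lia.
  - by rewrite delta_sandwich mxE [X in X && _]ne ?scale0r // ?hv ?lv; lia.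
Qed.

End NaturalRep.

(** Phrased through matrix coefficients, so that no matrices of an unknown, possibly
    zero, size appear. *)
Lemma natural_coef (k : fieldType) (q : k) (N : nat) (par : 'I_N -> bool) :
    q != 0 -> q - q^-1 != 0 ->
  exists phi : 'I_N -> 'I_N -> {linear U q par -> k^o},
  [/\ forall a b x y, phi a b (x * y) = \sum_c phi a c x * phi c b y,
      forall a b, phi a b 1 = (a == b)%:R,
      forall i a b, phi a b (UE i) = ((a == lo i) && (b == hi i))%:R &
      forall h a b, phi a b (UK h) = q ^ h 0 a *+ (a == b)].
Proof.
move=> q0 q1; case: N par => [|n] par.
  have F0 (a : 'I_0) : False by case: a.
  exists (fun a => False_rect _ (F0 a)).
  by split=> [[]|[]|? []|? []].
have r := Urel_natural par q0 q1.
pose f (a b : 'I_n.+1) (x : U q par) : k^o :=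
  Ulift (@natural_E k n) (@natural_F k n) (@natural_K k q n) x a b.
have fl a b : linear (f a b).
  by move=> c x y; rewrite /f (Ulift_linear r) !mxE.
pose F a b : {linear U q par -> k^o} :=
  HB.pack (f a b) (GRing.isLinear.Build k (U q par) k^o *:%R (f a b) (fl a b)).
exists F.
split=> /=.
- move=> a b x y; rewrite /f; have [_ ->] := Ulift_monoid r.
  by rewrite -mulmxE mxE.
- by move=> a b; rewrite /f; have [-> _] := Ulift_monoid r; rewrite mxE.
- by move=> i a b; rewrite /f (UliftE r) /= mxE.
- by move=> h a b; rewrite /f (UliftE r) /= !mxE.
Qed.

Section Contraction.
Variables (k : fieldType) (V W : lmodType k) (phi : {linear W -> k^o}).

Definition contr_fun (x : V) (y : W) : V := (phi y : k) *: x.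

Lemma contr_fun_bilinear : bilinear_for *:%R *:%R contr_fun.
Proof.
split=> [y a x x'|x a y y']; rewrite /contr_fun.
  rewrite scalerDr; congr (_ + _).
  by rewrite /= (scalerA a) (scalerA (phi y : k)) [_ * a]mulrC.
by rewrite (linearP phi) scalerDl -scalerA.
Qed.

HB.instance Definition _ := bilinear_isBilinear.Build k V W V *:%R *:%R
  contr_fun contr_fun_bilinear.

Definition contr (t : tensor V W) : V := tlift contr_fun t.

Lemma contr_tens x y : contr (tens x y) = (phi y : k) *: x.
Proof. exact: tlift_tens. Qed.

HB.instance Definition _ :=
  GRing.isLinear.Build k (tensor V W) V *:%R contr (tlift_is_linear contr_fun).
End Contraction.

Section Coefficients.
Variables (k : fieldType) (q : k) (N : nat) (par : 'I_N -> bool).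
Hypothesis q0 : q != 0.
Hypothesis two0 : 2 != 0 :> k.
Local Notation I := 'I_N.-1.
Local Notation U := (U q par).
Local Notation npar := (npar par).
Variable phi : 'I_N -> 'I_N -> {linear U -> k^o}.
Hypothesis phiM : forall a b x y, phi a b (x * y) = \sum_c phi a c x * phi c b y.
Hypothesis phi1 : forall a b, phi a b 1 = (a == b)%:R.
Hypothesis phiE : forall i a b, phi a b (UE i) = ((a == lo i) && (b == hi i))%:R.
Hypothesis phiK : forall h a b, phi a b (UK h) = q ^ h 0 a *+ (a == b).

Lemma phiEM i y a b : phi a b (UE i * y) = phi (hi i) b y *+ (a == lo i).
Proof.
rewrite phiM (bigD1 (hi i)) //= big1 ?addr0 => [|c ci].
  by rewrite phiE eqxx andbT; case: (a == _); rewrite ?mul1r ?mul0r.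
by rewrite phiE (negPf ci) andbF mul0r.
Qed.

Lemma phiMK y h a b : phi a b (y * UK h) = phi a b y * q ^ h 0 b.
Proof.
rewrite phiM (bigD1 b) //= big1 ?addr0 => [|c cb]; first by rewrite phiK eqxx.
by rewrite phiK (negPf cb) mulr0n mulr0.
Qed.

(** A product of E's acts on the natural representation as a matrix unit whose
    indices differ by the weight of the product. *)
Lemma phi_wt g y a b : Uplus_wt g y -> eps a - eps b <> g -> phi a b y = 0.
Proof.
case=> s sg -> ne; rewrite linear_sum big1_seq //= => -[c v] /sg /= vg.
rewrite linearZ /=; suff -> : phi a b (\prod_(i <- v) UE i) = 0 by rewrite scaler0.
rewrite -{}vg in ne; elim: v a ne => [|i v IH] a.
  rewrite !big_nil phi1; case: eqP => // -> []; exact: subrr.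
rewrite !big_cons phiEM => ne; case: eqP => [ai|_]; last exact: mulr0n.
rewrite IH ?mul0rn // => E; case: ne; rewrite -E ai /alpha.
by rewrite addrA subrK.
Qed.

Lemma contr_tail Q i t a b : in_tail Q i t -> ~ Q (eps a - eps b) ->
  contr (phi a b) t = 0.
Proof.
case=> s sQ -> nQ; rewrite linear_sum big1_seq //= => -[x y] /sQ [g [z [Qg zg /= ->]]].
rewrite contr_tens phiMK (phi_wt zg) ?mul0r ?scale0r // => E.
by case: nQ; rewrite E.
Qed.

Lemma parity_even_E i : ~~ npar i -> parity (UE i : U) = UE i.
Proof.
move=> /negPf ei.
by rewrite /parity (UliftE (Urel_sign (Urel_U q par))) /= ei expr0 scale1r.
Qed.

Variable Delta : {linear U -> tensor U U}.
Hypothesis copr : coproduct Delta.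

Definition contr_Delta a b (y : U) : U := contr (phi a b) (Delta y).

Lemma contr_Delta_linear a b : linear (contr_Delta a b).
Proof. by move=> c x y; rewrite /contr_Delta !linearP. Qed.
HB.instance Definition _ a b :=
  GRing.isLinear.Build k U U *:%R (contr_Delta a b) (contr_Delta_linear a b).

Lemma contr_Delta_K h a b : contr_Delta a b (UK h) = (q ^ h 0 a *+ (a == b)) *: UK h.
Proof. by rewrite /contr_Delta (DeltaK copr) contr_tens phiK. Qed.

Lemma contr_smul_l (u : tensor U U) (x y : U) a b : parity y = y ->
  contr (phi a b) (smul_l parity u x y) =
  \sum_(t <- repr u) (phi a b (y * t.2) : k) *: (x * t.1).
Proof.
move=> py.
have od : odd_part parity y = 0 by rewrite /odd_part /= py subrr scaler0.
have ev : even_part parity y = y.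
  rewrite /even_part /= py -[y in y + y]scale1r -scalerDl scalerA mulVf ?scale1r //.
rewrite /smul_l linear_sum; apply: eq_bigr => t _ /=.
by rewrite /smul_pure od ev mul0r linear0r addr0 contr_tens.
Qed.

(** Since E_i is even, the sign rule does not interfere, and Delta(E_i) acts on the
    left by two terms; iterating computes the coefficients of any word in the
    E's without expanding its coproduct. *)
Lemma contr_Delta_EM i y a b : ~~ npar i ->
  contr_Delta a b (UE i * y) =
    UE i * contr_Delta a b y + (UKi i * contr_Delta (hi i) b y) *+ (a == lo i).
Proof.
move=> ei; rewrite /contr_Delta (DeltaM copr) (DeltaE copr); set u := Delta y.
have -> : smul parity (tens (UE i) 1 + tens (UKi i) (UE i)) u =
    smul_l parity u (UE i) 1 + smul_l parity u (UKi i) (UE i).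
  rewrite -[LHS]/(tlift (smul_l parity u) _) -[tens (UE i) 1]scale1r.
  by rewrite tlift_is_linear scale1r !tlift_tens.
rewrite linearD /= !contr_smul_l ?rmorph1 ?parity_even_E //.
congr (_ + _).
  rewrite /contr /tlift /tsum mulr_sumr; apply: eq_bigr => t _.
  by rewrite mul1r -scalerAr.
rewrite /contr /tlift /tsum mulr_sumr -sumrMnl; apply: eq_bigr => t _.
rewrite phiEM -scalerAr; case: (a == lo i); rewrite ?mulr1n ?mulr0n //.
by rewrite scale0r.
Qed.

Variables (T : I -> {lrmorphism U -> U}) (tau : I -> I) (w : seq I).

Lemma Z_coef i (z : U) : is_Z Delta T tau w i z ->
  contr_Delta (lo (tau i)) (hi (tau i)) (TwEK T tau w i) =
  q ^ (- Kvec par i) 0 (hi (tau i)) *: z.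
Proof.
move=> H; have := contr_tail (a := lo (tau i)) (b := hi (tau i)) H.
move=> /(_ _) /eqP; rewrite !linearB /= -/(contr_Delta _ _ _) !contr_tens phiMK phiK lo_neq_hi.
rewrite mulr0n scale0r subr0 phiE !eqxx mul1r subr_eq0 => E; apply/eqP/E.
by case.
Qed.

Lemma W_coef (black : {set I}) i j (z W : U) a b : is_W Delta T black tau w i j z W ->
  eps a - eps b = alpha i + alpha j -> a != b -> ~~ ((a == lo i) && (b == hi i)) ->
  contr_Delta a b (TwEK T tau w i) =
  ((phi a b (T j (UE i)) : k) * q ^ (- Kvec par i) 0 b) *: (W * UKi j).
Proof.
move=> [_ H] abE ne ne'; have := contr_tail (a := a) (b := b) H.
move=> /(_ _) /eqP; rewrite !linearB /= -/(contr_Delta _ _ _) !contr_tens !phiMK phiK.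
rewrite (negPf ne) mulr0n scale0r subr0 phiE (negPf ne') mul0r scale0r subr0.
by rewrite subr_eq0 => E; apply/eqP/E => -[_ []].
Qed.

End Coefficients.

(** * The elements Z and W next to a pair of black nodes *)

(** For comparing endpoints of consecutive nodes once all are written in terms of
    one of them. *)
Lemma eqn_shiftF (m : nat) : ((m.+1 == m) = false) * ((m == m.+1) = false) *
  ((m.+2 == m) = false) * ((m == m.+2) = false) * ((m.+3 == m) = false) *
  ((m == m.+3) = false).
Proof. by repeat split; lia. Qed.

Lemma alpha_join N (i j : 'I_N.-1) : hi i = lo j ->
  eps (lo i) - eps (hi j) = alpha i + alpha j.
Proof. by move=> E; rewrite /alpha E addrA subrK. Qed.

Section BlackNeighbours.
Variables (k : fieldType) (q : k) (N : nat) (par : 'I_N -> bool).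
Hypothesis q0 : q != 0.
Hypothesis q1 : q - q^-1 != 0.
Hypothesis two0 : 2 != 0 :> k.
Local Notation I := 'I_N.-1.
Local Notation U := (U q par).
Local Notation npar := (npar par).
Local Notation q_ i := (qi q par i).

Lemma UE_far (a b : I) : ~~ npar a -> a != b -> ~~ next_to a b ->
  UE a * UE b = UE b * UE a :> U.
Proof.
move=> ea ab nab; have := UrelEE (Urel_U q par) (i := a) (j := b).
rewrite cartan_even // (negPf ab) (negPf nab) => /(_ erefl).
by rewrite /sbr (negPf ea) expr0 mul1r scale1r => /eqP; rewrite subr_eq0 => /eqP.
Qed.

Variable Delta : {linear U -> tensor U U}.
Hypothesis copr : coproduct Delta.
Variables (T : I -> {lrmorphism U -> U}) (tau : I -> I) (w : seq I).
Hypothesis braid_T : braid_operators T.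

Lemma Z_empty i (z : U) : ~~ npar (tau i) -> is_Z Delta T tau [::] i z ->
  z = UKi (tau i) * UKi_inv i.
Proof.
move=> ei Hz; have [phi [phiM phi1 phiE phiK]] := natural_coef par q0 q1.
have := Z_coef phiM phi1 phiE phiK Hz; rewrite /TwEK /=.
set u := q ^ _; have u0 : u != 0 by exact: expfz_neq0.
move=> H; apply: (scalerI u0); rewrite -{}H (contr_Delta_EM two0 phiM phiE copr) //.
rewrite /UKi_inv !(contr_Delta_K phiK copr) -/(UKi_inv i) -/u lo_neq_hi !eqxx.
by rewrite mulr0n scale0r mulr0 add0r !mulr1n -scalerAr.
Qed.

Variables i j l : I.
Hypotheses (ei : ~~ npar i) (ej : ~~ npar j) (el : ~~ npar l).
Hypotheses (ij : next_to i j) (il : next_to i l) (lj : l != j).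
Let T' : U := UE l * UE i - (q_ i)^-1 *: (UE i * UE l).
Hypothesis TwEKE :
  TwEK T tau w i = (UE j * T' - (q_ i)^-1 *: (T' * UE j)) * UKi_inv i.

Let qji : q_ j = q_ i. Proof. by rewrite (qi_next q ei ej ij). Qed.
Let ji : next_to j i. Proof. by rewrite next_toC. Qed.
Let njl : ~~ next_to j l. Proof. exact: next_far ij il lj. Qed.
Let Kij : UKi i * UE j = (q_ i)^-1 *: (UE j * UKi i) :> U.
Proof. exact: KiEj. Qed.
Let Kil : UKi i * UE l = (q_ i)^-1 *: (UE l * UKi i) :> U.
Proof. exact: KiEj. Qed.
Let Kji : UKi j * UE i = (q_ i)^-1 *: (UE i * UKi j) :> U.
Proof. by rewrite (KiEj q ej ji) qji. Qed.
Let Kjl : UKi j * UE l = UE l * UKi j :> U.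
Proof.
by rewrite (wt_Ki j (wtE q par l)) wform_far ?expr0z ?scale1r // eq_sym.
Qed.
Let Elj : UE l * UE j = UE j * UE l :> U.
Proof. by rewrite UE_far // next_toC. Qed.
Let KKji : UKi j * UKi i = UKi i * UKi j :> U. Proof. exact: UKC. Qed.
Let KKV : UKi j * UKi_inv i = UKi_inv i * UKi j :> U. Proof. exact: UKC. Qed.
Let KiV : UKi i * UKi_inv i = 1 :> U. Proof. exact: UKVi. Qed.

Let TwEK_words : TwEK T tau w i =
  UE j * (UE l * (UE i * UKi_inv i)) - (q_ i)^-1 *: (UE j * (UE i * (UE l * UKi_inv i)))
  - (q_ i)^-1 *: (UE l * (UE i * (UE j * UKi_inv i)))
  + (q_ i) ^- 2 *: (UE i * (UE l * (UE j * UKi_inv i))).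
Proof.
rewrite TwEKE /T'; have qi0 := qi_neq0 par q0 i.
nc_reduce k [:: UE i : U; UE j; UE l; UKi_inv i] tt; field; rewrite ?qi0 //.
Qed.

Lemma Z_black (z : U) : is_Z Delta T tau w i z -> tau i = i ->
  z = (1 - q_ i ^- 2) ^+ 2 *: (UE j * UE l).
Proof.
move=> Hz ti; have qi0 := qi_neq0 par q0 i.
have [phi [phiM phi1 phiE phiK]] := natural_coef par q0 q1.
have := Z_coef phiM phi1 phiE phiK Hz; rewrite ti TwEK_words.
set u := q ^ _; have u0 : u != 0 by exact: expfz_neq0.
move=> H; apply: (scalerI u0); rewrite -H {H}.
rewrite !(linearD, linearB, linearZ) /= !(contr_Delta_EM two0 phiM phiE copr) //.
rewrite /UKi_inv !(contr_Delta_K phiK copr) -/(UKi_inv i) -/u -!val_eqE /=.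
suff E : (UE j : U) * (UE l * (UKi i * (u *: UKi_inv i)))
    + -1 *: ((q_ i)^-1 *: (UE j * (UKi i * (UE l * (u *: UKi_inv i)))))
    + -1 *: ((q_ i)^-1 *: (UE l * (UKi i * (UE j * (u *: UKi_inv i)))))
    + q_ i ^- 2 *: (UKi i * (UE l * (UE j * (u *: UKi_inv i)))) =
    (1 - q_ i ^- 2) ^+ 2 *: (u *: (UE j * UE l)).
  have [[Ei El]|[Ej Ei]] := next_sides ij il lj; rewrite ?El ?Ej Ei;
  rewrite !eqSS !eqxx !eqn_shiftF /= !(mulr0n, mulr1n, scale0r, mulr0, addr0, add0r);
  exact: E.
nc_reduce k [:: UE j : U; UE l; UKi i; UKi_inv i] (tt, Kij, Kil, KiV, Elj);
  field; rewrite ?qi0 //.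
Qed.

Lemma W_black (black : {set I}) (z W : U) : is_W Delta T black tau w i j z W ->
  W * UKi j = (1 - q_ i ^- 2) *: (UE l * UKi j).
Proof.
move=> Hw; have qi0 := qi_neq0 par q0 i.
have [phi [phiM phi1 phiE phiK]] := natural_coef par q0 q1.
have [[Ei El]|[Ej Ei]] := next_sides ij il lj.
  (* j, i, l from left to right: alpha_i + alpha_j runs from lo j to hi i. *)
  have := W_coef phiM phi1 phiE phiK (a := lo j) (b := hi i) Hw.
  set u := q ^ _; have u0 : u != 0 by exact: expfz_neq0.
  have -> : phi (lo j) (hi i) (T j (UE i)) = 1.
    rewrite (T_next braid_T ej ji) linearB linearZ /= !(phiEM phiM phiE) !phiE.
    by rewrite -!val_eqE /= Ei !eqSS !eqxx !eqn_shiftF /= mulr0n mulr1n scaler0 subr0.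
  rewrite mul1r TwEK_words => H; apply: (scalerI u0); rewrite -H {H}; last first.
  - by rewrite -!val_eqE /= Ei eqn_shiftF.
  - by rewrite -val_eqE /= Ei eqn_shiftF.
  - by rewrite [RHS]addrC alpha_join //; apply: val_inj; rewrite /= Ei.
  rewrite !(linearD, linearB, linearZ) /= !(contr_Delta_EM two0 phiM phiE copr) //.
  rewrite /UKi_inv !(contr_Delta_K phiK copr) -/(UKi_inv i) -/u -!val_eqE /=.
  rewrite El Ei !eqSS !eqxx !eqn_shiftF /= !(mulr0n, mulr1n, scale0r, mulr0, addr0, add0r).
  nc_reduce k [:: UE j : U; UE l; UE i; UKi i; UKi j; UKi_inv i]
    (tt, Kij, Kil, Kji, Kjl, KiV, KKji, KKV, Elj); field; rewrite ?qi0 //.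
(* The opposite order; only E_i E_j contributes to T_j(E_i), whence the factor. *)
have := W_coef phiM phi1 phiE phiK (a := lo i) (b := hi j) Hw.
set u := q ^ _; have u0 : u != 0 by exact: expfz_neq0.
have -> : phi (lo i) (hi j) (T j (UE i)) = - (q_ i)^-1.
  rewrite (T_next braid_T ej ji) linearB linearZ /= !(phiEM phiM phiE) !phiE.
  rewrite -!val_eqE /= Ej !eqSS !eqxx !eqn_shiftF /= mulr0n mulr1n sub0r qji.
  by congr (- _); exact: mulr1.
have v0 : - (q_ i)^-1 * u != 0 by rewrite mulf_neq0 // oppr_eq0 invr_eq0.
rewrite TwEK_words => H; apply: (scalerI v0); rewrite -H {H}; last first.
- by rewrite -!val_eqE /= Ej eqn_shiftF andbF.
- by rewrite -val_eqE /= Ej eqn_shiftF.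
- by rewrite alpha_join //; apply: val_inj; rewrite /= Ej.
rewrite !(linearD, linearB, linearZ) /= !(contr_Delta_EM two0 phiM phiE copr) //.
rewrite /UKi_inv !(contr_Delta_K phiK copr) -/(UKi_inv i) -/u -!val_eqE /=.
rewrite Ej Ei !eqSS !eqxx !eqn_shiftF /= !(mulr0n, mulr1n, scale0r, mulr0, addr0, add0r).
nc_reduce k [:: UE j : U; UE l; UE i; UKi i; UKi j; UKi_inv i]
  (tt, Kij, Kil, Kji, Kjl, KiV, KKji, KKV, Elj); field; rewrite ?qi0 //.
Qed.

End BlackNeighbours.

(** * The Serre polynomial of the generators, case by case *)

Section Cases.
Variables (k : fieldType) (q : k) (N : nat) (par : 'I_N -> bool).
Hypothesis q0 : q != 0.
Hypothesis q1 : q - q^-1 != 0.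
Local Notation I := 'I_N.-1.
Local Notation U := (U q par).
Local Notation npar := (npar par).
Local Notation q_ i := (qi q par i).
Variables (T : I -> {lrmorphism U -> U}) (black : {set I}) (tau : I -> I) (w : seq I).
Variables (vsig kappa : I -> k).
Hypothesis braid_T : braid_operators T.
Hypothesis w_black : longest_on par black w.
Hypothesis satake : super_satake par black tau w.
Hypothesis adm : admissible par black tau w vsig kappa.
Local Notation X := (TwEK T tau w).
Local Notation B := (B T black tau w vsig kappa).
Local Notation Tw := (Tw T).

Let evB := satake_black_even satake.
Let rw : red black w. Proof. by apply/(redE evB); exact: w_black.1. Qed.
Let wB : word_on black w := rw.1.
Let tauK := satake_tauK satake.

Lemma tau_even i : ~~ npar i -> ~~ npar (tau i).
Proof. by rewrite (satake_tau_par satake). Qed.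

Lemma q_tau i : ~~ npar i -> q_ (tau i) = q_ i.
Proof. by move=> ei; rewrite /qi (tau_dsgn satake wB). Qed.

(** The black generators thus fit the pattern of the white ones. *)
Lemma UF_black i : i \in black -> UF i = - X i.
Proof.
move=> iB; have tB : tau i \in black by rewrite (tau_black satake).
have [E1 E2] := pact_black satake wB tB; rewrite tauK in E1 E2.
rewrite /TwEK -/(Tw w _) (Tw_reversed_E q0 q1 braid_T evB rw tB iB) //.
by rewrite mulNr opprK -mulrA UKVi mulr1.
Qed.

Lemma wtX j : has_wt (wact par w (alpha (tau j))) (Tw w (UE (tau j))).
Proof. exact: (Tw_wt braid_T evB wB (wtE q par (tau j))). Qed.

(** The common factor of the torus elements is supplied by [wform_sym]. *)
Lemma serreX i j : ~~ npar i -> next_to i j -> qserre (q_ i) (X i) (X j) = 0.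
Proof.
move=> ei ij; have := wt_KiV j (wtX i); rewrite (wform_sym satake wB) => bx.
rewrite /TwEK -!/(Tw w _) (qserre_tori (qi_neq0 par q0 i) (wt_KiV i (wtX i))
  (wt_KiV i (wtX j)) bx (UKC q par _ _)) -Tw_qserre -(q_tau ei) serreE ?tau_even //.
  by rewrite Tw0 mul0r scaler0.
exact: (tau_next satake ij).
Qed.

Lemma UF_Tw f l : f \notin black -> l \notin black -> f != l ->
  ~~ (npar f && npar l) -> UF f * Tw w (UE l) = Tw w (UE l) * UF f.
Proof.
move=> fB lB fl pfl; apply: (Tw_commF q0 q1 braid_T evB fB fl pfl rw).
by rewrite (negPf lB).
Qed.

Lemma Tw_fix_E v i : word_on [set l | (~~ npar l) && (i != l) && ~~ next_to l i] v ->
  Tw v (UE i) = UE i.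
Proof.
elim: v => //= l v IH /andP[/[!inE] /andP[/andP[el il] nl] /IH ->].
by rewrite (T_Efar braid_T).
Qed.

Lemma B_black i : i \in black -> B i = UF i.
Proof. by move=> iB; rewrite /Defs.B iB. Qed.

Lemma B_white i : i \notin black ->
  B i = UF i + vsig i *: X i + kappa i *: UKi_inv i.
Proof. by move=> /negPf iB; rewrite /Defs.B iB. Qed.

Lemma kappa_moved i : i \notin black -> tau i != i -> kappa i = 0.
Proof. by move=> iB /eqP ti; apply: (adm_kappa adm iB) => -[[_ H _] _]. Qed.

Lemma kappa_near i j : i \notin black -> j \in black -> next_to j i -> kappa i = 0.
Proof.
move=> iB jB ji; apply: (adm_kappa adm iB) => -[[_ _ H] _].
by have := H j jB; rewrite cartan_next // evB.
Qed.

Lemma Rem_black i j : i \in black -> next_to i j -> qserre (q_ i) (B i) (B j) = 0.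
Proof.
move=> iB ij; have ei := evB iB; have qi0 := qi_neq0 par q0 i.
rewrite (B_black iB); have [jB|jB] := boolP (j \in black).
  by rewrite (B_black jB) serreF.
rewrite (B_white jB) (kappa_near jB iB ij) scale0r addr0.
rewrite qserreDr // serreF // add0r qserreZr // (UF_black iB) qserreNl // serreX //.
by rewrite scaler0.
Qed.

Section WhiteEven.
Variables i j : I.
Hypotheses (ei : ~~ npar i) (ij : next_to i j) (iB : i \notin black).
Let qi0 := qi_neq0 par q0 i.
Let qid := qi_dif par q1 i.
Let ji : next_to j i. Proof. by rewrite next_toC. Qed.
Let wji : wform par (alpha j) (alpha i) = - dsgn par i.
Proof. by rewrite wformC wform_next. Qed.
Let FKj : UF i * UKi_inv j = q_ i *: (UKi_inv j * UF i) :> U.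
Proof. by rewrite (wt_KiV' q0 j (wtF q par i)) wformNr wji opprK. Qed.
Let serreF0 : qserre (q_ i) (UF i : U) (UF j) = 0. Proof. exact: serreF. Qed.

Lemma UF_X : j \notin black -> tau j != i -> UF i * X j = q_ i *: (X j * UF i).
Proof.
move=> jB tji; have C : UF i * Tw w (UE (tau j)) = Tw w (UE (tau j)) * UF i.
  by apply: UF_Tw; rewrite ?(tau_black satake) // 1?eq_sym // (negPf ei).
by rewrite /TwEK -/(Tw w _) mulrA C -!mulrA FKj -scalerAr.
Qed.

Section Fixed.
Hypotheses (ti : tau i = i) (jB : j \notin black).

Let nb l : l \in black -> ~~ next_to i l.
Proof. exact: (white_fix_no_black satake wB iB ei ti ij jB). Qed.

Lemma Tw_fixed : Tw w (UE i) = UE i.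
Proof.
apply: Tw_fix_E; apply: sub_all wB => l lB; rewrite inE evB // next_toC nb // andbT.
by apply: contraNneq iB => ->.
Qed.

Lemma wact_fixed : wact par w (alpha i) = alpha i.
Proof.
rewrite (wact_alpha evB) //.
have H a : a = lo i \/ a = hi i -> pact w a = a.
  move=> aE; apply: (pact_fix wB) => l lB; apply: far_endpoint aE; last exact: nb.
  by apply: contraNneq iB => ->.
by rewrite !H; auto.
Qed.

Lemma X_fixed : X i = UE i * UKi_inv i.
Proof. by rewrite /TwEK -/(Tw w _) ti Tw_fixed. Qed.

Lemma X_UF : X i * UF i = q_ i ^+ 2 *: (UF i * X i) +
  (q_ i ^+ 2 * (q_ i - (q_ i)^-1)^-1) *: (1 - UKi_inv i * UKi_inv i).
Proof.
have KF := KiVFi q ei; have EF := UEF_eq q ei; have KV := UKVi q par i.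
rewrite X_fixed; nc_reduce k [:: UE i : U; UF i; UKi i; UKi_inv i] (tt, KF, EF, KV);
  field; rewrite ?qi0 ?sqr_sub1_neq0 //.
Qed.

(** A node i without black neighbours and fixed by tau lies in I_ns, and its Cartan
    integer with j is odd. *)
Lemma kappa_next_fixed : kappa j = 0.
Proof.
apply: (adm_kappa adm jB) => -[_ /(_ i)]; rewrite cartan_next // => H.
suff : (2 %| -1)%Z by []; apply: H.
  split=> // l lB; rewrite cartan_even ?evB //.
  have := nb lB; rewrite next_toC => /negPf ->.
  by have /negPf -> : l != i by apply: contraNneq iB => <-.
by apply/eqP; exact: next_to_neq.
Qed.

(** F_j commutes up to a scalar with X_i and satisfies the Serre relation with F_i;
    for X_j the roles of F_i and X_i are exchanged. So S(B_i, .) multiplies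
    both summands of B_j by the same q_i vsig_i. *)
Lemma Rem_fixed : qserre (q_ i) (B i) (B j) = (q_ i * vsig i) *: B j.
Proof.
have KF := KiVFi q ei.
have KX : UKi_inv i * X i = q_ i ^- 2 *: (X i * UKi_inv i).
  by rewrite X_fixed mulrA KiVEi // -scalerAl.
rewrite (B_white iB) (B_white jB) kappa_next_fixed scale0r addr0.
rewrite qserreDr // qserreZr //.
rewrite (qserreD_tori_X qi0 qid _ _ (y := UF j) _ _ X_UF KF KX); first last.
- exact: KiVFj.
- rewrite X_fixed -mulrA KiVFj // -scalerAr mulrA UEF_ne ?mulrA //.
    exact: next_to_neq.
  by rewrite (negPf ei).
have FX : UF i * X i = q_ i ^- 2 *: (X i * UF i)
    - (q_ i - (q_ i)^-1)^-1 *: (1 - UKi_inv i * UKi_inv i).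
  rewrite X_UF scalerDr !scalerA mulKf ?expf_neq0 //.
  by rewrite mulVf ?expf_neq0 // scale1r addrK.
have tji : tau j != i.
  by apply: contra (next_to_neq ij) => /eqP tj; rewrite -ti -tj tauK.
have Ky : UKi_inv i * X j = q_ i *: (X j * UKi_inv i).
  rewrite /TwEK -/(Tw w _) mulrA (wt_KiV i (wtX j)) (wform_sym satake wB) ti.
  by rewrite wact_fixed wji opprK -scalerAl -!mulrA (UKC q par _ (- Kvec par j)).
rewrite (qserreD_tori_F qi0 qid _ _ (UF_X jB tji) Ky FX KF KX) serreX // serreF0.
by rewrite scaler0 !add0r scalerDr !scalerA [vsig j * _]mulrC.
Qed.
End Fixed.

(** With w = v s_tau(j), F_j is - T_w(E_tau(j)) K_j^-1, and the bracket is T_w of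
    the bracket of E_tau(i) and E_tau(j), from which T_tau(j) removes
    E_tau(j). *)
Lemma bracket_black : j \in black -> exists2 v, red black (rcons v (tau j)) &
  [/\ pact w =1 pact (rcons v (tau j)) &
  q_ i *: (X i * UF j) - UF j * X i =
    - (Tw v (UE (tau i)) * (UKi_inv j * UKi_inv i))].
Proof.
move=> jB; have tjB : tau j \in black by rewrite (tau_black satake).
have [E1 E2] := pact_black satake wB tjB; rewrite tauK in E1 E2.
have d : rdesc w (tau j) by rewrite /rdesc E1 E2.
have [v [vB sv Ev]] := exchange wB d.
have rv : red black (rcons v (tau j)).
  by apply: (red_eq rw) => //; rewrite ?word_rcons ?tjB // size_rcons.
exists v => //; split=> //.
have etj := tau_even (evB jB); have eti := tau_even ei.
have ntij : next_to (tau j) (tau i) by exact: (tau_next satake ji).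
have qtj : q_ (tau j) = q_ i by rewrite q_tau ?evB // (qi_next q ei (evB jB) ij).
pose x : U := Tw w (UE (tau i)); pose z : U := Tw w (UE (tau j)).
have g : Tw v (UE (tau i)) = x * z - (q_ i)^-1 *: (z * x).
  rewrite /x /z -!TwM -TwZ -TwB (matsumoto braid_T evB _ rw rv Ev) Tw_rcons.
  by rewrite -qtj (T_rank2_bracket q0 q1 braid_T).
have FjE : UF j = - (z * UKi_inv j) by rewrite (UF_black jB).
have Kjx : UKi_inv j * x = (q_ i)^-1 *: (x * UKi_inv j).
  rewrite (wt_KiV j (wtX i)) (wform_sym satake wB) (wact_alpha evB) // E1 E2.
  by rewrite -[_ - _]opprB -/(alpha j) wformNr opprK wform_next // q_dsgnN.
have KiF := KiVFj q ei ij.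
have Kiz : UKi_inv i * z * UKi_inv j = (q_ i)^-1 *: (z * UKi_inv j * UKi_inv i).
  by move: KiF; rewrite FjE mulrN mulNr scalerN mulrA => /oppr_inj.
have XE : X i = x * UKi_inv i by [].
rewrite g XE FjE.
have KC : UKi_inv i * UKi_inv j = UKi_inv j * UKi_inv i :> U by exact: UKC.
transitivity (- (q_ i *: (x * (UKi_inv i * z * UKi_inv j))) + z * (UKi_inv j * x) * UKi_inv i).
  by rewrite mulrN scalerN mulNr opprK !mulrA.
rewrite Kiz Kjx -!scalerAr -!scalerAl scalerA mulfV // scale1r.
by rewrite mulrBl -scalerAl opprB addrC !mulrA.
Qed.

Section Moved.
Hypotheses (ti : tau i != i).

Lemma kappa_i : kappa i = 0. Proof. exact: kappa_moved. Qed.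

Lemma UF_X_moved : UF i * X i = q_ i ^- 2 *: (X i * UF i).
Proof.
have C : UF i * Tw w (UE (tau i)) = Tw w (UE (tau i)) * UF i.
  by apply: UF_Tw; rewrite ?(tau_black satake) // 1?eq_sym // (negPf ei).
have KF := KiVFi q ei; rewrite /TwEK -/(Tw w _); set x := Tw w _ in C *.
nc_reduce k [:: UF i; x; UKi_inv i] (tt, C, KF); field; rewrite ?qi0 //.
Qed.

Lemma X_UF_moved : X i * UF i = q_ i ^+ 2 *: (UF i * X i).
Proof. by rewrite UF_X_moved scalerA mulfV ?expf_neq0 // scale1r. Qed.

Lemma B_moved : B i = UF i + vsig i *: X i.
Proof. by rewrite (B_white iB) kappa_i scale0r addr0. Qed.

(** Each of the three summands of B_j gives zero. If kappa_j is nonzero then j is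
    fixed by tau and orthogonal to the black nodes, and K_j^-1 moves past F_i
    and past X_i with inverse factors. *)
Lemma Rem_moved_white : j \notin black -> tau j != i ->
  qserre (q_ i) (B i) (B j) = 0.
Proof.
move=> jB tj; rewrite B_moved (B_white jB) !qserreDr // !qserreZr //.
have tij : j != tau i by apply: contraNneq tj => ->; rewrite tauK.
have S1 : qserre (q_ i) (UF i + vsig i *: X i) (UF j) = 0.
  rewrite (qserreD_Xcomm qi0 _ X_UF_moved) //.
  have C : UF j * Tw w (UE (tau i)) = Tw w (UE (tau i)) * UF j.
    apply: UF_Tw; rewrite ?(tau_black satake) //.
    by rewrite (negPf (tau_even ei)) andbF.
  by rewrite /TwEK -/(Tw w _) -mulrA KiVFj // -scalerAr !mulrA C.
have S2 : qserre (q_ i) (UF i + vsig i *: X i) (X j) = 0.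
  by rewrite (qserreD_Fcomm qi0 _ UF_X_moved (UF_X jB tj)) serreX // scaler0.
rewrite S1 S2 scaler0 !add0r; have [->|kj] := eqVneq (kappa j) 0.
  by rewrite scale0r.
have [jj jb] : tau j = j /\ wact par w (alpha j) = alpha j.
  have /contrapT [[_ jj nb] _] := contra_not (adm_kappa adm jB) (elimN eqP kj).
  split=> //; rewrite (wact_alpha evB) //.
  have H a : a = lo j \/ a = hi j -> pact w a = a.
    move=> aE; apply: (pact_fix wB) => l lB; apply: far_endpoint aE.
      by apply: contraNneq jB => ->.
    apply/negP => jl; have := nb l lB; rewrite cartan_next ?evB 1?next_toC //.
  by rewrite !H; auto.
have Kjx : UKi_inv j * Tw w (UE (tau i)) = q_ i *: (Tw w (UE (tau i)) * UKi_inv j).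
  rewrite (wt_KiV j (wtX i)) (wform_sym satake wB) jj jb.
  by rewrite wform_next // opprK q_dsgn.
rewrite (qserreD_Fcomm qi0 _ UF_X_moved FKj) qserre_qVcomm ?scaler0 //.
rewrite /TwEK -/(Tw w _) mulrA Kjx -scalerAl scalerA mulVf // scale1r.
by rewrite -!mulrA (UKC q par).
Qed.

Lemma Rem_moved_black : j \in black -> qserre (q_ i) (B i) (B j) = 0.
Proof.
move=> jB; have [v rv [_ bE]] := bracket_black jB.
rewrite B_moved (B_black jB).
rewrite (qserreD_bracket qi0 _ X_UF_moved bE) ?serreF0 ?(UF_black jB).
  by rewrite -[- X j]scaleN1r qserreZr // serreX // !scaler0 addr0.
have C : UF i * Tw v (UE (tau i)) = Tw v (UE (tau i)) * UF i.
  apply: (Tw_commF q0 q1 braid_T evB iB) (red_rcons rv) _.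
  - by rewrite eq_sym.
  - by rewrite (negPf ei).
  - by rewrite (tau_black satake) (negPf iB).
have KF := KiVFi q ei; set x := Tw v _ in C *.
nc_reduce k [:: UF i; x; UKi_inv i; UKi_inv j] (tt, C, KF, FKj);
  field; rewrite ?qi0 //.
Qed.
End Moved.

Variable Delta : {linear U -> tensor U U}.
Hypothesis copr : coproduct Delta.
Hypothesis two0 : 2 != 0 :> k.
Variables (Z : I -> U) (W : I -> I -> U).
Hypothesis Z_spec : forall i, i \notin black -> is_Z Delta T tau w i (Z i).
Hypothesis W_spec : forall i j, i \notin black -> tau i = i -> j \in black ->
  is_W Delta T black tau w i j (Z i) (W i j).

Let KEi := KiEi q ei.
Let KFi := KiFi q ei.
Let KVEi := KiVEi q ei.
Let KVFi := KiVFi q ei.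
Let KEj := KiEj q ei ij.
Let KFj := KiFj q ei ij.
Let KVEj := KiVEj q ei ij.
Let KVFj := KiVFj q ei ij.
Let EFi := UEF_eq q ei.
Let EiFj : UE i * UF j = UF j * UE i :> U.
Proof. by apply: UEF_ne; rewrite ?(next_to_neq ij) ?(negPf ei). Qed.
Let EjFi : UE j * UF i = UF i * UE j :> U.
Proof. by apply: UEF_ne; rewrite ?(next_to_neq ji) ?(negPf ei) ?andbF. Qed.

Lemma Rem_swapped : i = tau j -> qserre (q_ i) (B i) (B j) =
  - (q_ i + (q_ i)^-1) *:
    ((q_ i * vsig j *: Z j + q_ i ^- 2 * vsig i *: Z i) * B i).
Proof.
move=> itj; have ti : tau i = j by rewrite itj tauK.
have jB : j \notin black by rewrite -ti (tau_black satake).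
have ej : ~~ npar j by rewrite -ti tau_even.
have w0 : w = [::].
  move: wB; rewrite (tau_swap_empty satake wB (i := i)) ?ti //.
  by case: (w) => //= a v /andP[]; rewrite inE.
have XE l : X l = UE (tau l) * UKi_inv l by rewrite /TwEK w0.
have ZE l : l \notin black -> ~~ npar l -> Z l = UKi (tau l) * UKi_inv l.
  move=> lB el; have := Z_spec lB; rewrite w0; apply: (Z_empty q0 q1 two0 copr).
  exact: tau_even.
have nij := next_to_neq ij.
rewrite (B_white iB) (B_white jB) (kappa_moved iB) ?ti 1?eq_sym //.
rewrite (kappa_moved jB) -?itj // !scale0r !addr0.
have S0 := serreX ei ij.
rewrite !XE ti -itj in S0 *.
rewrite !ZE // ti -itj.
have qj : q_ j = q_ i by rewrite (qi_next q ei ej ij).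
have bEj := KiEi q ej; have bFj := KiFi q ej; have bVEj := KiVEi q ej.
have bVFj := KiVFi q ej; have bEi := KiEj q ej ji; have bFi := KiFj q ej ji.
have bVEi := KiVEj q ej ji; have bVFi := KiVFj q ej ji; have EFj := UEF_eq q ej.
rewrite !qj in bEj bFj bVEj bVFj bEi bFi bVEi bVFi EFj.
have := qserre_swapped qi0 qid (vsig i) (vsig j) KFi KFj KEi KEj KVFi KVFj KVEi KVEj
  bFi bFj bEi bEj bVFi bVFj bVEi bVEj (UKVi q par i) (UKiV q par i)
  (UKVi q par j) (UKiV q par j) (UKC q par _ _) (UKC q par _ _) (UKC q par _ _)
  (UKC q par _ _) EFi EFj EiFj EjFi.
by rewrite serreF0 S0 scaler0 !add0r.
Qed.

Section FixedBlack.
Hypotheses (ti : tau i = i) (jB : j \in black) (tid : tau =1 id).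
Variable l : I.
Hypotheses (lB : l \in black) (il : next_to i l) (lj : l != j).

Let ej : ~~ npar j. Proof. exact: evB. Qed.
Let el : ~~ npar l. Proof. exact: evB. Qed.

(** Pairwise commuting reflections cannot cancel in a reduced word, so a word that
    fixes alpha_m does not contain m. *)
Lemma fixed_notin u m : red black u -> m \in black -> pact u (lo m) = lo m ->
  pact u (hi m) = hi m -> m \notin u.
Proof.
move=> ru mB; elim/last_ind: u ru => // u c IH ruc El Eh.
have := ruc.1; rewrite word_rcons => /andP[cB _].
have mc : m != c.
  apply/eqP => mc; subst c; have [+ _] := red_rdesc ruc.
  by rewrite /rdesc El Eh /= ltnNge leqnSn.
rewrite mem_rcons inE negb_or mc /=.
have far a : a = lo m \/ a = hi m -> st c a = a.
  by apply: st_far mc _; exact: (black_not_next satake wB tid cB mB).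
apply: IH; first exact: red_rcons ruc.
  by rewrite -{2}El pact_rcons far; auto.
by rewrite -{2}Eh pact_rcons far; auto.
Qed.

(** Write w as u s_l s_j; the letters of u are far from i, j and l, so only T_l and
    T_j act. *)
Lemma Tw_fixed_black : Tw w (UE i) =
  UE j * (UE l * UE i - (q_ i)^-1 *: (UE i * UE l))
  - (q_ i)^-1 *: ((UE l * UE i - (q_ i)^-1 *: (UE i * UE l)) * UE j).
Proof.
have [j1 j2] := pact_black satake wB jB; rewrite tid in j1 j2.
have [l1 l2] := pact_black satake wB lB; rewrite tid in l1 l2.
have dj : rdesc w j by rewrite /rdesc j1 j2.
have [v [vB sv Ev]] := exchange wB dj.
have rv : red black (rcons v j).
  by apply: (red_eq rw) => //; rewrite ?word_rcons ?jB // size_rcons.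
have Evc c : pact v c = pact w (st j c) by rewrite Ev pact_rcons st_st.
have njl : ~~ next_to j l by exact: (next_far ij il lj).
have farj a : a = lo l \/ a = hi l -> st j a = a by apply: st_far.
have farl a : a = lo j \/ a = hi j -> st l a = a.
  by apply: st_far; rewrite 1?eq_sym // next_toC.
have dl : rdesc v l by rewrite /rdesc !Evc !farj ?l1 ?l2; auto.
have [u [uB su Eu]] := exchange vB dl.
have ru : red black (rcons u l).
  by apply: (red_eq (red_rcons rv)) => //; rewrite ?word_rcons ?lB // size_rcons.
have Euc c : pact u c = pact w (st j (st l c)) by rewrite -Evc Eu pact_rcons st_st.
have ju : j \notin u.
  apply: (fixed_notin (red_rcons ru) jB); rewrite Euc farl ?st_lo ?st_hi ?j1 ?j2; auto.
have lu : l \notin u.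
  by apply: (fixed_notin (red_rcons ru) lB); rewrite Euc ?st_lo ?st_hi farj ?l1 ?l2; auto.
have fix_u m : ~~ npar m -> (m = i \/ m = j \/ m = l) -> Tw u (UE m) = UE m.
  move=> em mE; apply: Tw_fix_E; apply/allP => c cu.
  have cB : c \in black by exact: (allP uB).
  have cj : c != j by apply: contraNneq ju => <-.
  have cl : c != l by apply: contraNneq lu => <-.
  have ci : i != c by apply: contraNneq iB => ->.
  rewrite inE evB //=; case: mE => [->|[->|->]].
  - rewrite ci /=; apply: contraNN cj => /(next_unique ij il lj).
    by rewrite (negPf cl) orbF.
  - by rewrite eq_sym cj; exact: (black_not_next satake wB tid cB jB).
  - by rewrite eq_sym cl; exact: (black_not_next satake wB tid cB lB).
rewrite (matsumoto braid_T evB _ rw rv Ev) Tw_rcons.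
rewrite (matsumoto braid_T evB _ (red_rcons rv) ru Eu) Tw_rcons.
have li : next_to l i by rewrite next_toC.
rewrite (T_next braid_T ej ji) linearB linearZ /= !rmorphM /=.
rewrite (T_next braid_T el li) (T_Efar braid_T) // ?(qi_next q el ei li) //; last first.
- by rewrite next_toC.
- by rewrite eq_sym.
rewrite (qi_next q ej ei ji) !(TwB, TwZ, TwM) !fix_u; auto.
Qed.
End FixedBlack.

Lemma Rem_fixed_black : tau i = i -> j \in black ->
  qserre (q_ i) (B i) (B j) =
    vsig i *: ((q_ i - (q_ i)^-1)^-1 *: (q_ i ^+ 2 *: (B j * Z i) - Z i * B j)
       + ((q_ i + (q_ i)^-1) / (q_ j - (q_ j)^-1)) *: (W i j * UKi j)).
Proof.
move=> ti jB.
have tid := white_fix_black_id satake wB iB ti jB.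
have [l [lB il lj]] := white_even_other satake wB tid iB ei ij jB.
have ej := evB jB; have el := evB lB.
have qj : q_ j = q_ i by rewrite (qi_next q ei ej ij).
have XE : X i = (UE j * (UE l * UE i - (q_ i)^-1 *: (UE i * UE l))
    - (q_ i)^-1 *: ((UE l * UE i - (q_ i)^-1 *: (UE i * UE l)) * UE j)) * UKi_inv i.
  by rewrite /TwEK -/(Tw w _) ti (Tw_fixed_black jB tid lB il lj).
have ZE := Z_black q0 q1 two0 copr ei ej el ij il lj XE (Z_spec iB) ti.
have WE := W_black q0 q1 two0 copr braid_T ei ej el ij il lj XE (W_spec iB ti jB).
rewrite (B_black jB) (B_white iB) (kappa_near iB jB ji) scale0r addr0.
rewrite qserre_polar // serreF0 add0r.
have -> : qserre (q_ i) (X i) (UF j) = 0.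
  by rewrite (UF_black jB) -scaleN1r qserreZr // serreX // scaler0.
rewrite scaler0 add0r; congr (_ *: _).
have bEj := KiEi q ej; have bFj := KiFi q ej; have bVEj := KiVEi q ej.
have bVFj := KiVFi q ej; have bEi := KiEj q ej ji; have bFi := KiFj q ej ji.
have bVEi := KiVEj q ej ji; have bVFi := KiVFj q ej ji; have EFj := UEF_eq q ej.
rewrite !qj in bEj bFj bVEj bVFj bEi bFi bVEi bVFi EFj.
have njl : ~~ next_to j l by exact: (next_far ij il lj).
have jl : j != l by rewrite eq_sym.
have wjl : wform par (alpha j) (alpha l) = 0 by exact: wform_far.
have bEl : UKi j * UE l = UE l * UKi j :> U.
  by rewrite (wt_Ki j (wtE q par l)) wjl expr0z scale1r.
have bVEl : UKi_inv j * UE l = UE l * UKi_inv j :> U.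
  by rewrite (wt_KiV j (wtE q par l)) wjl oppr0 expr0z scale1r.
have Elj : UE l * UE j = UE j * UE l :> U by rewrite UE_far // next_toC.
have ElFi : UE l * UF i = UF i * UE l :> U.
  by apply: UEF_ne; rewrite ?(negPf ei) ?andbF // eq_sym next_to_neq.
have ElFj : UE l * UF j = UF j * UE l :> U.
  by apply: UEF_ne; rewrite ?(negPf ej) ?andbF.
have KEl := KiEj q ei il; have KVEl := KiVEj q ei il.
have := qcross_black_pair qi0 qid KFi KFj KEi KEj KEl KVEl KVFi KVFj KVEi KVEj
  bFi bFj bEi bEj bEl bVEl bVFi bVFj bVEi bVEj (UKVi q par i) (UKiV q par i)
  (UKC q par _ _) (UKC q par _ _) (UKC q par _ _)
  (UKC q par _ _) EFi EFj EiFj EjFi ElFi ElFj Elj.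
rewrite /= -XE -ZE => ->; rewrite WE qj.
by rewrite -scalerAl.
Qed.

End WhiteEven.
End Cases.

(** * The theorem *)

Section QVariable.
Variable R : realType.

Lemma qvar_neq0 : qvar R != 0.
Proof. by rewrite /qvar tofrac_eq0 polyX_eq0. Qed.

Lemma qvar_dif : qvar R - (qvar R)^-1 != 0.
Proof.
rewrite subr_eq0; apply/eqP => /(congr1 ( *%R^~ (qvar R))).
rewrite mulVf ?qvar_neq0 // -rmorphM /= -[1](rmorph1 (@tofrac {poly R[i]})).
move=> /eqP; rewrite tofrac_eq => /eqP /(congr1 (fun p : {poly R[i]} => size p)).
by rewrite -expr2 size_polyXn size_poly1.
Qed.

Lemma two_neq0 : 2 != 0 :> Cq R.
Proof.
rewrite -(rmorph_nat (@tofrac {poly R[i]})) tofrac_eq0 -polyC_natr polyC_eq0.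
by rewrite pnatr_eq0.
Qed.
End QVariable.

Lemma Ui_p2 (k : fieldType) (q : k) N (par : 'I_N -> bool)
    (T : 'I_N.-1 -> {lrmorphism U q par -> U q par}) black tau w vsig kappa i j :
  let B_ := B T black tau w vsig kappa in
  Ui T black tau w vsig kappa (p2 q par i j (B_ i) (B_ j)).
Proof.
move=> B_; have UB l : Ui T black tau w vsig kappa (B_ l).
  apply: GenIn; right; exists l; case: ifP => // lB; right.
  by rewrite /B_ /B lB.
have Us a b c x y : Ui T black tau w vsig kappa x -> Ui T black tau w vsig kappa y ->
    Ui T black tau w vsig kappa (sbr a b c x y).
  move=> Ux Uy; rewrite /sbr -scaleNr.
  by apply: GenD; [exact: GenM|apply: GenZ; exact: GenM].
by apply: (Us); [|apply: (Us)]; apply: UB.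
Qed.

Theorem proposition3p10 (R : realType) (m n : nat) (par : 'I_(m + n) -> bool)
    (card_even : #|[set a | ~~ par a]| = m)
    (card_odd : #|[set a | par a]| = n)
    (Delta : {linear U (qvar R) par -> tensor (U (qvar R) par) (U (qvar R) par)})
    (coproduct_Delta : coproduct Delta)
    (T : 'I_(m + n).-1 -> {lrmorphism U (qvar R) par -> U (qvar R) par})
    (braid_T : braid_operators T)
    (black : {set 'I_(m + n).-1}) (tau : 'I_(m + n).-1 -> 'I_(m + n).-1)
    (w : seq 'I_(m + n).-1) (w_black : longest_on par black w)
    (satake : super_satake par black tau w)
    (vsig kappa : 'I_(m + n).-1 -> Cq R)
    (adm : admissible par black tau w vsig kappa)
    (Z : 'I_(m + n).-1 -> U (qvar R) par)
    (Z_spec : forall i, i \notin black -> is_Z Delta T tau w i (Z i))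
    (W : 'I_(m + n).-1 -> 'I_(m + n).-1 -> U (qvar R) par)
    (W_spec : forall i j, i \notin black -> tau i = i -> j \in black ->
      is_W Delta T black tau w i j (Z i) (W i j))
    (i j : 'I_(m + n).-1) (even_i : ~~ npar par i) (adj_ij : adj par i j) :
  let q_ := qi (qvar R) par in
  let B_ := B T black tau w vsig kappa in
  let Rem := p2 (qvar R) par i j (B_ i) (B_ j) in
  Ui T black tau w vsig kappa Rem /\
  Rem =
    if [&& tau i == i, i \notin black & j \notin black] then
      (q_ i * vsig i) *: B_ j
    else if [&& tau i == i, i \notin black & j \in black] then
      vsig i *: ((q_ i - (q_ i)^-1)^-1 *: (q_ i ^+ 2 *: (B_ j * Z i) - Z i * B_ j)
                 + ((q_ i + (q_ i)^-1) / (q_ j - (q_ j)^-1)) *: (W i j * UKi j))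
    else if (i == tau j) && (i \notin black) then
      - (q_ i + (q_ i)^-1) *:
        ((q_ i * vsig j *: Z j + q_ i ^- 2 * vsig i *: Z i) * B_ i)
    else 0.
Proof.
move=> q_ B_ Rem; split; first exact: Ui_p2.
have q0 := qvar_neq0 R; have q1 := qvar_dif R; have two0 := two_neq0 R.
have ij : next_to i j by rewrite -(adjE par).
rewrite /Rem p2E // /B_ /q_.
have evB := satake_black_even satake.
have [iB|iB] := boolP (i \in black).
  by rewrite /= !andbF (Rem_black q0 q1 braid_T w_black satake adm iB ij).
rewrite /= andbT; have [ti|ti] := eqVneq (tau i) i.
  have [jB|jB] /= := boolP (j \in black).
    exact: (Rem_fixed_black q0 q1 braid_T w_black satake adm even_i ij iB
      coproduct_Delta two0 Z_spec W_spec ti jB).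
  exact: (Rem_fixed q0 q1 braid_T w_black satake adm).
have [itj|itj] /= := eqVneq i (tau j).
  exact: (Rem_swapped q0 q1 braid_T w_black satake adm even_i ij iB coproduct_Delta
    two0 Z_spec itj).
have [jB|jB] := boolP (j \in black).
  exact: (Rem_moved_black q0 q1 braid_T w_black satake adm).
apply: (Rem_moved_white q0 q1 braid_T w_black satake adm) => //.
by rewrite eq_sym.
Qed.
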